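(* Assume that the Lindelöf hypothesis is true. Let $d\geq 2$ be an integer, let $1/2<\sigma\leq 1$, let $t\in\mathbb{R}$ and put $s:=\sigma+it$. Then: (i) for almost every $(a_1,\dots,a_d)\in[0,+\infty)^d$, $$\lim_{N\to\infty}\frac{1}{N}\sum_{n=1}^{N}\left|\zeta\left(s+i\left(a_1n+a_2n^2+\dots+a_dn^d\right)\right)\right|^2=\zeta(2\sigma);$$ (ii) for almost every $a\in[0,+\infty)$, $$\lim_{N\to\infty}\frac{1}{N}\sum_{n=1}^{N}\left|\zeta\left(s+ian^d\right)\right|^2=\zeta(2\sigma).$$
   Context: $\zeta$ denotes the Riemann zeta-function. The Lindelöf hypothesis is the statement that for every $\epsilon>0$ one has $\zeta\left(\tfrac12+it\right)\ll_\epsilon |t|^\epsilon$ for $|t|\geq t_0>0$. ''Almost every'' is with respect to Lebesgue measure. *)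

(* Defs.v *)
From HB Require Import structures.
From mathcomp Require Import all_boot all_order all_algebra.
From mathcomp Require Import complex.
From mathcomp Require Import all_classical all_reals all_analysis.

Set Implicit Arguments.
Unset Strict Implicit.
Unset Printing Implicit Defensive.

Import Order.TTheory GRing.Theory Num.Theory.
Import numFieldNormedType.Exports.

Local Open Scope classical_set_scope.
Local Open Scope ring_scope.
Local Open Scope complex_scope.

Definition cexp (R : realType) (z : R[i]) : R[i] :=
  (expR (complex.Re z) * cos (complex.Im z)) +i*
  (expR (complex.Re z) * sin (complex.Im z)).

(* n ^ (- s) for a positive integer n, with the real logarithm of n. *)
Definition dirichlet_term (R : realType) (n : nat) (s : R[i]) : R[i] :=
  cexp (- (s * (ln n%:R)%:C)).

(* The regular module R[i]^o carries the topology of the complex modulus. *)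
Definition csum_to (R : realType) (u : nat -> R[i]) (l : R[i]) : Prop :=
  ((fun N => \sum_(0 <= k < N) u k) : nat -> R[i]^o) @ \oo --> (l : R[i]^o).

Definition analytic_at (R : realType) (f : R[i] -> R[i]) (z0 : R[i]) : Prop :=
  exists c : nat -> R[i], exists r : R, 0 < r /\
    forall z : R[i], `|z - z0| < r%:C ->
      csum_to (fun k => c k * (z - z0) ^+ k) (f z).

(* The Dirichlet series for Re s > 1 together with its analytic continuation
   to the complex plane minus 1.  This determines f everywhere except at the
   pole 1, where the value of f is left arbitrary. *)
Definition is_riemann_zeta (R : realType) (f : R[i] -> R[i]) : Prop :=
  (forall s : R[i], 1 < complex.Re s ->
     csum_to (fun k => dirichlet_term k.+1 s) (f s)) /\
  (forall s : R[i], s != 1 -> analytic_at f s).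

Definition lindelof_hypothesis (R : realType) (zeta : R[i] -> R[i]) : Prop :=
  exists2 t0 : R, 0 < t0 &
    forall eps : R, 0 < eps -> exists K : R,
      forall t : R, t0 <= `|t| ->
        `|zeta (2^-1 +i* t)| <= (K * `|t| `^ eps)%:C.

(* Lebesgue measure on the Borel sets of R^n, as the iterated product of the
   one-dimensional one, transported along R * R^n -> R^n.+1. *)
Fixpoint lebesgue_tuple (R : realType) (n : nat) :
    set (n.-tuple (measurableTypeR R)) -> \bar R :=
  match n return set (n.-tuple (measurableTypeR R)) -> \bar R with
  | 0 => \d_([tuple])
  | m.+1 =>
      pushforward (product_measure1 lebesgue_measure (@lebesgue_tuple R m))
        (fun p : measurableTypeR R * m.-tuple (measurableTypeR R) =>
           cons_tuple p.1 p.2)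
  end.

(* Main.v *)
(* Fix all coefficients but the leading one, so that the heights at which zeta
   is sampled are y n = a n^d + b n with b independent of a.  At such heights zeta
   is approximated by its partial sum of length K = j n^d: the error is
   O(K^(-1/2) + K^(1/2) / |y n|), by comparing k^(-s) with differences of k^(1-s).
   The limit of the corrected partial sums is identified with zeta through
   (1 - 2^(1-s)) zeta(s) = sum_k (-1)^(k-1) k^(-s) and the identity theorem on
   horizontal lines.

   The mean values over a in a bounded interval of the square of the tail of the
   Dirichlet polynomial and of the off-diagonal terms of its initial segment are
   summable along N = j^p, where the initial segment has length X = j^q; so both
   tend to 0 for almost every a, and only the diagonal, which tends to
   zeta(2 sigma), remains.  Since the summands are nonnegative and (j + 1)^p / j^p
   tends to 1, convergence along N = j^p is enough.  Almost every point of R^d is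
   reached by Fubini's theorem with the leading coefficient as inner variable. *)

Require Import Defs.
From HB Require Import structures.
From mathcomp Require Import all_boot all_order all_algebra.
From mathcomp Require Import complex ring lra zify.
From mathcomp Require Import all_classical all_reals all_analysis measurable_realfun.

Set Implicit Arguments.
Unset Strict Implicit.
Unset Printing Implicit Defensive.

Import Order.TTheory GRing.Theory Num.Theory.
Import numFieldNormedType.Exports ComplexField.Normc.

Local Open Scope classical_set_scope.
Local Open Scope ring_scope.
Local Open Scope complex_scope.

(** * Power sums and trigonometric sums *)

(** Origin of the exponents. In the mean over a, the tail beyond X has diagonal part O(X^(-2 eta))
    and off-diagonal part O(K^(1 - eta) / n^d) = O(j K^(-eta)), where K = j n^d; as n >= X = j^q,
    both are O(j^(-2)) once q eta >= 4. Below X there are at most X^2 pairs k <> l, with |ln k - ln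
    l| >= 1/(2X); the squared exponential average of a pair has mean O(X / N^(1/2)), so with the
    weight X^4 the total is X^7 / N^(1/2). For N = j^(2p) the root is the integer j^p, and p >= 7q +
    2 makes this O(j^(-2)). Samples with n < X, where only |zeta| = O(j X^d) is used, contribute
    X^(2d+1) j^2 / N, whence q(2d+1) + 3 <= 2p.

    On the side of zeta, the data are a Dirichlet series for Re s > 1 and unrelated local power
    series elsewhere. The alternating series is the bridge: grouped in pairs it has a locally
    dominated expansion for all Re s > 0, so it can be compared with zeta across Re s = 1. On a line
    Im s = y with y <> 0 the pole is avoided and real power series in one variable suffice. *)

Lemma lnB_ge (R : realType) (a b : R) : 0 < a -> 0 < b ->
  (b - a) / b <= ln b - ln a.
Proof.
move=> a0 b0; have := @le_ln1Dx R (a / b - 1).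
rewrite addrCA subrr addr0 ln_div ?posrE// => /(_ _); move=> h.
have ab0 : 0 < a / b by rewrite divr_gt0.
have : ln a - ln b <= a / b - 1 by apply: h; lra.
by rewrite mulrBl divff ?gt_eqF//; lra.
Qed.

Lemma lnB_le (R : realType) (a b : R) : 0 < a -> 0 < b ->
  ln b - ln a <= (b - a) / a.
Proof.
by move=> a0 b0; have := lnB_ge b0 a0; rewrite -(opprB b a) mulNr; lra.
Qed.

(** Discrete form of comparing [n^(tau - 1)] with the derivative of [n^tau / tau]. With [b = n + 1]
    and [v = tau / b <= 1], [(n / b)^tau <= exp(- v) <= 1 / (1 + v) <= 1 - v / 2]; the last
    inequality costs the factor 2 and covers [n = 0] as well. *)
Lemma powRB1_le (R : realType) (tau : R) (n : nat) : 0 < tau <= 1 ->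
  tau * n.+1%:R `^ (tau - 1) <= 2 * (n.+1%:R `^ tau - n%:R `^ tau).
Proof.
move=> /andP[t0 t1].
have b0 : 0 < n.+1%:R :> R by rewrite ltr0n.
set b : R := n.+1%:R in b0 *.
have bt0 : 0 < b `^ tau by rewrite powR_gt0.
have -> : b `^ (tau - 1) = b `^ tau / b.
  by rewrite powRB ?powRr1 ?(ltW b0)// (gt_eqF b0) implybT.
have b1 : 1 <= b by rewrite /b ler1n.
set v := tau / b.
have v0 : 0 < v by rewrite divr_gt0.
have v1 : v <= 1 by rewrite ler_pdivrMr ?mul1r//; lra.
have -> : tau * (b `^ tau / b) = b `^ tau * v by rewrite /v; ring.
have key : n%:R `^ tau <= b `^ tau * (1 - v / 2).
  case: n => [|n] in b b0 bt0 b1 v v0 v1 *.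
    rewrite powR0 ?gt_eqF//; apply: mulr_ge0; first exact: ltW.
    by lra.
  have n0 : 0 < n.+1%:R :> R by rewrite ltr0n.
  have -> : n.+1%:R `^ tau = b `^ tau * expR (- (tau * (ln b - ln n.+1%:R))).
    by rewrite /powR !gt_eqF// -expRD; congr expR; ring.
  rewrite ler_pM2l//; apply: (@le_trans _ _ (expR (- v))).
    rewrite ler_expR lerN2 /v mulrC [leRHS]mulrC ler_pM2r//.
    have := lnB_ge n0 b0; rewrite /b.
    by rewrite (_ : n.+2%:R - n.+1%:R = 1 :> R) ?mul1r// -natrB// subSnn.
  have e1 := expR_ge1Dx v.
  rewrite expRN -(ler_pM2r (expR_gt0 v)) mulVf ?expR_eq0//.
  have : (1 - v / 2) * (1 + v) <= (1 - v/2) * expR v by rewrite ler_wpM2l//; lra.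
  by nra.
by have := ltW bt0; nra.
Qed.

Lemma sum_powRB1 (R : realType) (tau : R) (M : nat) : 0 < tau <= 1 ->
  \sum_(1 <= m < M.+1) m%:R `^ (tau - 1) <= 2 / tau * M%:R `^ tau.
Proof.
move=> t01; have /andP[t0 t1] := t01.
rewrite -(ler_pM2l t0) mulrA [tau * (_ / _)]mulrC divfK ?gt_eqF//.
elim: M => [|M IH].
  by rewrite big_geq// mulr0 mulr_ge0// powR_ge0.
rewrite big_nat_recr//= mulrDr.
have := powRB1_le M t01.
move: IH. by set X := tau * (\sum_(_ <= _ < _) _); lra.
Qed.

Lemma powRNB1_le (R : realType) (tau : R) (n : nat) : 0 < tau -> (0 < n)%N ->
  tau * n.+1%:R `^ (- 1 - tau) <= n%:R `^ (- tau) - n.+1%:R `^ (- tau).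
Proof.
move=> t0 n0.
have a0 : 0 < n%:R :> R by rewrite ltr0n.
have b0 : 0 < n.+1%:R :> R by rewrite ltr0n.
have bt0 : 0 < n.+1%:R `^ (- tau) :> R by rewrite powR_gt0.
have -> : n.+1%:R `^ (- 1 - tau) = n.+1%:R `^ (- tau) / n.+1%:R :> R.
  by rewrite addrC powRB ?powRr1 ?(ltW b0)// (gt_eqF b0) implybT.
have -> : n%:R `^ (- tau) =
    n.+1%:R `^ (- tau) * expR (tau * (ln n.+1%:R - ln n%:R)) :> R.
  by rewrite /powR !gt_eqF// -expRD; congr expR; ring.
have h : tau / n.+1%:R <= tau * (ln n.+1%:R - ln n%:R).
  rewrite ler_pM2l//; have := lnB_ge a0 b0.
  by rewrite (_ : n.+1%:R - n%:R = 1 :> R) ?div1r// -natrB// subSnn.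
have := expR_ge1Dx (tau * (ln n.+1%:R - ln n%:R)).
set E := expR _ => hE.
have : n.+1%:R `^ (- tau) * (1 + tau / n.+1%:R) <= n.+1%:R `^ (- tau) * E.
  by rewrite ler_pM2l// (le_trans _ hE)// lerD2l.
by rewrite mulrCA; set v := tau / _; lra.
Qed.

Lemma sum_powRNB1 (R : realType) (tau : R) (X K : nat) :
  0 < tau -> (0 < X)%N ->
  \sum_(X.+1 <= k < K) k%:R `^ (- 1 - tau) <= X%:R `^ (- tau) / tau.
Proof.
move=> t0 X0; rewrite ler_pdivlMr// mulrC.
have p0 k : 0 <= k%:R `^ (- tau) :> R by exact: powR_ge0.
case: K => [|K]; first by rewrite big_geq// mulr0.
have [KX|XK] := ltnP K X; first by rewrite big_geq// ?mulr0// ltnW.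
suff : tau * (\sum_(X.+1 <= i < K.+1) i%:R `^ (- 1 - tau)) <=
   X%:R `^ (- tau) - K%:R `^ (- tau).
  by have := p0 K; lra.
elim: K => [|K IH] in XK *; first by move: XK; rewrite leqn0 gtn_eqF.
move: XK; rewrite leq_eqVlt => /predU1P[<-|XK].
  by rewrite big_geq// mulr0 subrr.
rewrite big_nat_recr// mulrDr.
have := @powRNB1_le R tau K t0; rewrite (leq_trans X0 XK) => /(_ isT).
by move: (IH XK); set S := \sum_(_ <= _ < _) _; lra.
Qed.

(** The squared modulus of the exponential sum with coefficients [c k] and phases [th k], kept in
    real form so that real integration applies. *)
Definition trig_sq (R : realType) (I : seq nat) (c th : nat -> R) : R :=
  (\sum_(k <- I) c k * cos (th k)) ^+ 2 + (\sum_(k <- I) c k * sin (th k)) ^+ 2.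

Lemma trig_sqE (R : realType) (I : seq nat) (c th : nat -> R) :
  trig_sq I c th = \sum_(k <- I) \sum_(l <- I) c k * c l * cos (th k - th l).
Proof.
rewrite /trig_sq !expr2 !big_distrlr -big_split/=; apply: eq_bigr => k _.
by rewrite -big_split/=; apply: eq_bigr => l _; rewrite cosB; ring.
Qed.

Lemma trig_sq_ge0 (R : realType) (I : seq nat) (c th : nat -> R) :
  0 <= trig_sq I c th.
Proof. by rewrite addr_ge0// sqr_ge0. Qed.

Lemma is_derive_bigsum (R : realType) (T : Type) (I : seq T) (f : T -> R -> R)
    (df : T -> R) (x : R) :
  (forall k, is_derive x 1 (f k) (df k)) ->
  is_derive x 1 (fun y => \sum_(k <- I) f k y) (\sum_(k <- I) df k).
Proof.
move=> h; elim: I => [|k I IH].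
  rewrite big_nil (_ : (fun _ => _) = cst 0); first exact: is_derive_cst.
  by apply/funext => y; rewrite big_nil.
rewrite big_cons (_ : (fun _ => _) = f k + (fun y => \sum_(k <- I) f k y)).
  exact: is_deriveD.
by apply/funext => y; rewrite big_cons.
Qed.

Lemma continuous_bigsum (R : realType) (S : topologicalType) (T : Type)
    (I : seq T) (f : T -> S -> R) :
  (forall k, continuous (f k)) -> continuous (fun y => \sum_(k <- I) f k y).
Proof.
move=> h; elim: I => [|k I IH].
  rewrite (_ : (fun _ => _) = cst 0); first by move=> x; exact: cvg_cst.
  by apply/funext => y; rewrite big_nil.
rewrite (_ : (fun _ => _) = f k \+ (fun y => \sum_(k <- I) f k y)).
  by move=> x; apply: continuousD; [exact: h|exact: IH].
by apply/funext => y; rewrite big_cons.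
Qed.

Lemma continuous_trig_sq (R : realType) (S : topologicalType) (I : seq nat)
    (c : nat -> R) (th : nat -> S -> R) : (forall k, continuous (th k)) ->
  continuous (fun y => trig_sq I c (th ^~ y)).
Proof.
move=> cth; rewrite (_ : (fun _ => _) = fun y => \sum_(k <- I) \sum_(l <- I)
    c k * c l * cos (th k y - th l y)); last by apply/funext => y; exact: trig_sqE.
apply: continuous_bigsum => k; apply: continuous_bigsum => l x.
apply: (@continuousM _ _ (cst (c k * c l)) (fun y => cos (th k y - th l y))).
  exact: cvg_cst.
apply: (@continuous_comp _ _ _ (fun y => th k y - th l y) (@cos R)).
  by apply: (@continuousB _ _ _ (th k) (th l)); exact: cth.
exact: continuous_cos.
Qed.

Lemma continuous_affine (R : realType) (u v : R) :
  continuous (fun a : R => a * u + v).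
Proof.
move=> y; apply: cvgD; last exact: cvg_cst.
by apply: cvgM; [exact: cvg_id|exact: cvg_cst].
Qed.

(** Expanding the square gives an explicit primitive: pairs [k = l] contribute the length of the
    interval, and each other pair a sine divided by the frequency gap, whose increment is at most 2
    over the gap. *)
Lemma integral_trig_sq_le (R : realType) (A B : R) (I : seq nat)
    (c lam phi : nat -> R) : A < B -> uniq I ->
  {in I &, forall k l, k != l -> lam k != lam l} ->
  (\int[lebesgue_measure]_(a in `[A, B])
     (trig_sq I c (fun k => (a : R) * lam k + phi k))%:E <=
   ((B - A) * (\sum_(k <- I) c k ^+ 2) + \sum_(k <- I) \sum_(l <- I | l != k)
      `|c k * c l| * (2 / `|lam k - lam l|))%:E)%E.
Proof.
move=> AB uI injlam.
(* A primitive of [cos (a * (lam k - lam l) + (phi k - phi l))]; the first branch serves equal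
   frequencies, where the integrand is constant. *)
pose h k l (a : R) := if lam k == lam l then a * cos (phi k - phi l)
  else sin (a * (lam k - lam l) + (phi k - phi l)) / (lam k - lam l).
pose F a := \sum_(k <- I) \sum_(l <- I) c k * c l * h k l a.
have hd k l (x : R) : is_derive x 1 (h k l)
    (cos (x * (lam k - lam l) + (phi k - phi l))).
  rewrite /h; case: eqVneq => [->|kl].
    rewrite subrr mulr0 add0r.
    rewrite (_ : (fun a => _) = cos (phi k - phi l) \*: id); last first.
      by apply/funext => a /=; rewrite /GRing.scale/= mulrC.
    by apply: is_derive_eq; rewrite /GRing.scale/= mulr1.
  rewrite -subr_eq0 in kl; set d := lam k - lam l in kl *; set e := phi k - phi l.
  rewrite (_ : (fun a => _) = d^-1 \*: (sin \o (d \*: id + cst e))); last first.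
    apply/funext => a /=; rewrite /GRing.scale/= mulrC; congr (_ * sin _).
    by rewrite fctE/= mulrC.
  apply: is_derive_eq.
  rewrite /GRing.scale/= fctE/= addr0 mulr1 mulrCA mulVf// mulr1 /GRing.scale/=.
  by congr (cos (_ + _)); rewrite mulrC.
have Fd (x : R) : is_derive x 1 F
    (trig_sq I c (fun k => x * lam k + phi k)).
  rewrite trig_sqE; apply: is_derive_bigsum => k; apply: is_derive_bigsum => l.
  rewrite (_ : (fun _ => _) = (c k * c l) \*: h k l); last first.
    by apply/funext.
  apply: is_derive_eq; rewrite /GRing.scale/=; congr (_ * cos _); ring.
have cF : continuous F.
  move=> x; apply: differentiable_continuous; apply/derivable1_diffP.
  by have [] := Fd x.
have cf : continuous (fun a : R => trig_sq I c (fun k => a * lam k + phi k)).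
  apply: continuous_trig_sq => k y.
  exact: continuous_affine.
rewrite (@continuous_FTC2 _ _ F)//; last 3 first.
- exact/continuous_subspaceT/cf.
- split.
  + by move=> x _; have [] := Fd x.
  + exact/cvg_at_right_filter/cF.
  + exact/cvg_at_left_filter/cF.
- by move=> x _; rewrite derive1E; apply: derive_val.
rewrite -EFinB lee_fin /F -sumrB mulr_sumr -big_split/=.
rewrite big_seq [leRHS]big_seq; apply: ler_sum => k kI.
rewrite -sumrB (bigD1_seq k)//= -mulrBr; apply: lerD.
  rewrite /h eqxx subrr cos0 !mulr1 expr2; lra.
rewrite big_seq_cond [leRHS]big_seq_cond; apply: ler_sum => l /andP[lI lk].
have := injlam _ _ kI lI; rewrite eq_sym => /(_ lk) kl.
rewrite /h !(negbTE kl).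
rewrite -subr_eq0 in kl; set d := lam k - lam l in kl *.
rewrite -mulrBr -mulrBl (le_trans (ler_norm _))// normrM ler_wpM2l// normrM.
rewrite normfV ler_wpM2r ?invr_ge0// (le_trans (ler_normB _ _))//.
by rewrite (_ : 2 = 1 + 1 :> R) ?lerD ?sin_max.
Qed.

Lemma natr_dist (R : realDomainType) (k l : nat) :
  `|k%:R - l%:R| = ((k - l) + (l - k))%:R :> R.
Proof.
have [kl|/ltnW lk] := leqP k l.
  rewrite distrC -natrB// ger0_norm ?ler0n//; congr _%:R; lia.
rewrite -natrB// ger0_norm ?ler0n//; congr _%:R; lia.
Qed.

(** Each distance [m >= 1] from [l] occurs at most twice, once on either side. *)
Lemma sum_dist_le (R : realDomainType) (g : nat -> R) (K l : nat) :
  (forall n, 0 <= g n) -> (l < K)%N ->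
  \sum_(0 <= k < K | k != l) g ((k - l) + (l - k))%N <=
  2 * \sum_(1 <= m < K) g m.
Proof.
move=> g0 lK; have l1 : (l <= K)%N := ltnW lK.
rewrite (big_cat_nat (leq0n l) l1)/= [X in _ + X]big_ltn_cond// eqxx/=.
have -> : 2 * \sum_(1 <= m < K) g m =
  \sum_(1 <= m < K) g m + \sum_(1 <= m < K) g m by ring.
have sub (n : nat) : (n <= K)%N ->
    \sum_(1 <= m < n) g m <= \sum_(1 <= m < K) g m.
  move=> nK; have [n1|n1] := ltnP n 2; last first.
    by rewrite [leRHS](big_cat_nat (ltnW n1) nK)/= lerDl sumr_ge0.
  by rewrite big_geq// sumr_ge0.
apply: lerD.
  apply: le_trans (sub _ lK).
  rewrite big_nat_rev/= add0n [leRHS]big_add1/=.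
  rewrite big_mkcond/= !big_seq; apply: ler_sum => k.
  rewrite mem_index_iota => /andP[_ kl].
  by case: ifP => // _; rewrite (_ : (_ + _)%N = k.+1)//; lia.
apply: le_trans (sub (K - l)%N _); last exact: leq_subr.
rewrite -[l.+1]add1n big_addn big_mkcond/= !big_seq; apply: ler_sum => k.
rewrite mem_index_iota => /andP[_ kl].
by case: ifP => // _; rewrite (_ : (_ + _)%N = k)//; lia.
Qed.

(** A harmonic sum. Using [1 / m <= m^(tau - 1)] it is bounded by a small power of [K] in place of a
    logarithm, so that later estimates involve powers only. *)
Lemma sum_recip_dist (R : realType) (tau : R) (X K l : nat) :
  0 < tau <= 1 -> (l < K)%N ->
  \sum_(X <= k < K | k != l) `|k%:R - l%:R|^-1 <= 4 / tau * K%:R `^ tau.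
Proof.
move=> t01 lK; have /andP[t0 t1] := t01.
pose g (n : nat) : R := n%:R^-1.
have g0 n : 0 <= g n by rewrite invr_ge0.
apply: (@le_trans _ _ (\sum_(0 <= k < K | k != l) g ((k - l) + (l - k))%N)).
  have [XK|KX] := leqP X K; last first.
    by rewrite big_geq ?(ltnW KX)// sumr_ge0.
  rewrite [leRHS](big_cat_nat (leq0n X) XK)/= ler_wpDl ?sumr_ge0//.
  by apply: ler_sum => k _; rewrite natr_dist.
apply: le_trans (sum_dist_le g0 lK) _.
have -> : 4 / tau * K%:R `^ tau = 2 * (2 / tau * K%:R `^ tau) by ring.
rewrite ler_pM2l//.
case: K lK => [|K] lK; first by rewrite big_geq// mulr_ge0 ?powR_ge0 ?divr_ge0 ?ltW.
apply: (@le_trans _ _ (2 / tau * K%:R `^ tau)); last first.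
  rewrite ler_wpM2l ?divr_ge0 ?(ltW t0)//.
  by apply: ge0_ler_powR; rewrite ?nnegrE ?ler_nat// ltW.
apply: le_trans (sum_powRB1 K t01); rewrite !big_seq; apply: ler_sum => m.
rewrite mem_index_iota => /andP[m1 _].
rewrite /g -powR_inv1//; apply: ler_powR; rewrite ?ler1n//; lra.
Qed.

Lemma lnB_norm_ge (R : realType) (k l : nat) : (0 < k)%N -> (0 < l)%N ->
  `|k%:R - l%:R| / (k + l)%:R <= `|ln k%:R - ln l%:R| :> R.
Proof.
wlog kl : k l / (l <= k)%N.
  move=> h k0 l0; have [lk|/ltnW kl] := leqP l k; first exact: h.
  by rewrite distrC addnC [leRHS]distrC; exact: h.
move=> k0 l0; have k0' : 0 < k%:R :> R by rewrite ltr0n.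
have l0' : 0 < l%:R :> R by rewrite ltr0n.
apply: le_trans (ler_norm _); apply: le_trans (lnB_ge l0' k0').
rewrite ger0_norm ?subr_ge0 ?ler_nat//.
rewrite ler_wpM2l ?subr_ge0 ?ler_nat// lef_pV2 ?posrE ?ltr0n ?addn_gt0 ?k0//.
by rewrite ler_nat leq_addr.
Qed.

(** The gap of logarithms is at least [|k - l| / (k + l)]. Distributing [k + l] over
    [k^(- s) * l^(- s)], one factor [n * n^(- s) <= K^(1 - s)] is absorbed, and what remains depends
    on [k] or on [l] alone apart from [1 / |k - l|]. *)
Lemma offdiag_pair_le (R : realType) (sg s : R) (K k l : nat) :
  s <= sg -> s <= 1 -> (0 < k < K)%N -> (0 < l < K)%N -> k != l ->
  `|k%:R `^ (- sg) * l%:R `^ (- sg)| / `|ln k%:R - ln l%:R| <=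
  K%:R `^ (1 - s) * (k%:R `^ (- s) + l%:R `^ (- s)) / `|k%:R - l%:R|.
Proof.
move=> ssg s1 /andP[k0 kK] /andP[l0 lK] kl.
have d0 : 0 < `|k%:R - l%:R| :> R by rewrite normr_gt0 subr_eq0 eqr_nat.
have kl0 : 0 < (k + l)%:R :> R by rewrite ltr0n addn_gt0 k0.
have L := lnB_norm_ge R k0 l0.
have L0 : 0 < `|ln k%:R - ln l%:R| :> R by apply: lt_le_trans L; rewrite divr_gt0.
have dec (n : nat) : (0 < n)%N -> n%:R `^ (- sg) <= n%:R `^ (- s) :> R.
  by move=> n0; apply: ler_powR; rewrite ?ler1n ?lerN2.
have ups (n : nat) : (0 < n < K)%N -> n%:R * n%:R `^ (- s) <= K%:R `^ (1 - s) :> R.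
  move=> /andP[n0 nK]; rewrite -{1}(powRr1 (ler0n R n)) -powRD; last first.
    by rewrite pnatr_eq0 -lt0n n0 implybT.
  by apply: ge0_ler_powR; rewrite ?nnegrE ?ler_nat ?subr_ge0// ltnW.
apply: (@le_trans _ _ (k%:R `^ (- s) * l%:R `^ (- s) * ((k + l)%:R / `|k%:R - l%:R|))).
  rewrite ger0_norm ?mulr_ge0 ?powR_ge0//.
  apply: ler_pM; rewrite ?invr_ge0 ?mulr_ge0 ?powR_ge0//.
    by apply: ler_pM; rewrite ?powR_ge0 ?dec.
  by rewrite -[leRHS]invf_div lef_pV2 ?posrE ?divr_gt0.
rewrite mulrA ler_pM2r ?invr_gt0// natrD.
have := ups _ (introT andP (conj k0 kK)); have := ups _ (introT andP (conj l0 lK)).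
have := powR_ge0 (k%:R : R) (- s); have := powR_ge0 (l%:R : R) (- s).
set a := k%:R `^ _; set b := l%:R `^ _; set c := K%:R `^ _ => b0 a0 hl hk.
have := ler_wpM2l a0 hl; have := ler_wpM2l b0 hk; lra.
Qed.

Lemma offdiag_sum (R : realType) (sg eta : R) (X K : nat) :
  0 < eta <= 1 / 4 -> 1 / 2 + eta <= sg -> (0 < X)%N ->
  \sum_(X <= k < K) \sum_(X <= l < K | l != k)
    `|k%:R `^ (- sg) * l%:R `^ (- sg)| / `|ln k%:R - ln l%:R| <=
  64 / eta * K%:R `^ (1 - eta).
Proof.
move=> /andP[e0 e1] esg X0.
(* Lowering the exponent to [s] gives the final power [2 * (1 - s) + eta = 1 - eta]. As
   [1 - s >= 1 / 4], the constant is [8 * 4 / eta], doubled by the symmetry in [k] and [l]. *)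
pose s := 1 / 2 + eta.
have s1 : s <= 1 by rewrite /s; lra.
have pw0 (n : nat) (x : R) : 0 <= n%:R `^ x by exact: powR_ge0.
pose S := \sum_(X <= k < K) \sum_(X <= l < K | l != k)
  k%:R `^ (- s) / `|k%:R - l%:R|.
have SE : \sum_(X <= k < K) \sum_(X <= l < K | l != k)
    l%:R `^ (- s) / `|k%:R - l%:R| = S.
  under eq_bigr do rewrite big_mkcond/=.
  rewrite exchange_big/=; apply: eq_bigr => k _; rewrite [RHS]big_mkcond/=.
  by apply: eq_bigr => l _; rewrite eq_sym distrC.
have S_le : S <= 32 / eta * K%:R `^ (1 - s + eta).
  apply: (@le_trans _ _ (\sum_(X <= k < K) k%:R `^ (- s) * (4 / eta * K%:R `^ eta))).
    rewrite /S !big_seq; apply: ler_sum => k; rewrite mem_index_iota => /andP[_ kK].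
    rewrite -mulr_sumr ler_wpM2l//.
    apply: le_trans (@sum_recip_dist R eta X K k _ kK); last lra.
    by rewrite le_eqVlt; apply/orP; left; apply/eqP/eq_bigr => l _; rewrite distrC.
  rewrite -mulr_suml.
  have -> : 32 / eta * K%:R `^ (1 - s + eta) =
      (8 * K%:R `^ (1 - s)) * (4 / eta * K%:R `^ eta).
    rewrite powRD; last by rewrite /s; apply/implyP => /eqP h; lra.
    by ring.
  rewrite ler_wpM2r ?mulr_ge0 ?invr_ge0 ?(ltW e0)//.
  case: K {S SE} => [|K]; first by rewrite big_geq// mulr_ge0.
  apply: (@le_trans _ _ (\sum_(1 <= k < K.+1) k%:R `^ (- s))).
    have [XK|KX] := leqP X K.+1; last by rewrite big_geq ?sumr_ge0 ?(ltnW KX).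
    by rewrite [leRHS](big_cat_nat X0 XK)/= ler_wpDl ?sumr_ge0.
  have ts : 0 < 1 - s <= 1 by rewrite /s; lra.
  have := sum_powRB1 K ts; rewrite (_ : 1 - s - 1 = - s); last ring.
  move=> /le_trans; apply; apply: ler_pM; rewrite ?divr_ge0//; first lra.
    rewrite ler_pdivrMr; rewrite /s; lra.
  by apply: ge0_ler_powR; rewrite ?nnegrE ?ler_nat//; lra.
apply: (@le_trans _ _ (K%:R `^ (1 - s) * (S + S))).
  rewrite -{2}SE -big_split/= mulr_sumr !big_seq; apply: ler_sum => k.
  rewrite mem_index_iota => /andP[Xk kK]; rewrite -big_split/= mulr_sumr.
  rewrite big_seq_cond [leRHS]big_seq_cond; apply: ler_sum => l.
  rewrite mem_index_iota => /andP[/andP[Xl lK] lk]; rewrite -mulrDl mulrA.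
  by apply: offdiag_pair_le; rewrite // ?kK ?lK ?(leq_trans X0)// eq_sym.
apply: (@le_trans _ _ (K%:R `^ (1 - s) * (64 / eta * K%:R `^ (1 - s + eta)))).
  by rewrite ler_wpM2l//; lra.
rewrite mulrCA ler_wpM2l ?divr_ge0 ?(ltW e0)// -powRD; last first.
  by rewrite /s; apply/implyP => /eqP h; lra.
by rewrite le_eqVlt; apply/orP; left; apply/eqP; congr (_ `^ _); rewrite /s; lra.
Qed.

(** * The mean value theorem in the leading coefficient *)

Lemma continuous_EFin_measurable (R : realType) (D : set (measurableTypeR R))
    (f : R -> R) : continuous f -> measurable_fun D (fun x => (f x)%:E).
Proof.
move=> cf; apply/measurable_EFinP/measurable_funTS.
exact: continuous_measurable_fun.
Qed.

(** The bound is bundled with continuity and nonnegativity so that measurability and additivity of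
    the integral come for free when bounds are summed or scaled. *)
Definition int_le (R : realType) (D : set R) (f : R -> R) (C : R) :=
  [/\ continuous f, forall x, 0 <= f x &
      (\int[lebesgue_measure]_(x in D) (f x)%:E <= C%:E)%E].

Lemma int_leD (R : realType) (D : set R) (f g : R -> R) (C C' : R) :
  measurable D -> int_le D f C -> int_le D g C' ->
  int_le D (fun x => f x + g x) (C + C').
Proof.
move=> mD [cf f0 fC] [cg g0 gC]; split.
- by move=> x; apply: cvgD; [exact: cf|exact: cg].
- by move=> x; rewrite addr_ge0.
- under eq_integral do rewrite EFinD.
  rewrite ge0_integralD//; [|by move=> x _; rewrite lee_fin| |
    by move=> x _; rewrite lee_fin|].
  + by rewrite EFinD; apply: leeD.
  + exact: continuous_EFin_measurable.
  + exact: continuous_EFin_measurable.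
Qed.

Lemma int_leZ (R : realType) (D : set R) (f : R -> R) (a C : R) :
  measurable D -> 0 <= a -> int_le D f C -> int_le D (fun x => a * f x) (a * C).
Proof.
move=> mD a0 [cf f0 fC]; split.
- by move=> x; apply: cvgM; [exact: cvg_cst|exact: cf].
- by move=> x; rewrite mulr_ge0.
- under eq_integral do rewrite EFinM.
  rewrite ge0_integralZl//; [|
    exact: continuous_EFin_measurable|].
    by rewrite EFinM lee_wpmul2l// lee_fin.
  by move=> x _; rewrite lee_fin.
Qed.

Lemma int_le_sum (R : realType) (D : set R) (I : seq nat) (P : pred nat)
    (f : nat -> R -> R) (C : nat -> R) :
  measurable D -> (forall k, k \in I -> P k -> int_le D (f k) (C k)) ->
  int_le D (fun x => \sum_(k <- I | P k) f k x) (\sum_(k <- I | P k) C k).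
Proof.
move=> mD; elim: I => [|k I IH] h.
  rewrite big_nil (_ : (fun _ => _) = cst 0); last first.
    by apply/funext => x; rewrite big_nil.
  split => //; first by move=> x; exact: cvg_cst.
  by rewrite integral0_eq.
have IH' : int_le D (fun x => \sum_(k <- I | P k) f k x) (\sum_(k <- I | P k) C k).
  by apply: IH => l lI; apply: h; rewrite inE lI orbT.
rewrite big_cons; have [Pk|Pk] := boolP (P k); last first.
  rewrite (_ : (fun _ => _) = fun x => \sum_(k <- I | P k) f k x)//.
  by apply/funext => x; rewrite big_cons (negbTE Pk).
rewrite (_ : (fun _ => _) = fun x => f k x + \sum_(k <- I | P k) f k x).
  by apply: int_leD => //; apply: h => //; rewrite inE eqxx.
by apply/funext => x; rewrite big_cons Pk.
Qed.

Lemma int_le_le (R : realType) (D : set R) (f : R -> R) (C C' : R) :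
  int_le D f C -> C <= C' -> int_le D f C'.
Proof.
by move=> [cf f0 h] CC'; split=> //; apply: le_trans h _; rewrite lee_fin.
Qed.

Lemma int_le_trig_sq (R : realType) (A B : R) (I : seq nat)
    (c lam phi : nat -> R) : A < B -> uniq I ->
  {in I &, forall k l, k != l -> lam k != lam l} ->
  int_le `[A, B] (fun a => trig_sq I c (fun k => a * lam k + phi k))
   ((B - A) * (\sum_(k <- I) c k ^+ 2) + \sum_(k <- I) \sum_(l <- I | l != k)
      `|c k * c l| * (2 / `|lam k - lam l|)).
Proof.
move=> AB uI h; split; last exact: integral_trig_sq_le.
- by apply: continuous_trig_sq => k; exact: continuous_affine.
- by move=> x; exact: trig_sq_ge0.
Qed.

(* [dir_sq sg X K y = |sum_(X <= k < K) k^(- sg - i y)|^2]. *)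
Definition dir_sq (R : realType) (sg : R) (X K : nat) (y : R) :=
  trig_sq (index_iota X K) (fun k => k%:R `^ (- sg)) (fun k => y * ln k%:R).

(** At height [a * u + b] the frequencies in [a] are [u * ln k]. The diagonal is the tail of
    [k^(- 1 - 2 eta)], bounded from [X - 1] on; the off-diagonal part is [offdiag_sum] times
    [2 / u]. *)
Lemma int_le_dir_sq (R : realType) (A B sg eta u b : R) (X K : nat) :
  A < B -> 0 < u -> 0 < eta <= 1 / 4 -> 1 / 2 + eta <= sg -> (1 < X)%N ->
  int_le `[A, B] (fun a => dir_sq sg X K (a * u + b))
   ((B - A) * (X.-1%:R `^ (- (2 * eta)) / (2 * eta)) +
    128 / eta * K%:R `^ (1 - eta) / u).
Proof.
move=> AB u0 e01 esg X1; have /andP[e0 e1] := e01.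
have E : (fun a => dir_sq sg X K (a * u + b)) = (fun a : R =>
    trig_sq (index_iota X K) (fun k => k%:R `^ (- sg))
      (fun k => a * (u * ln k%:R) + b * ln k%:R)).
  apply/funext => a; rewrite /dir_sq; congr trig_sq.
  by apply/funext => k; ring.
have X0 : (0 < X)%N by exact: ltnW.
rewrite E; apply: (int_le_le (int_le_trig_sq _ _ AB (iota_uniq _ _) _)).
  move=> k l; rewrite !mem_index_iota => /andP[Xk _] /andP[Xl _] kl.
  rewrite (inj_eq (mulfI (lt0r_neq0 u0))).
  apply: contra kl => /eqP /ln_inj; rewrite !posrE !ltr0n.
  by move=> /(_ (leq_trans X0 Xk) (leq_trans X0 Xl)) /eqP; rewrite eqr_nat.
apply: lerD.
  rewrite ler_wpM2l ?subr_ge0 ?(ltW AB)//.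
  have te : 0 < 2 * eta by lra.
  have := @sum_powRNB1 R (2 * eta) X.-1 K te.
  rewrite -ltnS prednK// => /(_ X1); apply: le_trans.
  rewrite !big_seq; apply: ler_sum => k; rewrite mem_index_iota => /andP[Xk _].
  rewrite -powR_mulrn ?powR_ge0// -powRrM; apply: ler_powR; last lra.
  by rewrite ler1n (leq_trans X0).
rewrite -[leRHS]mulrA -[128]/(64 * 2)%N%:R.
have -> : 128 / eta * (K%:R `^ (1 - eta) / u) =
    (2 / u) * (64 / eta * K%:R `^ (1 - eta)) by ring.
apply: (@le_trans _ _ (2 / u * \sum_(X <= k < K) \sum_(X <= l < K | l != k)
    `|k%:R `^ (- sg) * l%:R `^ (- sg)| / `|ln k%:R - ln l%:R|)); last first.
  by rewrite ler_wpM2l ?divr_ge0 ?(ltW u0)//; exact: offdiag_sum.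
rewrite le_eqVlt; apply/orP; left; apply/eqP.
rewrite mulr_sumr; apply: eq_bigr => k _; rewrite mulr_sumr; apply: eq_bigr => l _.
rewrite -mulrBr [`|u * _|]normrM (gtr0_norm u0) invfM; ring.
Qed.

(* The weight [X ^ 4] makes each of the at most [X ^ 2] exponential averages
   smaller than [sqrt correlation / X ^ 2]. *)
Definition correlation (R : realType) (X N : nat) (y : nat -> R) :=
  X%:R ^+ 4 * \sum_(1 <= k < X) \sum_(1 <= l < X | l != k)
    trig_sq (index_iota X N) (fun=> N%:R^-1) (fun n => y n * (ln k%:R - ln l%:R)).

(** The frequencies [n^d * th] are spaced at least as widely as [n * th], and [|th| >= 1 / (2X)]
    turns each pair into [4X / |l - n|]. The harmonic sum with exponent 1/2 is at most [8 * sqrt N],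
    so [N] rows of weight [N^(-2)] give [32 X / sqrt N]. *)
Lemma int_le_corr_term (R : realType) (A B th : R) (d X N : nat) (b : nat -> R) :
  A < B -> (0 < d)%N -> (0 < X)%N -> (2 * X%:R)^-1 <= `|th| ->
  int_le `[A, B] (fun a => trig_sq (index_iota X N) (fun=> N%:R^-1)
      (fun n => (a * n%:R ^+ d + b n) * th))
   ((B - A) / N%:R + 32 * X%:R / Num.sqrt N%:R).
Proof.
move=> AB d0 X0 Xth.
have th0 : 0 < `|th| by apply: lt_le_trans Xth; rewrite invr_gt0 mulr_gt0 ?ltr0n.
have E : (fun a : R => trig_sq (index_iota X N) (fun=> N%:R^-1)
      (fun n => (a * n%:R ^+ d + b n) * th)) = (fun a : R =>
    trig_sq (index_iota X N) (fun=> N%:R^-1)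
      (fun n => a * (n%:R ^+ d * th) + b n * th)).
  by apply/funext => a; congr trig_sq; apply/funext => k; ring.
(* The cofactor of [k - l] in [k^d - l^d] contains [k^(d - 1) >= 1]. *)
have dist (k l : nat) : (0 < k)%N -> `|k%:R - l%:R| <= `|k%:R ^+ d - l%:R ^+ d| :> R.
  move=> k0; rewrite subrXX normrM -[leLHS]mulr1 ler_wpM2l//.
  case: d d0 {E} => // d _; rewrite big_ord_recl/= expr0 mulr1 subn0/=.
  rewrite ger0_norm ?addr_ge0 ?exprn_ge0 ?sumr_ge0//.
  apply: ler_wpDr; last by rewrite exprn_ege1 ?ler1n.
  by apply: sumr_ge0 => i _; rewrite mulr_ge0 ?exprn_ge0.
rewrite E; apply: (int_le_le (int_le_trig_sq _ _ AB (iota_uniq _ _) _)).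
  move=> k l; rewrite !mem_index_iota => /andP[Xk _] /andP[Xl _] kl.
  rewrite (inj_eq (mulIf _)); last by rewrite -normr_gt0.
  rewrite -subr_eq0 -normr_gt0 (lt_le_trans _ (dist _ _ (leq_trans X0 Xk)))//.
  by rewrite normr_gt0 subr_eq0 eqr_nat.
have N0 : 0 <= N%:R^-1 :> R by rewrite invr_ge0.
have sN : (N - X)%:R * N%:R^-1 <= 1 :> R.
  have [->|Nn0] := eqVneq N 0%N; first by rewrite invr0 mulr0.
  by rewrite ler_pdivrMr ?mul1r ?ler_nat ?leq_subr// ltr0n lt0n.
apply: lerD.
  rewrite ler_wpM2l ?subr_ge0 ?(ltW AB)// sumr_const_nat -[_ *+ (N - X)]mulr_natl expr2 mulrA.
  by rewrite -[leRHS]mul1r ler_wpM2r.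
apply: (@le_trans _ _ (\sum_(X <= n < N) (N%:R^-1 ^+ 2 * (4 * X%:R)) *
   (4 / 2^-1 * N%:R `^ 2^-1))).
  rewrite !big_seq; apply: ler_sum => n; rewrite mem_index_iota => /andP[Xn nN].
  have n0 : (0 < n)%N by exact: leq_trans Xn.
  have h01 : 0 < (2^-1 : R) <= 1 by apply/andP; split; lra.
  apply: (@le_trans _ _ (N%:R^-1 ^+ 2 * (4 * X%:R) *
      \sum_(X <= l < N | l != n) `|l%:R - n%:R|^-1)); last first.
    by rewrite ler_wpM2l ?mulr_ge0 ?sqr_ge0//; exact: sum_recip_dist.
  rewrite mulr_sumr big_seq_cond [leRHS]big_seq_cond; apply: ler_sum => l.
  rewrite mem_index_iota => /andP[/andP[Xl lN] ln].
  rewrite -mulrA ger0_norm ?mulr_ge0// -expr2 ler_wpM2l ?sqr_ge0//.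
  have -> : 4 * X%:R * `|l%:R - n%:R|^-1 = 2 * (`|l%:R - n%:R|^-1 * (2 * X%:R)) :> R.
    by ring.
  rewrite ler_wpM2l// -mulrBl normrM invfM ler_pM ?invr_ge0//; last first.
    by rewrite -[leRHS]invrK lef_pV2 ?posrE ?invr_gt0 ?mulr_gt0 ?ltr0n.
  rewrite [`|l%:R - _|]distrC lef_pV2 ?posrE; first exact: dist.
    rewrite (lt_le_trans _ (dist _ _ n0))//.
    by rewrite normr_gt0 subr_eq0 eqr_nat eq_sym.
  by rewrite normr_gt0 subr_eq0 eqr_nat eq_sym.
rewrite sumr_const_nat -[_ *+ (N - X)]mulr_natl powR12_sqrt//.
have -> : (N - X)%:R * (N%:R^-1 ^+ 2 * (4 * X%:R) * (4 / 2^-1 * Num.sqrt N%:R)) =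
   ((N - X)%:R * N%:R^-1) * (32 * X%:R * (N%:R^-1 * Num.sqrt N%:R)) :> R by rewrite invrK; ring.
have -> : N%:R^-1 * Num.sqrt N%:R = (Num.sqrt N%:R)^-1 :> R.
  have [->|Nn0] := eqVneq (N%:R : R) 0; first by rewrite sqrtr0 invr0 mul0r.
  rewrite -{1}(@sqr_sqrtr _ N%:R)// expr2 invfM -mulrA mulVf ?mulr1//.
  by rewrite gt_eqF// sqrtr_gt0 lt0r Nn0 ler0n.
by rewrite -[leRHS]mul1r ler_wpM2r// mulr_ge0 ?invr_ge0 ?sqrtr_ge0.
Qed.

(* At height [y n ~ n ^ d], zeta is replaced by its Dirichlet polynomial of
   length [j * n ^ d]; the first summand is the mean square of the part beyond
   [X = j ^ q], the second controls the off-diagonal terms below [X]. *)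
Definition defect (R : realType) (sg : R) (d p q j : nat) (y : nat -> R) :=
  (j ^ p)%:R^-1 * (\sum_(j ^ q <= n < j ^ p)
     dir_sq sg (j ^ q) (j * n ^ d) (y n)) + correlation (j ^ q) (j ^ p) y.

Lemma powR_nat_le (R : realType) (j m X : nat) (x : R) :
  (0 < j)%N -> (j ^ m <= X)%N -> 0 <= x ->
  X%:R `^ (- x) <= j%:R `^ (- (m%:R * x)) :> R.
Proof.
move=> j0 jX x0; have jm0 : 0 < (j ^ m)%:R :> R by rewrite ltr0n expn_gt0 j0.
have X0 : 0 < X%:R :> R by rewrite (lt_le_trans jm0)// ler_nat.
rewrite -mulrN powRrM powR_mulrn// -natrX !powRN lef_pV2 ?posrE ?powR_gt0//.
by apply: ge0_ler_powR; rewrite ?nnegrE ?ler_nat.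
Qed.

(** The three summands of the constant are the diagonal of the tail, the off-diagonal of the tail
    and the correlations. The exponent [p.*2] makes the square root of the number of samples equal
    to [j^p]. *)
Lemma int_le_defect (R : realType) (A B sg eta : R) (d p q j : nat) (b : nat -> R) :
  A < B -> (0 < d)%N -> 0 < eta <= 1 / 4 -> 1 / 2 + eta <= sg ->
  4 <= q%:R * eta -> (7 * q + 2 <= p)%N -> (1 < j)%N ->
  int_le `[A, B] (fun a => defect sg d p.*2 q j (fun n => a * n%:R ^+ d + b n))
   (((B - A) / (2 * eta) + 128 / eta + (B - A + 32)) / j%:R ^+ 2).
Proof.
move=> AB d0 e01 esg qe pq j1; have /andP[e0 e1] := e01.
have j0 : (0 < j)%N by exact: ltnW.
have jR0 : 0 < j%:R :> R by rewrite ltr0n.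
have jR1 : 1 <= j%:R :> R by rewrite ler1n.
have BA0 : 0 <= B - A by rewrite subr_ge0 ltW.
have mAB : measurable (`[A, B]%classic : set (measurableTypeR R)) by [].
have q1 : (1 < q)%N.
  by rewrite -(ltr_nat R); have := ler_wpM2r (ltW e0) (ler0n R q); nra.
set X := (j ^ q)%N; set N := (j ^ p.*2)%N.
have X1 : (1 < X)%N by rewrite -(exp1n q) /X ltn_exp2r ?(ltnW q1).
have X0 : (0 < X)%N by exact: ltnW.
have N0 : (0 < N)%N by rewrite expn_gt0 j0.
have jm (x : R) : 2 <= x -> j%:R `^ (- x) <= (j%:R ^+ 2)^-1.
  by move=> x2; rewrite -powR_invn ?(ltW jR0)// ler_powR// lerN2.
have XR1 : 1 <= X%:R :> R by rewrite ler1n.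
rewrite (mulrDl (_ + _) (B - A + 32)); apply: int_leD => //.
  pose c := ((B - A) / (2 * eta) + 128 / eta) / j%:R ^+ 2.
  have c0 : 0 <= c.
    by rewrite /c divr_ge0 ?exprn_ge0 ?addr_ge0 ?divr_ge0 ?mulr_ge0// ltW.
  apply: (int_le_le (C := N%:R^-1 * \sum_(X <= n < N) c)); last first.
    rewrite sumr_const_nat -[_ *+ (N - X)]mulr_natl mulrA.
    rewrite -[leRHS]mul1r ler_wpM2r// mulrC ler_pdivrMr ?ltr0n// mul1r ler_nat.
    exact: leq_subr.
  apply: int_leZ => //.
  apply: int_le_sum => // n; rewrite mem_index_iota => /andP[Xn nN] _.
  have n0 : (0 < n)%N by exact: leq_trans Xn.
  have nd0 : 0 < n%:R ^+ d :> R by rewrite exprn_gt0// ltr0n.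
  apply: int_le_le (int_le_dir_sq (b n) _ AB nd0 e01 esg X1) _.
  rewrite /c [leRHS]mulrDl lerD//.
    rewrite -!mulrA ler_wpM2l// [leLHS]mulrC ler_wpM2l ?invr_ge0 ?mulr_ge0 ?(ltW e0)//.
    (* [X - 1 >= j^(q - 1)], and [2 * eta * (q - 1) >= 2] because [q * eta >= 4] and
       [eta <= 1 / 4]. *)
    apply: le_trans (powR_nat_le j0 (m := q.-1) _ _) _; last 2 first.
    - by rewrite mulr_ge0// ltW.
    - apply: jm; rewrite -subn1 natrB ?(ltnW q1)//; nra.
    rewrite -ltnS prednK// /X -[q in (_ < _ ^ q)%N]prednK ?(ltnW q1)//.
    by rewrite ltn_exp2l.
  rewrite -!mulrA ler_wpM2l// ler_wpM2l ?invr_ge0 ?(ltW e0)//.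
  have Kq : (j ^ q <= j * n ^ d)%N.
    apply: leq_trans Xn _; apply: leq_trans (leq_pmull _ j0).
    by rewrite -{1}(expn1 n) leq_pexp2l.
  have K0 : (0 < j * n ^ d)%N by rewrite muln_gt0 j0 expn_gt0 n0.
  rewrite powRB ?pnatr_eq0 -?lt0n ?K0 ?implybT// powRr1// -powRN.
  set P := _ `^ (- eta).
  have -> : (j * n ^ d)%:R * P / n%:R ^+ d = j%:R * P.
    by rewrite natrM natrX; field; rewrite gt_eqF// ltr0n.
  (* The length [j * n^d] exceeds the derivative [n^d] of the height in [a] only by the factor [j],
     and its power [- eta] is at most [j^(- q eta) <= j^(- 4)]. *)
  apply: (@le_trans _ _ (j%:R * j%:R `^ (- 4))).
    rewrite ler_wpM2l// (le_trans (powR_nat_le j0 Kq (ltW e0)))//.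
    by rewrite ler_powR// lerN2.
  rewrite -{1}(powRr1 (ltW jR0)) -powRD; last by rewrite (gt_eqF jR0) implybT.
  by rewrite (_ : 1 - 4 = - 3 :> R) ?jm//; lra.
rewrite /correlation.
pose c' := (B - A + 32) * X%:R / j%:R ^+ p.
have c'0 : 0 <= c'.
  by apply: divr_ge0; [apply: mulr_ge0 => //; lra|exact: exprn_ge0].
apply: (int_le_le (C := X%:R ^+ 4 * (\sum_(1 <= k < X) \sum_(1 <= l < X | l != k) c'))).
  apply: int_leZ; rewrite ?exprn_ge0//.
  apply: int_le_sum => // k; rewrite mem_index_iota => /andP[k0 kX] _.
  apply: int_le_sum => // l; rewrite mem_index_iota => /andP[l0 lX] lk.
  apply: (int_le_le (int_le_corr_term N b AB d0 X0 _)); last first.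
    rewrite /c' -[leRHS]mulrA [leRHS]mulrDl lerD//.
      rewrite ler_wpM2l// (@le_trans _ _ (j%:R ^+ p)^-1)//.
        rewrite lef_pV2 ?posrE ?ltr0n ?exprn_gt0// /N natrX -addnn exprD.
        by rewrite -[leLHS]mul1r ler_wpM2r ?exprn_ge0// exprn_ege1.
      by rewrite -[leLHS]mul1r ler_wpM2r// invr_ge0 exprn_ge0.
    by rewrite mulrA /N natrX -muln2 exprM sqrtr_sqr ger0_norm ?exprn_ge0.
  apply: le_trans (lnB_norm_ge R k0 l0).
  rewrite -[leLHS]mul1r ler_pM ?invr_ge0 ?mulr_ge0//.
    rewrite natr_dist ler1n; move: lk; lia.
  rewrite lef_pV2 ?posrE ?mulr_gt0 ?ltr0n ?addn_gt0 ?k0// -natrM ler_nat; lia.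
apply: (@le_trans _ _ (X%:R ^+ 4 * (X%:R * (X%:R * c')))).
  rewrite ler_wpM2l ?exprn_ge0//.
  apply: (@le_trans _ _ (\sum_(1 <= k < X) (X%:R * c'))).
    apply: ler_sum => k _.
    apply: (@le_trans _ _ (\sum_(1 <= l < X) c')).
      by rewrite big_mkcond/=; apply: ler_sum => l _; case: ifP.
    rewrite sumr_const_nat -[_ *+ (X - 1)]mulr_natl ler_wpM2r// ler_nat.
    exact: leq_subr.
  rewrite sumr_const_nat -[_ *+ (X - 1)]mulr_natl; apply: ler_wpM2r.
    exact: mulr_ge0.
  by rewrite ler_nat leq_subr.
rewrite /c'.
have -> : X%:R ^+ 4 * (X%:R * (X%:R * ((B - A + 32) * X%:R / j%:R ^+ p))) =
  (B - A + 32) * (X%:R ^+ 7 / j%:R ^+ p) by ring.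
apply: ler_wpM2l; first lra.
rewrite ler_pdivrMr ?exprn_gt0// mulrC ler_pdivlMr ?exprn_gt0//.
rewrite /X natrX -exprM -exprD ler_weXn2l// mulnC; exact: pq.
Qed.

Lemma sum_inv_sqr (R : realType) (n : nat) :
  \sum_(0 <= j < n) (j.+2%:R ^+ 2)^-1 <= 1 :> R.
Proof.
suff : \sum_(0 <= j < n) (j.+2%:R ^+ 2)^-1 <= 1 - n.+1%:R^-1 :> R.
  by move=> /le_trans; apply; rewrite gerBl.
elim: n => [|n IH]; first by rewrite big_geq// invr1 subrr.
rewrite big_nat_recr//=; apply: le_trans (lerD IH (lexx _)) _.
have a0 : 0 < n.+1%:R :> R by rewrite ltr0n.
have b0 : 0 < n.+2%:R :> R by rewrite ltr0n.
have E : n.+1%:R^-1 - n.+2%:R^-1 = (n.+1%:R * n.+2%:R)^-1 :> R.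
  rewrite -(natr1 n.+1) in b0 *; field.
  by rewrite !gt_eqF.
have : (n.+2%:R ^+ 2)^-1 <= (n.+1%:R * n.+2%:R)^-1 :> R.
  by rewrite lef_pV2 ?posrE ?mulr_gt0// expr2 ler_pM2r// ler_nat.
rewrite -E; set u := n.+1%:R^-1; set v := n.+2%:R^-1.
by set w := (_ ^+ 2)^-1; move: u v w => u v w; lra.
Qed.

(** By monotone convergence the sum of all [f j] is integrable on [D], hence finite almost
    everywhere, and the terms of a convergent series tend to 0. *)
Lemma ae_cvg0 (R : realType) (D : set (measurableTypeR R)) (f : nat -> R -> R)
    (C : R) : measurable D -> 0 <= C ->
  (forall j, int_le D (f j) (C / j.+2%:R ^+ 2)) ->
  {ae lebesgue_measure, forall a : measurableTypeR R, D a ->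
     f ^~ (a : R) @ \oo --> (0 : R)}.
Proof.
move=> mD C0 hf.
pose F (a : measurableTypeR R) := (\sum_(j <oo) (f j a)%:E)%E.
have f0 j a : 0 <= f j a by have [_ + _] := hf j; exact.
have mf j : measurable_fun D (fun a => (f j a)%:E).
  by have [cf _ _] := hf j; exact: continuous_EFin_measurable.
have IF : (\int[lebesgue_measure]_(a in D) F a <= C%:E)%E.
  rewrite /F integral_nneseries//; last by move=> j a _; rewrite lee_fin.
  apply: lime_le.
    apply: is_cvg_nneseries => j _ _.
    by apply: integral_ge0 => a _; rewrite lee_fin.
  apply: nearW => n.
  apply: (@le_trans _ _ (\sum_(0 <= j < n) (C / j.+2%:R ^+ 2)%:E)%E).
    by apply: lee_sum => j _; have [_ _ ] := hf j.
  rewrite sumEFin lee_fin -mulr_sumr -[leRHS]mulr1 ler_wpM2l//.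
  exact: sum_inv_sqr.
have iF : lebesgue_measure.-integrable D F.
  apply/integrableP; split.
    apply: ge0_emeasurable_sum => // j a Da _.
    by rewrite lee_fin.
  under eq_integral.
    move=> a _; rewrite gee0_abs; last by apply: nneseries_ge0 => *; rewrite lee_fin.
    over.
  by rewrite (le_lt_trans IF)// ltry.
have := integrable_ae mD iF; apply: filterS => a h Da.
have {}h := h Da.
apply: cvg_series_cvg_0; apply: nondecreasing_is_cvgn.
  by apply: nondecreasing_series => n _ _; exact: f0.
exists (fine (F a)) => _ [n _ <-].
rewrite -lee_fin fineK// /series/= -sumEFin.
by apply: nneseries_lim_ge => j _ _; rewrite lee_fin.
Qed.

(** The mean values are over bounded intervals, so the line is exhausted by countably many. The
    index [j.+2] keeps to the range [1 < j] of [int_le_defect]. *)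
Lemma ae_defect_cvg0 (R : realType) (sg eta : R) (d p q : nat) (b : nat -> R) :
  (0 < d)%N -> 0 < eta <= 1 / 4 -> 1 / 2 + eta <= sg ->
  4 <= q%:R * eta -> (7 * q + 2 <= p)%N ->
  {ae lebesgue_measure, forall a : measurableTypeR R,
    (fun j => defect sg d p.*2 q j.+2 (fun n => (a : R) * n%:R ^+ d + b n))
      @ \oo --> (0 : R)}.
Proof.
move=> d0 e01 esg qe pq; have /andP[e0 _] := e01.
have H (m : nat) : {ae lebesgue_measure, forall a : measurableTypeR R,
    `[- m.+1%:R, m.+1%:R]%classic (a : R) ->
    (fun j => defect sg d p.*2 q j.+2 (fun n => (a : R) * n%:R ^+ d + b n))
      @ \oo --> (0 : R)}.
  pose f j (a : R) := defect sg d p.*2 q j.+2 (fun n => a * n%:R ^+ d + b n).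
  have mm : - m.+1%:R < m.+1%:R :> R.
    by rewrite (lt_trans (y := 0)) ?oppr_lt0 ?ltr0n.
  have BA0 : 0 <= m.+1%:R - - m.+1%:R :> R by rewrite subr_ge0 ltW.
  apply: (@ae_cvg0 R _ f ((m.+1%:R - - m.+1%:R) / (2 * eta) + 128 / eta +
      (m.+1%:R - - m.+1%:R + 32))) => //.
    by apply: addr_ge0; [apply: addr_ge0; rewrite divr_ge0// ltW// mulr_gt0|lra].
  by move=> j; exact: int_le_defect.
have := ae_foralln H; apply: filterS => a h.
apply: (h (Num.truncn `|a : R|)) => /=; rewrite in_itv/= -ler_norml ltW//.
exact: truncnS_gt.
Qed.

(** * The exponential function on the complex numbers *)

Lemma derivable_MVT (R : realType) (f df : R -> R) (a b : R) :
  (forall x : R, is_derive x 1 f (df x)) ->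
  exists2 c, `|c - a| <= `|b - a| & f b - f a = df c * (b - a).
Proof.
move=> fd.
have cf : continuous f.
  by move=> x; apply: differentiable_continuous; apply/derivable1_diffP; have [] := fd x.
have [ab|/ltW ba] := leP a b.
  have [|c] := MVT_segment ab (fun x _ => fd x); first exact/continuous_subspaceT/cf.
  rewrite in_itv/= => /andP[ac cb] e; exists c => //.
  by rewrite !ger0_norm ?subr_ge0// lerD2r.
have [|c] := MVT_segment ba (fun x _ => fd x); first exact/continuous_subspaceT/cf.
rewrite in_itv/= => /andP[bc ca] e; exists c; last by rewrite -[LHS]opprB e; ring.
by rewrite !ler0_norm ?subr_le0// lerN2 lerD2r.
Qed.

Lemma cos_lipschitz (R : realType) (a b : R) : `|cos b - cos a| <= `|b - a|.
Proof.
have [c _ ->] := derivable_MVT a b (@is_derive_cos R).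
by rewrite normrM -[leRHS]mul1r ler_wpM2r// normrN sin_max.
Qed.

Lemma sin_lipschitz (R : realType) (a b : R) : `|sin b - sin a| <= `|b - a|.
Proof.
have [c _ ->] := derivable_MVT a b (@is_derive_sin R).
by rewrite normrM -[leRHS]mul1r ler_wpM2r// cos_max.
Qed.

Lemma cos_sub1_le (R : realType) (b : R) : `|cos b - 1| <= b ^+ 2.
Proof.
have [c cb] := derivable_MVT 0 b (@is_derive_cos R).
rewrite cos0 !subr0 in cb * => ->.
rewrite normrM normrN -real_normK ?num_real// expr2 ler_wpM2r//.
by have := sin_lipschitz 0 c; rewrite sin0 !subr0 => /le_trans; apply.
Qed.

Lemma sin_sub_le (R : realType) (b : R) : `|b| <= 1 -> `|sin b - b| <= b ^+ 2.
Proof.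
move=> b1; have [c cb] := derivable_MVT 0 b (@is_derive_sin R).
rewrite sin0 !subr0 in cb * => ->.
rewrite -{2}[b]mul1r -mulrBl normrM -real_normK ?num_real// expr2 ler_wpM2r//.
have := cos_sub1_le c; rewrite -real_normK ?num_real// => /le_trans; apply.
by rewrite expr2 (le_trans (ler_piMr _ _))// (le_trans cb).
Qed.

(** Both bounds come from [1 + x <= exp x]: at [a] directly, and at [- a] in the form
    [(1 - a) * exp a <= 1]. *)
Lemma expR_taylor1 (R : realType) (a : R) : `|a| <= 1 / 2 ->
  0 <= expR a - 1 - a <= 2 * a ^+ 2.
Proof.
rewrite ler_norml => /andP[a1 a2].
have e1 := expR_ge1Dx a; have := expR_ge1Dx (- a).
rewrite expRN => h; apply/andP; split; first lra.
have ep := expR_gt0 a.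
have : (1 - a) * expR a <= 1.
  by rewrite -ler_pdivlMr// div1r.
by nra.
Qed.

Lemma cexpD (R : realType) (z w : R[i]) : cexp (z + w) = cexp z * cexp w.
Proof.
case: z => a b; case: w => c d; rewrite /cexp/= expRD cosD sinD.
by apply/eqP; rewrite eq_complex/=; apply/andP; split; apply/eqP; ring.
Qed.

Lemma normc_cexp (R : realType) (z : R[i]) : normc (cexp z) = expR (complex.Re z).
Proof.
by rewrite /cexp/= !exprMn -mulrDr cos2Dsin2 mulr1 sqrtr_sqr ger0_norm ?expR_ge0.
Qed.

Lemma cexp0 (R : realType) : cexp (0 : R[i]) = 1.
Proof. by rewrite /cexp/= expR0 cos0 sin0 mulr1 mulr0. Qed.

Lemma cexp_neq0 (R : realType) (z : R[i]) : cexp z != 0.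
Proof.
apply/eqP => h; have := normc_cexp z; rewrite h normc0.
by move/eqP; rewrite eq_sym expR_eq0.
Qed.

Lemma cexpN (R : realType) (z : R[i]) : cexp (- z) = (cexp z)^-1.
Proof.
by apply: (mulIf (cexp_neq0 z)); rewrite -cexpD addNr cexp0 mulVf ?cexp_neq0.
Qed.

Lemma normr_Re_le (R : realType) (z : R[i]) : `|complex.Re z| <= normc z.
Proof.
by case: z => a b /=; rewrite -sqrtr_sqr ler_sqrt ?addr_ge0 ?sqr_ge0// lerDl sqr_ge0.
Qed.

Lemma normr_Im_le (R : realType) (z : R[i]) : `|complex.Im z| <= normc z.
Proof.
by case: z => a b /=; rewrite -sqrtr_sqr ler_sqrt ?addr_ge0 ?sqr_ge0// lerDr sqr_ge0.
Qed.

Lemma normc_sqr (R : realType) (z : R[i]) :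
  normc z ^+ 2 = complex.Re z ^+ 2 + complex.Im z ^+ 2.
Proof. by case: z => a b /=; rewrite sqr_sqrtr// addr_ge0 ?sqr_ge0. Qed.

Lemma normc_ge0 (R : realType) (z : R[i]) : 0 <= normc z.
Proof. by case: z => a b; exact: sqrtr_ge0. Qed.

Lemma normc_le_ReIm (R : realType) (z : R[i]) :
  normc z <= `|complex.Re z| + `|complex.Im z|.
Proof.
rewrite -(@ler_pXn2r _ 2)// ?nnegrE ?normc_ge0 ?addr_ge0// normc_sqr sqrrD.
rewrite !real_normK ?num_real//.
by rewrite addrAC lerDl mulrn_wge0// mulr_ge0.
Qed.

Lemma cexp_taylor1 (R : realType) (z : R[i]) : normc z <= 1 / 2 ->
  normc (cexp z - 1 - z) <= 8 * normc z ^+ 2.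
Proof.
move=> z1; apply: le_trans (normc_le_ReIm _) _.
have := normr_Re_le z; have := normr_Im_le z; have := normc_sqr z.
case: z z1 => a b /= z1; set r := Num.sqrt _ in z1 * => rE hb ha.
have := expR_taylor1 (le_trans ha z1); have := cos_sub1_le b.
have := sin_sub_le (b := b).
have b1 : `|b| <= 1 by lra.
move=> /(_ b1) hs hc /andP[e0 e1].
(* The real and imaginary remainders are split so that every piece is of second order in [a] and [b]
   by the real estimates above. *)
have E1 : expR a * cos b - 1 - a = (expR a - 1 - a) * cos b + (1 + a) * (cos b - 1).
  by ring.
have E2 : expR a * sin b - 0 - b = (expR a - 1) * sin b + (sin b - b) by ring.
rewrite E1 E2.
have a1 : `|a| <= 1 / 2 by lra.
have : `|(expR a - 1 - a) * cos b| <= 2 * a ^+ 2.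
  rewrite normrM (ger0_norm e0); apply: le_trans e1.
  by rewrite -[leRHS]mulr1 ler_wpM2l// cos_max.
have : `|(1 + a) * (cos b - 1)| <= 2 * b ^+ 2.
  by rewrite normrM ler_pM// (le_trans (ler_normD _ _))// normr1; lra.
have : `|(expR a - 1) * sin b| <= 2 * `|a| * `|b|.
  rewrite normrM ler_pM//.
    have -> : expR a - 1 = a + (expR a - 1 - a) by ring.
    rewrite (le_trans (ler_normD _ _))// (ger0_norm e0).
    have : a ^+ 2 <= `|a| / 2.
      by rewrite -real_normK ?num_real// expr2 ler_wpM2l//; lra.
    by lra.
  by have := sin_lipschitz 0 b; rewrite sin0 !subr0.
have : 2 * `|a| * `|b| <= a ^+ 2 + b ^+ 2.
  have := sqr_ge0 (`|a| - `|b|); rewrite sqrrB !real_normK ?num_real//.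
  by rewrite -mulr_natl; lra.
have := ler_normD ((expR a - 1 - a) * cos b) ((1 + a) * (cos b - 1)).
have := ler_normD ((expR a - 1) * sin b) (sin b - b).
have := sqr_ge0 a; have := sqr_ge0 b.
rewrite rE; lra.
Qed.

Lemma normcD (R : realType) (z w : R[i]) : normc (z + w) <= normc z + normc w.
Proof. exact: le_normcD. Qed.

Lemma normc_opp (R : realType) (z : R[i]) : normc (- z) = normc z.
Proof. exact: normcN. Qed.

Lemma normcB (R : realType) (z w : R[i]) : normc (z - w) <= normc z + normc w.
Proof. by rewrite -(normc_opp w) normcD. Qed.

Lemma normc_distC (R : realType) (z w : R[i]) : normc (z - w) = normc (w - z).
Proof. by rewrite -normc_opp opprB. Qed.

Lemma normc_real (R : realType) (x : R) : normc (x%:C) = `|x|.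
Proof. by rewrite /= expr0n/= addr0 sqrtr_sqr. Qed.

Lemma normc_gt0 (R : realType) (z : R[i]) : (0 < normc z) = (z != 0).
Proof.
rewrite lt0r normc_ge0 andbT; congr negb; apply/eqP/eqP => [/eq0_normc//|->].
exact: normc0.
Qed.

Lemma normc_div (R : realType) (z w : R[i]) : normc (z / w) = normc z / normc w.
Proof. by rewrite normcM normcV. Qed.

Lemma powR_cvgn0 (R : realType) (x : R) : 0 < x ->
  (fun n : nat => n%:R `^ (- x)) @ \oo --> (0 : R).
Proof.
move=> x0; apply/cvgrPdist_le => e e0.
exists (Num.truncn (e^-1 `^ x^-1)).+1 => // n /= ne.
rewrite sub0r normrN ger0_norm ?powR_ge0// powRN -[leRHS]invrK.
have ei : 0 < e^-1 by rewrite invr_gt0.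
have n0 : 0 < n%:R :> R by rewrite ltr0n (leq_trans _ ne).
rewrite lef_pV2 ?posrE ?powR_gt0//.
have -> : e^-1 = (e^-1 `^ x^-1) `^ x.
  by rewrite -powRrM mulVf ?gt_eqF// powRr1// ltW.
apply: ge0_ler_powR; rewrite ?nnegrE ?powR_ge0// ?(ltW x0)//.
by apply: ltW; rewrite (lt_le_trans (truncnS_gt _))// ler_nat.
Qed.

(** Relates [(k + 1)^w - k^w = k^w * (exp (w * lnstep) - 1)] to its first-order value; it is near 1
    for small [z]. Estimates are made only away from [z = 0], where division returns a default. *)
Definition cquot (R : realType) (z : R[i]) := (cexp z - 1) / z.

Lemma cquot_sub1_le (R : realType) (z : R[i]) : z != 0 -> normc z <= 1 / 2 ->
  normc (cquot z - 1) <= 8 * normc z.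
Proof.
move=> z0 z1; have nz : 0 < normc z by rewrite normc_gt0.
have -> : cquot z - 1 = (cexp z - 1 - z) / z by rewrite /cquot; field.
rewrite normc_div ler_pdivrMr// -mulrA -expr2; exact: cexp_taylor1.
Qed.

(** With [z = w u] and [h = w v], the numerator of the difference is a sum of two Taylor remainders
    bounded by [8 |z| |h| (|z| + |h|)]. On a ray [|z| + |h| = |z + h|], so the denominator
    [z * (z + h)] cancels without loss; the factor 16 includes [|exp z| <= 2]. *)
Lemma cquot_lipschitz (R : realType) (w : R[i]) (u v : R) :
  w != 0 -> 0 < u -> 0 <= v -> normc w * (u + v) <= 1 / 2 ->
  normc (cquot (w * (u + v)%:C) - cquot (w * u%:C)) <= 16 * normc w * v.
Proof.
move=> w0 u0 v0 wuv; have nw : 0 < normc w by rewrite normc_gt0.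
set z := w * u%:C; set h := w * v%:C.
have -> : w * (u + v)%:C = z + h by rewrite rmorphD/= mulrDr.
have nz : normc z = normc w * u by rewrite normcM normc_real ger0_norm// ltW.
have nh : normc h = normc w * v by rewrite normcM normc_real ger0_norm.
have nzh : normc (z + h) = normc w * (u + v).
  by rewrite -mulrDr -rmorphD/= normcM normc_real ger0_norm// addr_ge0// ltW.
have uv0 : 0 < u + v by rewrite ltr_wpDr.
have z0 : z != 0 by rewrite -normc_gt0 nz mulr_gt0.
have zh0 : z + h != 0 by rewrite -normc_gt0 nzh mulr_gt0.
have -> : cquot (z + h) - cquot z = cexp z *
   (z * (cexp h - 1 - h) + h * (cexp (- z) - 1 - (- z))) / (z * (z + h)).
  rewrite /cquot cexpD cexpN; field.
  by rewrite zh0 z0 cexp_neq0.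
rewrite normc_div (normcM (cexp z)) (normcM z) nz nzh ler_pdivrMr ?mulr_gt0//.
have wu : normc w * u <= 1 / 2.
  by apply: le_trans wuv; rewrite ler_wpM2l// ?(ltW nw)// lerDl.
have wv : normc w * v <= 1 / 2.
  by apply: le_trans wuv; rewrite ler_wpM2l// ?(ltW nw)// lerDr ltW.
have ez : normc (cexp z) <= 2.
  rewrite normc_cexp; have rz := normr_Re_le z; rewrite nz in rz.
  have rz1 : `|complex.Re z| <= 1 / 2 by lra.
  have /andP[_] := expR_taylor1 rz1.
  have : complex.Re z ^+ 2 <= 1 / 4.
    rewrite -real_normK ?num_real// expr2.
    have -> : 1 / 4 = (1 / 2) * (1 / 2) :> R by field.
    by apply: ler_pM.
  by have := ler_norm (complex.Re z); lra.
have th : normc (cexp h - 1 - h) <= 8 * normc h ^+ 2.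
  by apply: cexp_taylor1; rewrite nh.
have tz : normc (cexp (- z) - 1 - (- z)) <= 8 * normc z ^+ 2.
  by rewrite -(normc_opp z); apply: cexp_taylor1; rewrite normc_opp nz.
set S := normc (_ + _).
have hS : S <= 8 * (normc w * u) * (normc w * v) * (normc w * (u + v)).
  apply: le_trans (normcD _ _) _; rewrite (normcM z) (normcM h).
  have := ler_wpM2l (normc_ge0 z) th; have := ler_wpM2l (normc_ge0 h) tz.
  rewrite nz nh => h1 h2.
  have -> : 8 * (normc w * u) * (normc w * v) * (normc w * (u + v)) =
    (normc w * v) * (8 * (normc w * u) ^+ 2) +
    (normc w * u) * (8 * (normc w * v) ^+ 2) by ring.
  by rewrite addrC lerD.
apply: le_trans (ler_pM (normc_ge0 _) (normc_ge0 _) ez hS) _.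
by rewrite le_eqVlt; apply/orP; left; apply/eqP; ring.
Qed.

(** * Partial sums of the zeta series corrected by a telescoping term *)

Definition lnstep (R : realType) (k : nat) : R := ln k.+1%:R - ln k%:R.

Lemma lnstep_ge (R : realType) (k : nat) : (0 < k)%N -> k.+1%:R^-1 <= lnstep R k.
Proof.
move=> k0; have := @lnB_ge R k%:R k.+1%:R; rewrite !ltr0n => /(_ k0 isT).
by rewrite -natrB// subSnn mul1r.
Qed.

Lemma lnstep_le (R : realType) (k : nat) : (0 < k)%N -> lnstep R k <= k%:R^-1.
Proof.
move=> k0; have := @lnB_le R k%:R k.+1%:R; rewrite !ltr0n => /(_ k0 isT).
by rewrite -natrB// subSnn mul1r.
Qed.

(** The difference is the logarithm of [(k + 1)^2 / (k * (k + 2))], whose numerator exceeds its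
    denominator by exactly 1. *)
Lemma lnstep_diff (R : realType) (k : nat) : (0 < k)%N ->
  (k.+1%:R ^+ 2)^-1 <= lnstep R k - lnstep R k.+1 <= (k%:R * k.+2%:R)^-1.
Proof.
move=> k0.
have a0 : 0 < k%:R :> R by rewrite ltr0n.
have b0 : 0 < k.+1%:R :> R by rewrite ltr0n.
have c0 : 0 < k.+2%:R :> R by rewrite ltr0n.
have E : lnstep R k - lnstep R k.+1 = ln (k.+1%:R ^+ 2) - ln (k%:R * k.+2%:R).
  by rewrite lnXn// lnM ?posrE// mulr2n /lnstep; ring.
have ac0 : 0 < k%:R * k.+2%:R :> R by rewrite mulr_gt0.
have bb0 : 0 < k.+1%:R ^+ 2 :> R by rewrite exprn_gt0.
have D : k.+1%:R ^+ 2 - k%:R * k.+2%:R = 1 :> R.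
  by rewrite -(natr1 k.+1) -(natr1 k); ring.
have := lnB_ge ac0 bb0; have := lnB_le ac0 bb0.
by rewrite D !mul1r E => -> ->.
Qed.

(* [tau w k = ((k + 1)^w - k^w) / (w k^(w - 1))], the ratio by which a term
   [k^(w - 1)] misses being a telescoping difference. *)
Definition tau (R : realType) (w : R[i]) (k : nat) : R[i] :=
  (k%:R * lnstep R k)%:C * cquot (w * (lnstep R k)%:C).

Lemma knstep_bound (R : realType) (k : nat) : (0 < k)%N ->
  1 - k.+1%:R^-1 <= k%:R * lnstep R k <= 1.
Proof.
move=> k0; have a0 : 0 < k%:R :> R by rewrite ltr0n.
have b0 : 0 < k.+1%:R :> R by rewrite ltr0n.
apply/andP; split.
  apply: le_trans (ler_wpM2l (ltW a0) (lnstep_ge R k0)).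
  have : k.+1%:R * k.+1%:R^-1 = 1 :> R by rewrite divff ?gt_eqF.
  by set i := _^-1; rewrite -natr1 mulrDl mul1r; lra.
by rewrite -[leRHS](@divff _ k%:R) ?gt_eqF// ler_wpM2l ?lnstep_le// ltW.
Qed.

(** [32 |w| <= k] makes the argument of [cquot] at most 1/32, so [cquot] is within 1/4 of 1;
    [k >= 3] puts [k * lnstep R k] in [3/4, 1]. Hence [tau] stays at distance at least 1/2 from 0
    and can be divided by. *)
Lemma tau_sub1_le (R : realType) (w : R[i]) (k : nat) :
  w != 0 -> (2 < k)%N -> 32 * normc w <= k%:R ->
  normc (tau w k - 1) <= 1 / 2 /\
  normc (cquot (w * (lnstep R k)%:C)) <= 5 / 4.
Proof.
move=> w0 k2 wk; have k0 : (0 < k)%N by exact: leq_trans k2.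
have a0 : 0 < k%:R :> R by rewrite ltr0n.
have b0 : 0 < k.+1%:R :> R by rewrite ltr0n.
have d0 : 0 < lnstep R k by apply: lt_le_trans (lnstep_ge R k0); rewrite invr_gt0.
have nw : 0 < normc w by rewrite normc_gt0.
have wd : normc (w * (lnstep R k)%:C) <= 1 / 32.
  rewrite normcM normc_real gtr0_norm//.
  apply: le_trans (ler_wpM2l (ltW nw) (lnstep_le R k0)) _.
  by rewrite ler_pdivrMr//; lra.
have wd0 : w * (lnstep R k)%:C != 0.
  by rewrite -normc_gt0 normcM normc_real gtr0_norm// mulr_gt0.
have E1 : normc (cquot (w * (lnstep R k)%:C) - 1) <= 1 / 4.
  by apply: le_trans (cquot_sub1_le wd0 _) _; lra.
have /andP[l1 l2] := knstep_bound R k0.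
have k4 : k.+1%:R^-1 <= 1 / 4 :> R by rewrite div1r lef_pV2 ?posrE// ler_nat.
split; last first.
  rewrite -[cquot _](subrK 1); apply: le_trans (normcD _ _) _.
  by rewrite normc1; lra.
set q := cquot _ in E1 *; set c := k%:R * _ in l1 l2 *.
set i := k.+1%:R^-1 in l1 k4.
have -> : tau w k - 1 = c%:C * (q - 1) + (c - 1)%:C.
  by rewrite /tau -/c -/q rmorphB/=; ring.
apply: le_trans (normcD _ _) _; rewrite normcM !normc_real.
have c0 : 0 <= c by lra.
rewrite (ger0_norm c0) ler0_norm ?subr_le0//.
have : c * normc (q - 1) <= 1 * (1 / 4) by apply: ler_pM => //; exact: normc_ge0.
by lra.
Qed.

Lemma tau_norm_ge (R : realType) (w : R[i]) (k : nat) :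
  w != 0 -> (2 < k)%N -> 32 * normc w <= k%:R -> 1 / 2 <= normc (tau w k).
Proof.
move=> w0 k2 wk; have [h _] := tau_sub1_le w0 k2 wk.
have := normcD (tau w k) (1 - tau w k); rewrite addrC subrK normc1.
by rewrite normc_distC in h; lra.
Qed.

(** Both factors of [tau] vary by O(1 / k^2) from [k] to [k + 1], the second with a factor [|w|];
    the product of the two denominators costs at most 4. This order of smallness is what makes the
    corrected sums converge for [Re w < 1]. *)
Lemma tau_inv_step (R : realType) (w : R[i]) (k : nat) :
  w != 0 -> (2 < k)%N -> 32 * normc w <= k%:R ->
  normc ((tau w k)^-1 - (tau w k.+1)^-1) <= (8 + 128 * normc w) / k.+1%:R ^+ 2.
Proof.
move=> w0 k2 wk; have k0 : (0 < k)%N by exact: leq_trans k2.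
have a0 : 0 < k%:R :> R by rewrite ltr0n.
have b0 : 0 < k.+1%:R :> R by rewrite ltr0n.
have c0 : 0 < k.+2%:R :> R by rewrite ltr0n.
have b2 : 0 < k.+1%:R ^+ 2 :> R by rewrite exprn_gt0.
have nw : 0 < normc w by rewrite normc_gt0.
have wk' : 32 * normc w <= k.+1%:R.
  by apply: le_trans wk _; rewrite ler_nat.
have t1 := tau_norm_ge w0 k2 wk; have t2 := tau_norm_ge w0 (ltnW k2 : (2 < k.+1)%N) wk'.
have [_ q2] := tau_sub1_le w0 (ltnW k2 : (2 < k.+1)%N) wk'.
have T1 : tau w k != 0 by rewrite -normc_gt0; lra.
have T2 : tau w k.+1 != 0 by rewrite -normc_gt0; lra.
have -> : (tau w k)^-1 - (tau w k.+1)^-1 =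
    (tau w k.+1 - tau w k) / (tau w k * tau w k.+1).
  by field; rewrite T1 T2.
have /andP[dl du] := lnstep_diff R k0.
set d := lnstep R k in dl du *; set d' := lnstep R k.+1 in dl du *.
have d'0 : 0 < d'.
  by apply: lt_le_trans (lnstep_ge R (k := k.+1) isT); rewrite invr_gt0.
have bi0 : 0 < (k.+1%:R ^+ 2)^-1 :> R by rewrite invr_gt0.
have dd : 0 <= d - d' by exact: le_trans (ltW bi0) dl.
have du' : d - d' <= 2 / k.+1%:R ^+ 2.
  apply: le_trans du _; rewrite -[leRHS]invf_div lef_pV2 ?posrE ?divr_gt0 ?mulr_gt0//.
  rewrite ler_pdivrMr// -(natr1 k.+1) -(natr1 k).
  have : 1 <= k%:R :> R by rewrite ler1n.
  set x : R := k%:R; nra.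
have lip : normc (cquot (w * d%:C) - cquot (w * d'%:C)) <= 16 * normc w * (d - d').
  have {1}-> : d = d' + (d - d') by ring.
  apply: cquot_lipschitz => //.
  rewrite addrC subrK.
  apply: le_trans (ler_wpM2l (ltW nw) (lnstep_le R k0)) _.
  by rewrite ler_pdivrMr//; lra.
(* The difference equals [d' - k * (d - d')], and both terms are [1 / (k + 1)] up to second
   order. *)
have kd : `|k.+1%:R * d' - k%:R * d| <= (k.+1%:R ^+ 2)^-1.
  have -> : k.+1%:R * d' - k%:R * d = d' - k%:R * (d - d') by rewrite -natr1; ring.
  have h1 := lnstep_ge R (k := k.+1) isT; have h2 := lnstep_le R (k := k.+1) isT.
  rewrite -/d' in h1 h2.
  have h3 : k%:R * (d - d') <= k.+2%:R^-1.
    apply: le_trans (ler_wpM2l (ltW a0) du) _.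
    by rewrite invfM mulrA divff ?gt_eqF// mul1r.
  have h4 : k.+1%:R^-1 - (k.+1%:R ^+ 2)^-1 <= k%:R * (d - d').
    apply: le_trans (ler_wpM2l (ltW a0) dl).
    have -> : k.+1%:R^-1 = k.+1%:R * (k.+1%:R ^+ 2)^-1 :> R.
      by rewrite expr2 invfM mulrA divff ?gt_eqF// mul1r.
    by set i := (_ ^+ 2)^-1; rewrite -natr1 mulrDl mul1r; lra.
  move: h1 h2 h3 h4 dl bi0; set e := k%:R * (d - d').
  set i := (k.+1%:R ^+ 2)^-1; set i1 := k.+1%:R^-1; set i2 := k.+2%:R^-1.
  move: i i1 i2 e => i i1 i2 e h1 h2 h3 h4 dl bi0.
  by rewrite ler_norml; apply/andP; split; lra.
have /andP[l1 l2] := knstep_bound R k0.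
have tt : normc (tau w k.+1 - tau w k) <= (2 + 32 * normc w) / k.+1%:R ^+ 2.
  set q := cquot (w * d%:C) in lip; set q' := cquot (w * d'%:C) in lip q2.
  have -> : tau w k.+1 - tau w k =
      (k.+1%:R * d' - k%:R * d)%:C * q' - (k%:R * d)%:C * (q - q').
    by rewrite /tau -/d -/d' -/q -/q' rmorphB/=; ring.
  apply: le_trans (normcB _ _) _; rewrite (normcM _ q') (normcM _ (q - q')) !normc_real.
  have kd0 : 0 <= k%:R * d by rewrite mulr_ge0// ?ltW//; lra.
  rewrite (ger0_norm kd0).
  have e1 := ler_pM (normr_ge0 _) (normc_ge0 _) kd q2.
  have e2 := ler_pM kd0 (normc_ge0 _) l2 lip.
  have e3 : 16 * normc w * (d - d') <= 16 * normc w * (2 / k.+1%:R ^+ 2).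
    by rewrite ler_wpM2l// mulr_ge0// ltW.
  move: e1 e2 e3 bi0; set i := (k.+1%:R ^+ 2)^-1; move: i => i e1 e2 e3 bi0.
  apply: le_trans (lerD e1 e2) _; rewrite mul1r.
  by apply: le_trans (lerD (lexx _) e3) _; lra.
rewrite normc_div ler_pdivrMr; last by rewrite normcM; nra.
apply: le_trans tt _; rewrite normcM.
have -> : (8 + 128 * normc w) / k.+1%:R ^+ 2 * (normc (tau w k) * normc (tau w k.+1)) =
   (2 + 32 * normc w) / k.+1%:R ^+ 2 * (4 * (normc (tau w k) * normc (tau w k.+1))).
  by ring.
apply: ler_peMr; first by rewrite mulr_ge0 ?invr_ge0 ?exprn_ge0//; lra.
by nra.
Qed.

Definition npow (R : realType) (k : nat) (w : R[i]) : R[i] := cexp (w * (ln k%:R)%:C).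

Definition dsum (R : realType) (L : nat) (s : R[i]) : R[i] :=
  \sum_(1 <= k < L) dirichlet_term k s.

Lemma normc_npow (R : realType) (k : nat) (w : R[i]) : (0 < k)%N ->
  normc (npow k w) = k%:R `^ (complex.Re w).
Proof.
move=> k0; rewrite normc_cexp /powR gt_eqF ?ltr0n//.
by case: w => a b /=; rewrite mulr0 subr0.
Qed.

Lemma dirichlet_termE (R : realType) (k : nat) (s : R[i]) :
  dirichlet_term k s = npow k (- s).
Proof. by rewrite /dirichlet_term /npow mulNr. Qed.

Lemma npowB1 (R : realType) (k : nat) (w : R[i]) : (0 < k)%N ->
  npow k (w - 1) = npow k w / (k%:R)%:C.
Proof.
move=> k0; rewrite /npow mulrBl mul1r cexpD; congr (_ * _).
rewrite cexpN; congr (_^-1); rewrite /cexp/= cos0 sin0 mulr1 mulr0 lnK//.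
by rewrite posrE ltr0n.
Qed.

Lemma npowM (R : realType) (k l : nat) (w : R[i]) : (0 < k)%N -> (0 < l)%N ->
  npow (k * l) w = npow k w * npow l w.
Proof.
move=> k0 l0; rewrite /npow natrM lnM ?posrE ?ltr0n// rmorphD/= mulrDr.
exact: cexpD.
Qed.

Lemma npowS (R : realType) (k : nat) (w : R[i]) : w != 0 -> (0 < k)%N ->
  npow k.+1 w - npow k w = tau w k * w * npow k (w - 1).
Proof.
move=> w0 k0; have k0' : (k%:R)%:C != 0 :> R[i].
  by rewrite -normc_gt0 normc_real normr_gt0 pnatr_eq0 -lt0n.
have d0 : 0 < lnstep R k.
  by apply: lt_le_trans (lnstep_ge R k0); rewrite invr_gt0 ltr0n.
have d0' : (lnstep R k)%:C != 0 :> R[i].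
  by rewrite -normc_gt0 normc_real normr_gt0 gt_eqF.
have -> : npow k.+1 w = npow k w * cexp (w * (lnstep R k)%:C).
  by rewrite /npow -cexpD -mulrDr -rmorphD/= /lnstep addrCA subrr addr0.
rewrite npowB1// /tau /cquot rmorphM/=.
move: (lnstep R k)%:C (k%:R)%:C d0' k0' => x y x0 y0.
by field; rewrite w0 x0 y0.
Qed.

(* With [w = 1 - s] this is [sum_(k < L) k^(- s)] minus an Euler-Maclaurin main
   term close to [L^(1 - s) / (1 - s)], hence converges to [zeta s]. *)
Definition dsum_corr (R : realType) (w : R[i]) (L : nat) : R[i] :=
  dsum L (1 - w) - npow L w / (tau w L * w).

(** By [npowS] the new term [L^(w - 1)] is a difference of powers over [tau w L * w], so it cancels
    the change of the main term except for the variation of [1 / tau]. Dividing by [|w| >= 1] turns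
    [8 + 128 |w|] into the uniform constant 136. *)
Lemma dsum_corr_step (R : realType) (w : R[i]) (L : nat) :
  1 <= normc w -> (2 < L)%N -> 32 * normc w <= L%:R ->
  normc (dsum_corr w L.+1 - dsum_corr w L) <=
  136 * L.+1%:R `^ (- 1 - (1 - complex.Re w)).
Proof.
move=> w1 L2 wL; have L0 : (0 < L)%N by exact: leq_trans L2.
have w0 : w != 0 by rewrite -normc_gt0; lra.
have wL' : 32 * normc w <= L.+1%:R by apply: le_trans wL _; rewrite ler_nat.
have t1 := tau_norm_ge w0 L2 wL; have t2 := tau_norm_ge w0 (ltnW L2 : (2 < L.+1)%N) wL'.
have T1 : tau w L != 0 by rewrite -normc_gt0; lra.
have T2 : tau w L.+1 != 0 by rewrite -normc_gt0; lra.
have -> : dsum_corr w L.+1 - dsum_corr w L =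
    npow L.+1 w * ((tau w L)^-1 - (tau w L.+1)^-1) / w.
  rewrite /dsum_corr /dsum big_nat_recr//= dirichlet_termE opprB.
  have E := npowS w0 L0.
  have {}E : npow L (w - 1) = (npow L.+1 w - npow L w) / (tau w L * w).
    by rewrite E; field; rewrite w0 T1.
  by rewrite E; field; rewrite w0 T1 T2.
rewrite normc_div normcM normc_npow// ler_pdivrMr; last lra.
apply: le_trans (ler_wpM2l (powR_ge0 _ _) (tau_inv_step w0 L2 wL)) _.
have b0 : 0 < L.+1%:R :> R by rewrite ltr0n.
have -> : L.+1%:R `^ (- 1 - (1 - complex.Re w)) =
    L.+1%:R `^ complex.Re w / L.+1%:R ^+ 2 :> R.
  rewrite -powR_mulrn ?(ltW b0)// -powRB; last by rewrite (gt_eqF b0) implybT.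
  by congr (_ `^ _); ring.
have -> : L.+1%:R `^ complex.Re w * ((8 + 128 * normc w) / L.+1%:R ^+ 2) =
  (L.+1%:R `^ complex.Re w / L.+1%:R ^+ 2) * (8 + 128 * normc w) by ring.
have P0 : 0 <= L.+1%:R `^ complex.Re w / L.+1%:R ^+ 2 :> R.
  by rewrite divr_ge0 ?powR_ge0 ?exprn_ge0.
move: (_ / L.+1%:R ^+ 2) P0 => P P0.
by have := ler_wpM2l P0 w1; lra.
Qed.

Lemma dsum_corr_cauchy (R : realType) (w : R[i]) (K L : nat) :
  1 <= normc w -> complex.Re w < 1 -> (2 < K)%N -> 32 * normc w <= K%:R ->
  (K <= L)%N ->
  normc (dsum_corr w L - dsum_corr w K) <=
  136 / (1 - complex.Re w) * K%:R `^ (- (1 - complex.Re w)).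
Proof.
move=> w1 rw K2 wK KL; have K0 : (0 < K)%N by exact: leq_trans K2.
set sg := 1 - complex.Re w; have s0 : 0 < sg by rewrite subr_gt0.
apply: (@le_trans _ _ (136 * \sum_(K.+1 <= k < L.+1) k%:R `^ (- 1 - sg))); last first.
  have -> : 136 / sg * K%:R `^ (- sg) = 136 * (K%:R `^ (- sg) / sg) by ring.
  by rewrite ler_wpM2l//; exact: sum_powRNB1.
elim: L KL => [|L IH] KL; first by move: K2; rewrite ltnNge (leq_trans KL).
move: KL; rewrite leq_eqVlt => /predU1P[<-|KL].
  by rewrite subrr normc0 mulr_ge0// sumr_ge0// => *; exact: powR_ge0.
have -> : dsum_corr w L.+1 - dsum_corr w K =
    (dsum_corr w L.+1 - dsum_corr w L) + (dsum_corr w L - dsum_corr w K) by ring.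
apply: le_trans (normcD _ _) _.
rewrite big_nat_recr//= mulrDr addrC lerD ?IH//.
apply: dsum_corr_step => //; first exact: (leq_trans K2 KL).
by apply: le_trans wK _; rewrite ler_nat.
Qed.

Lemma tau_inv_diff (R : realType) (w : R[i]) (L n : nat) :
  1 <= normc w -> (2 < L)%N -> 32 * normc w <= L%:R ->
  normc ((tau w (L + n))^-1 - (tau w L)^-1) <= n%:R * (136 * normc w / L%:R ^+ 2).
Proof.
move=> w1 L2 wL; have L0 : (0 < L)%N by exact: leq_trans L2.
have w0 : w != 0 by rewrite -normc_gt0; lra.
elim: n => [|n IH]; first by rewrite addn0 subrr normc0 mul0r.
have -> : (tau w (L + n.+1))^-1 - (tau w L)^-1 =
   ((tau w (L + n))^-1 - (tau w L)^-1) -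
   ((tau w (L + n))^-1 - (tau w (L + n).+1)^-1) by rewrite addnS; ring.
apply: le_trans (normcB _ _) _; rewrite -natr1 mulrDl mul1r; apply: lerD => //.
apply: le_trans (tau_inv_step w0 _ _) _.
- by rewrite (leq_trans L2)// leq_addr.
- by apply: le_trans wL _; rewrite ler_nat leq_addr.
apply: ler_pM; rewrite ?invr_ge0 ?exprn_ge0//; first lra.
  by lra.
rewrite lef_pV2 ?posrE ?exprn_gt0 ?ltr0n//.
by apply: lerXn2r; rewrite ?nnegrE// ler_nat -addnS leq_addr.
Qed.

(* The error [e L = dsum_corr w L - Z] is nearly constant in [L], while the
   hypothesis forces it to behave like a solution of [e (2 L) = 2^w e L];
   as [2^w <> 1], it vanishes in the limit. *)
Lemma dsum_corr_limit (R : realType) (w Z : R[i]) (K : nat) :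
  1 <= normc w -> 0 < complex.Re w <= 1 / 2 -> (2 < K)%N ->
  32 * normc w <= K%:R ->
  (fun L => normc (dsum (2 * L) (1 - w) - npow 2 w * dsum L (1 - w)
     - (1 - npow 2 w) * Z)) @ \oo --> (0 : R) ->
  normc (dsum_corr w K - Z) <= 272 * K%:R `^ (- (1 - complex.Re w)).
Proof.
move=> w1 /andP[rw0 rw1] K2 wK hZ; have K0 : (0 < K)%N by exact: leq_trans K2.
have w0 : w != 0 by rewrite -normc_gt0; lra.
set sg := 1 - complex.Re w; have s0 : 1 / 2 <= sg by rewrite /sg; lra.
have rlt : complex.Re w < 1 by lra.
pose Kn (L : nat) : R := L%:R `^ (- sg).
have cauchy (M L : nat) : (K <= M)%N -> (M <= L)%N ->
    normc (dsum_corr w L - dsum_corr w M) <= 272 * Kn M.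
  move=> KM ML; have wM : 32 * normc w <= M%:R by apply: le_trans wK _; rewrite ler_nat.
  apply: le_trans (dsum_corr_cauchy w1 rlt (leq_trans K2 KM) wM ML) _.
  rewrite ler_wpM2r ?powR_ge0// -/sg ler_pdivrMr; lra.
pose c := normc (1 - npow 2 w).
(* [|2^w| = 2^(Re w)], so this is where [Re w > 0] enters. *)
have n2 : 1 < normc (npow 2 w).
  by rewrite normc_npow// /powR pnatr_eq0/= expR_gt1 mulr_gt0// ln_gt0// ltr1n.
have c0 : 0 < c.
  rewrite normc_gt0 subr_eq0; apply/eqP => h.
  by move: n2; rewrite -h normc1 ltxx.
pose h L := normc (dsum (2 * L) (1 - w) - npow 2 w * dsum L (1 - w)
     - (1 - npow 2 w) * Z).
(* Of the 544, one 272 = 136 / (1/2) bounds [dsum_corr w (2 * L) - dsum_corr w L], the other bounds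
   [e] below. *)
pose u L := c^-1 * (h L + 544 * Kn L).
have hu L : (K <= L)%N -> normc (dsum_corr w K - Z) <= u L + 272 * Kn K.
  move=> KL; have L0 : (0 < L)%N by exact: leq_trans KL.
  have L2 : (L <= 2 * L)%N by rewrite leq_pmull.
  have -> : dsum_corr w K - Z = (dsum_corr w L - Z) - (dsum_corr w L - dsum_corr w K).
    by ring.
  apply: le_trans (normcB _ _) _; apply: lerD; last exact: cauchy.
  rewrite /u ler_pdivlMl// /c -normcM.
  (* Since [(2 L)^w = 2^w * L^w], the main terms at [2 L] and at [L] would cancel if [tau] were
     constant; [e] is what its variation leaves. *)
  pose e := npow (2 * L) w * ((tau w (2 * L))^-1 - (tau w L)^-1) / w.
  have -> : (1 - npow 2 w) * (dsum_corr w L - Z) =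
     (dsum (2 * L) (1 - w) - npow 2 w * dsum L (1 - w) - (1 - npow 2 w) * Z)
     - (dsum_corr w (2 * L) - dsum_corr w L) - e.
    have wL : 32 * normc w <= L%:R by apply: le_trans wK _; rewrite ler_nat.
    have wL2 : 32 * normc w <= (2 * L)%:R.
      by apply: le_trans wL _; rewrite ler_nat.
    have t1 := tau_norm_ge w0 (leq_trans K2 KL) wL.
    have t2 := tau_norm_ge w0 (leq_trans (leq_trans K2 KL) L2) wL2.
    have T1 : tau w L != 0 by rewrite -normc_gt0; lra.
    have T2 : tau w (2 * L) != 0 by rewrite -normc_gt0; lra.
    rewrite /e /dsum_corr npowM//; field.
    by rewrite w0 T1 T2.
  have he : normc e <= 272 * Kn L.
    have wL : 32 * normc w <= L%:R by apply: le_trans wK _; rewrite ler_nat.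
    have LR0 : 0 < L%:R :> R by rewrite ltr0n.
    rewrite /e normc_div normcM normc_npow ?muln_gt0// ler_pdivrMr; last lra.
    have := tau_inv_diff L w1 (leq_trans K2 KL) wL; rewrite addnn -mul2n => hd.
    have p2 : (2 * L)%:R `^ complex.Re w <= 2 * L%:R `^ complex.Re w :> R.
      rewrite natrM powRM// ler_wpM2r ?powR_ge0//.
      by rewrite -[leRHS](powRr1 (ltW (ltr0Sn R 1))) ler_powR//; [rewrite ler1n|lra].
    apply: le_trans (ler_pM (powR_ge0 _ _) (normc_ge0 _) p2 hd) _.
    have -> : Kn L = L%:R `^ complex.Re w / L%:R.
      rewrite /Kn -[X in _ / X](powRr1 (ltW LR0)) -powRB; last first.
        by rewrite (gt_eqF LR0) implybT.
      by congr (_ `^ _); rewrite /sg; ring.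
    rewrite le_eqVlt; apply/orP; left; apply/eqP; field.
    by rewrite gt_eqF.
  apply: le_trans (normcB _ _) _; have := cauchy _ _ KL L2.
  have := normcB (dsum (2 * L) (1 - w) - npow 2 w * dsum L (1 - w) -
    (1 - npow 2 w) * Z) (dsum_corr w (2 * L) - dsum_corr w L).
  rewrite -/(h L); lra.
have u0 : u @ \oo --> (0 : R).
  rewrite -[X in _ --> X](mulr0 c^-1); apply: cvgMl_tmp.
  rewrite -[X in _ --> X](addr0 0); apply: cvgD; first exact: hZ.
  by rewrite -[X in _ --> X](mulr0 544); apply: cvgMl_tmp; apply: powR_cvgn0; lra.
have l : (fun L => u L + 272 * Kn K) @ \oo --> 0 + 272 * Kn K.
  by apply: cvgD u0 _; exact: cvg_cst.
rewrite add0r in l; apply: (cvgr_to_ge l).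
by exists K => // L /= KL; exact: hu.
Qed.

(** * Power series and the identity theorem on a half-line *)

Lemma sum_half_le (R : realType) (n : nat) :
  \sum_(0 <= m < n) (1 / 2) ^+ m <= 2 :> R.
Proof.
suff : \sum_(0 <= m < n) (1 / 2) ^+ m <= 2 - 2 * (1 / 2) ^+ n :> R.
  move=> /le_trans; apply; rewrite gerBl mulr_ge0// exprn_ge0//; lra.
elim: n => [|n IH]; first by rewrite big_geq// expr0; lra.
by rewrite big_nat_recr//= exprS; move: IH; set u := (1 / 2) ^+ n; lra.
Qed.

Lemma abs_bounded_cvgn (R : realType) (u : nat -> R) (C : R) :
  (forall n, \sum_(0 <= m < n) `|u m| <= C) -> cvgn (series u).
Proof.
move=> h; apply: normed_cvg; apply: nondecreasing_is_cvgn.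
  by apply: nondecreasing_series => n _ _; exact: normr_ge0.
by exists C => _ [n _ <-]; exact: h.
Qed.

Definition pser_to (R : realType) (c : nat -> R) (x v : R) :=
  (fun N => \sum_(0 <= m < N) c m * x ^+ m) @ \oo --> v.

Lemma pser_sum (R : realType) (u : nat -> R -> R) (b : nat -> nat -> R) (x : R) (K : nat) :
  (forall k, pser_to (b k) x (u k x)) ->
  pser_to (fun m => \sum_(0 <= k < K) b k m) x (\sum_(0 <= k < K) u k x).
Proof.
move=> h; rewrite /pser_to (_ : (fun _ => _) =
    fun N => \sum_(0 <= k < K) \sum_(0 <= m < N) b k m * x ^+ m); last first.
  apply/funext => N; rewrite exchange_big/=; apply: eq_bigr => m _.
  by rewrite mulr_suml.
elim: K => [|K IH].
  rewrite big_geq// (_ : (fun _ => _) = cst 0); first exact: cvg_cst.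
  by apply/funext => N; rewrite big_geq.
rewrite big_nat_recr//= (_ : (fun _ => _) = fun N =>
    \sum_(0 <= k < K) \sum_(0 <= m < N) b k m * x ^+ m +
    \sum_(0 <= m < N) b K m * x ^+ m); last first.
  by apply/funext => N; rewrite big_nat_recr.
by apply: cvgD => //; exact: h.
Qed.

(* Cauchy-type domination [`|b k m| r^m <= w k] with [sum_k w k] finite makes
   the coefficients of the partial sums converge geometrically fast inside the
   disc of radius [r / 2]. *)
Lemma pser_series (R : realType) (u : nat -> R -> R) (b : nat -> nat -> R)
    (r : R) (w : nat -> R) (W : R) :
  0 < r ->
  (forall k x, `|x| < r -> pser_to (b k) x (u k x)) ->
  (forall k m, `|b k m| * r ^+ m <= w k) ->
  (forall K, \sum_(0 <= k < K) w k <= W) ->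
  exists B : nat -> R, forall x, `|x| < r / 2 ->
    exists2 v, pser_to B x v & (fun K => \sum_(0 <= k < K) u k x) @ \oo --> v.
Proof.
move=> r0 hu hb hW.
have rm m : 0 < r ^+ m by rewrite exprn_gt0.
have w0 k : 0 <= w k.
  by apply: le_trans (hb k 0%N); rewrite mulr_ge0// ltW.
have cb m : cvgn (series (fun k => b k m)).
  apply: (@abs_bounded_cvgn _ _ (W / r ^+ m)) => n.
  rewrite ler_pdivlMr// mulr_suml; apply: le_trans (hW n).
  by apply: ler_sum => k _; exact: hb.
have cw : cvgn (series w).
  apply: nondecreasing_is_cvgn; first by apply: nondecreasing_series => k _ _.
  by exists W => _ [n _ <-]; exact: hW.
pose B m := limn (series (fun k => b k m)).
(* The tail of the dominating series; it bounds the error of every coefficient at once, weighted by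
   [r^m], and therefore the error of the sums for [|x| < r / 2]. *)
pose eps K := limn (series w) - series w K.
have BK m K : `|B m - \sum_(0 <= k < K) b k m| * r ^+ m <= eps K.
  have l : (fun N => `|series (fun k => b k m) N - \sum_(0 <= k < K) b k m| * r ^+ m)
      @ \oo --> `|B m - \sum_(0 <= k < K) b k m| * r ^+ m.
    apply: cvgMr_tmp; apply: cvg_norm; apply: cvgB; [exact: cb|exact: cvg_cst].
  apply: (cvgr_to_le l); exists K => // N /= KN.
  rewrite /series/= (big_cat_nat (leq0n K) KN)/= addrAC subrr add0r.
  apply: (@le_trans _ _ (\sum_(K <= k < N) w k)).
    apply: (@le_trans _ _ ((\sum_(K <= k < N) `|b k m|) * r ^+ m)).
      by rewrite ler_wpM2r// ?ler_norm_sum// ltW.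
    by rewrite mulr_suml; apply: ler_sum => k _; exact: hb.
  rewrite /eps lerBrDl; apply: (@le_trans _ _ (series w N)).
    by rewrite /series/= [leRHS](big_cat_nat (leq0n K) KN).
  by apply: nondecreasing_cvgn_le => //; apply: nondecreasing_series => k _ _.
have eps0 : eps @ \oo --> (0 : R).
  rewrite -[X in _ --> X](subrr (limn (series w))); apply: cvgB => //.
  exact: cvg_cst.
exists B => x xr.
have xm m : `|x| ^+ m <= r ^+ m * (1 / 2) ^+ m.
  rewrite -exprMn; apply: lerXn2r; rewrite ?nnegrE//; last lra.
  by rewrite mulr_ge0//; lra.
have geo (c : nat -> R) (e : R) N : (forall m, `|c m| * r ^+ m <= e) ->
    \sum_(0 <= m < N) `|c m * x ^+ m| <= 2 * e.
  move=> hc; have e0 : 0 <= e.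
    by apply: le_trans (hc 0%N); rewrite mulr_ge0// ltW.
  apply: (@le_trans _ _ (\sum_(0 <= m < N) e * (1 / 2) ^+ m)).
    apply: ler_sum => m _; rewrite normrM normrX.
    apply: le_trans (ler_wpM2l (normr_ge0 _) (xm m)) _; rewrite mulrA.
    by apply: ler_wpM2r; [rewrite exprn_ge0//; lra|exact: hc].
  by rewrite -mulr_sumr mulrC; apply: ler_wpM2r => //; exact: sum_half_le.
have cB : cvgn (series (fun m => B m * x ^+ m)).
  apply: (@abs_bounded_cvgn _ _ (2 * eps 0%N)) => N; apply: geo => m.
  by have := BK m 0%N; rewrite big_geq// subr0.
pose v := limn (series (fun m => B m * x ^+ m)).
exists v; first exact: cB.
have key K : `|v - \sum_(0 <= k < K) u k x| <= 2 * eps K.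
  have xr' : `|x| < r by lra.
  have l1 := pser_sum (K := K) (fun k => hu k x xr').
  have l : (fun N => `|\sum_(0 <= m < N) B m * x ^+ m -
      \sum_(0 <= m < N) (\sum_(0 <= k < K) b k m) * x ^+ m|) @ \oo -->
      `|v - \sum_(0 <= k < K) u k x|.
    by apply: cvg_norm; apply: cvgB => //; exact: cB.
  apply: (cvgr_to_le l); apply: nearW => N; rewrite -sumrB.
  apply: le_trans (ler_norm_sum _ _ _) _.
  under eq_bigr do rewrite -mulrBl.
  by apply: geo => m; exact: BK.
apply/cvgrPdist_le => e e0.
have l : (fun K => 2 * eps K) @ \oo --> (0 : R).
  by rewrite -[X in _ --> X](mulr0 2); apply: cvgMl_tmp.
move/cvgrPdist_le : l => /(_ e e0); apply: filterS => K.
rewrite sub0r normrN => h; apply: le_trans (key K) _.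
exact: le_trans (ler_norm _) h.
Qed.

Lemma pser_coef_bounded (R : realType) (c : nat -> R) (x v : R) :
  pser_to c x v -> exists2 C, 0 <= C & forall m, `|c m| * `|x| ^+ m <= C.
Proof.
move=> h; have /cvg_series_cvg_0 h0 : cvgn (series (fun m => c m * x ^+ m)).
  by apply/cvg_ex; exists v.
have [C hC] := cvg_has_ub (cvgP _ h0).
exists `|C| => // m; rewrite -normrX -normrM (le_trans _ (ler_norm C))//.
by apply: hC; exists m.
Qed.

(** At the first nonzero coefficient [c M], dividing the vanishing sum by [x^M] leaves [c M] plus a
    tail O(x), which is impossible for small [x > 0]. Points on the right of 0 are enough, as
    [identity_half_line] requires. *)
Lemma pser_eq0 (R : realType) (c : nat -> R) (r : R) :
  0 < r -> (forall x, 0 < x < r -> pser_to c x 0) -> forall m, c m = 0.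
Proof.
move=> r0 h m; apply/eqP/negPn/negP => cm0.
have /ex_minnP[M cM minM] : exists m, c m != 0 by exists m.
have lt0 k : (k < M)%N -> c k = 0.
  by move=> kM; apply/eqP; apply: contraTT kM => /minM; rewrite -leqNgt.
pose x1 := r / 2; have x10 : 0 < x1 by rewrite divr_gt0.
have [C C0 hC] : exists2 C, 0 <= C & forall m, `|c m| * `|x1| ^+ m <= C.
  by apply: (pser_coef_bounded (v := 0)); apply: h; rewrite /x1; lra.
rewrite (gtr0_norm x10) in hC.
have key x : 0 < x <= x1 / 2 -> `|c M| * x1 ^+ M <= 2 * C * (x / x1).
  move=> /andP[x0 xx1]; pose t := x / x1.
  have t0 : 0 < t by rewrite divr_gt0.
  have t1 : t <= 1 / 2 by rewrite ler_pdivrMr//; lra.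
  have xE : x = t * x1 by rewrite divfK ?gt_eqF.
  have hx : pser_to c x 0 by apply: h; rewrite x0/= (le_lt_trans xx1)// /x1; lra.
  have tm m' : `|c m' * x ^+ m'| <= C * t ^+ m'.
    rewrite xE exprMn normrM (ger0_norm (x := t ^+ m' * _)); last first.
      by rewrite mulr_ge0// exprn_ge0// ltW.
    rewrite mulrCA mulrC; apply: ler_wpM2r; rewrite ?exprn_ge0 ?(ltW t0)//.
  have tail N : \sum_(0 <= k < N) `|c (M.+1 + k)%N * x ^+ (M.+1 + k)| <=
      C * t ^+ M.+1 * 2.
    apply: (@le_trans _ _ (\sum_(0 <= k < N) C * t ^+ M.+1 * (1 / 2) ^+ k)).
      apply: ler_sum => k _; apply: le_trans (tm _) _; rewrite exprD mulrA.
      apply: ler_wpM2l; first by rewrite mulr_ge0// exprn_ge0// ltW.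
      by apply: lerXn2r; rewrite ?nnegrE//; lra.
    rewrite -mulr_sumr; apply: ler_wpM2l; last exact: sum_half_le.
    by rewrite mulr_ge0// exprn_ge0// ltW.
  have part N : `|c M * x ^+ M| <= C * t ^+ M.+1 * 2 +
      `|\sum_(0 <= k < M.+1 + N) c k * x ^+ k|.
    rewrite (big_cat_nat (n := M.+1))//= ?leq_addr//.
    rewrite big_nat_recr//= big_nat big1 ?add0r; last first.
      by move=> k /andP[_ kM]; rewrite lt0 ?mul0r.
    have -> : \sum_(M.+1 <= k < M.+1 + N) c k * x ^+ k =
        \sum_(0 <= k < N) c (k + M.+1)%N * x ^+ (k + M.+1).
      by rewrite -{1}[M.+1]add0n big_addn addKn.
    have := tail N; set T := \sum_(0 <= k < N) (c (k + M.+1)%N * _).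
    have hT : `|T| <= \sum_(0 <= k < N) `|c (M.+1 + k)%N * x ^+ (M.+1 + k)|.
      apply: le_trans (ler_norm_sum _ _ _) _; apply: ler_sum => k _.
      by rewrite addnC.
    have := ler_normB (c M * x ^+ M + T) T; rewrite addrK.
    by lra.
  have l : (fun N => C * t ^+ M.+1 * 2 + `|\sum_(0 <= k < M.+1 + N) c k * x ^+ k|)
      @ \oo --> C * t ^+ M.+1 * 2 + `|0 : R|.
    apply: cvgD; first exact: cvg_cst.
    apply: cvg_norm; have := hx; rewrite /pser_to -(cvg_shiftn M.+1).
    by under eq_fun do rewrite addnC.
  have {l} : `|c M * x ^+ M| <= C * t ^+ M.+1 * 2 + `|0 : R|.
    by apply: (cvgr_to_ge l); apply: nearW => N; exact: part.
  rewrite normr0 addr0 xE exprMn normrM (ger0_norm (x := t ^+ M * _)); last first.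
    by rewrite mulr_ge0// exprn_ge0// ltW.
  have tM : 0 < t ^+ M by rewrite exprn_gt0.
  rewrite mulrCA exprS (_ : C * (t * t ^+ M) * 2 = t ^+ M * (2 * C * t)); last by ring.
  by rewrite ler_pM2l// mulfK ?gt_eqF.
have c0 : 0 < `|c M| * x1 ^+ M by rewrite mulr_gt0 ?normr_gt0 ?exprn_gt0.
set e := `|c M| * x1 ^+ M in c0 key.
(* The second entry makes the right side of [key] at most [e / 2]; [C + 1] guards against
   [C = 0]. *)
pose x := Num.min (x1 / 2) (e * x1 / (4 * (C + 1))).
have x0 : 0 < x.
  rewrite lt_min; apply/andP; split; first by rewrite divr_gt0.
  by apply: divr_gt0; apply: mulr_gt0 => //; lra.
have := key x; rewrite x0 /= ge_min lexx/= => /(_ isT).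
have : x <= e * x1 / (4 * (C + 1)) by rewrite ge_min lexx orbT.
have a0 : 0 <= 2 * C / x1 by rewrite divr_ge0 ?mulr_ge0// ltW.
move=> /(ler_wpM2l a0).
have -> : 2 * C / x1 * (e * x1 / (4 * (C + 1))) = e * (C / (2 * (C + 1))).
  by field; rewrite !gt_eqF//; lra.
have : e * (C / (2 * (C + 1))) <= e * (1 / 2).
  by apply: ler_wpM2l; [exact: ltW|rewrite ler_pdivrMr; lra].
have -> : 2 * C / x1 * x = 2 * C * (x / x1) by ring.
lra.
Qed.

Lemma pser_inj (R : realType) (b c : nat -> R) (v : R -> R) (r : R) :
  0 < r -> (forall x, 0 < x < r -> pser_to b x (v x) /\ pser_to c x (v x)) ->
  b = c.
Proof.
move=> r0 h; apply/funext => m; apply/eqP; rewrite -subr_eq0; apply/eqP.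
apply: (pser_eq0 (c := fun m => b m - c m) r0) => x /h[hb hc].
rewrite /pser_to -[X in _ --> X](subrr (v x)).
have -> : (fun N => \sum_(0 <= m < N) (b m - c m) * x ^+ m) = fun N =>
    \sum_(0 <= m < N) b m * x ^+ m - \sum_(0 <= m < N) c m * x ^+ m.
  by apply/funext => N; rewrite -sumrB; apply: eq_bigr => k _; rewrite mulrBl.
exact: cvgB.
Qed.

(* Identity theorem on the half-line: at a supremum of the points where
   convergence fails, the two power series agree on the right side only, hence
   everywhere nearby. *)
Lemma identity_half_line (R : realType) (S : nat -> R -> R) (g : R -> R) :
  (forall x, 0 < x -> exists B c r, 0 < r /\ forall h, `|h| < r ->
     (exists2 v, pser_to B h v & (fun K => S K (x + h)) @ \oo --> v) /\
     pser_to c h (g (x + h))) ->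
  (forall x, 1 < x -> (fun K => S K x) @ \oo --> g x) ->
  forall x, 0 < x -> (fun K => S K x) @ \oo --> g x.
Proof.
move=> loc far x1 x10; apply: contrapT => bad.
pose T := [set x : R | 0 < x /\ ~ ((fun K => S K x) @ \oo --> g x)].
have T1 : ubound T 1.
  by move=> x [x0 hx]; rewrite leNgt; apply/negP => /far.
have supT : has_sup T by split; [exists x1|exists 1].
pose x0 := sup T.
have x1x0 : x1 <= x0 by apply: ub_le_sup => //; exists 1.
have x00 : 0 < x0 by exact: lt_le_trans x1x0.
have good x : x0 < x -> (fun K => S K x) @ \oo --> g x.
  move=> xx; apply: contrapT => hx.
  have : x <= x0 by apply: ub_le_sup; [exists 1|split => //; exact: lt_trans xx].
  by rewrite leNgt xx.
have [B [c [r [r0 hr]]]] := loc _ x00.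
have BC : B = c.
  apply: (pser_inj (v := fun h => g (x0 + h)) r0) => h /andP[h0 hlt].
  have hr' : `|h| < r by rewrite gtr0_norm.
  have [[v Bv Sv] cg] := hr _ hr'; split => //.
  have gd : (fun K => S K (x0 + h)) @ \oo --> g (x0 + h) by apply: good; rewrite ltrDl.
  by rewrite -(cvg_unique _ Sv gd).
(* A bad point within [r] to the left of the supremum: it lies in the disc where the two expansions
   now coincide. *)
have [x [x_gt0 hx] xr] := sup_adherent r0 supT.
have xx0 : x <= x0 by apply: ub_le_sup; [exists 1|].
apply: hx; have hh : `|x - x0| < r.
  have := xx0.
  rewrite -/x0 in xr; rewrite -subr_le0 => /ler0_norm ->; lra.
have [[v Bv Sv] cg] := hr _ hh.
rewrite addrC subrK in Sv cg; rewrite BC in Bv.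
by rewrite (cvg_unique _ cg Bv).
Qed.

Definition ranalytic (R : realType) (F : R -> R) (x0 : R) :=
  exists c r, 0 < r /\ forall h, `|h| < r -> pser_to c h (F (x0 + h)).

Lemma ranalyticD (R : realType) (F G : R -> R) (x0 : R) :
  ranalytic F x0 -> ranalytic G x0 -> ranalytic (fun x => F x + G x) x0.
Proof.
move=> [c [r [r0 hc]]] [b [s [s0 hb]]].
exists (fun m => c m + b m), (Num.min r s); rewrite lt_min r0; split => // h.
rewrite lt_min => /andP[hr hs]; rewrite /pser_to.
have -> : (fun N => \sum_(0 <= m < N) (c m + b m) * h ^+ m) = fun N =>
    \sum_(0 <= m < N) c m * h ^+ m + \sum_(0 <= m < N) b m * h ^+ m.
  by apply/funext => N; rewrite -big_split/=; apply: eq_bigr => k _; rewrite mulrDl.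
by apply: cvgD; [exact: hc|exact: hb].
Qed.

Lemma ranalyticZ (R : realType) (F : R -> R) (a x0 : R) :
  ranalytic F x0 -> ranalytic (fun x => a * F x) x0.
Proof.
move=> [c [r [r0 hc]]]; exists (fun m => a * c m), r; split => // h hr.
rewrite /pser_to.
have -> : (fun N => \sum_(0 <= m < N) (a * c m) * h ^+ m) = fun N =>
    a * \sum_(0 <= m < N) c m * h ^+ m.
  by apply/funext => N; rewrite mulr_sumr; apply: eq_bigr => k _; rewrite mulrA.
by apply: cvgMl_tmp; exact: hc.
Qed.

Lemma cvg_exp_series (R : realType) (x : R) :
  (fun K => \sum_(0 <= i < K) x ^+ i / i`!%:R) @ \oo --> expR x.
Proof. exact: is_cvg_series_exp_coeff. Qed.

Lemma exp_series_le (R : realType) (x : R) (K : nat) : 0 <= x ->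
  \sum_(0 <= i < K) x ^+ i / i`!%:R <= expR x.
Proof.
move=> x0; apply: nondecreasing_cvgn_le; last exact: is_cvg_series_exp_coeff.
by apply: nondecreasing_series => k _ _; rewrite divr_ge0 ?exprn_ge0.
Qed.

Lemma pser_shift (R : realType) (c : nat -> R) (i : nat) (x v : R) :
  pser_to c x v ->
  pser_to (fun m => if (m < i)%N then 0 else c (m - i)%N) x (x ^+ i * v).
Proof.
move=> h; rewrite /pser_to -(cvg_shiftn i).
have -> : (fun N => \sum_(0 <= m < N + i)
    (if (m < i)%N then 0 else c (m - i)%N) * x ^+ m) =
  fun N => x ^+ i * \sum_(0 <= m < N) c m * x ^+ m.
  apply/funext => N; rewrite (big_cat_nat (n := i)) ?leq_addl//=.
  rewrite big_nat big1 ?add0r => [|m /andP[_ ->]]; last by rewrite mul0r.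
  rewrite -{1}(add0n i) big_addn addnK mulr_sumr; apply: eq_bigr => m _.
  by rewrite ltnNge leq_addl/= addnK exprD; ring.
by apply: cvgMl_tmp.
Qed.

(** The product is expanded as the sum over [i] of the i-th Taylor term of the exponential times the
    series of [F]; each is a shifted power series, and [pser_series] sums them, dominated by
    [exp (|l| * r1)]. *)
Lemma ranalytic_expM (R : realType) (F : R -> R) (l x0 : R) :
  ranalytic F x0 -> ranalytic (fun x => expR (l * x) * F x) x0.
Proof.
move=> [c [r [r0 hc]]]; pose r1 := r / 2; have r10 : 0 < r1 by rewrite divr_gt0.
have [C C0 hC] : exists2 C, 0 <= C & forall m, `|c m| * `|r1| ^+ m <= C.
  apply: (pser_coef_bounded (v := F (x0 + r1))); apply: hc.
  by rewrite gtr0_norm// /r1; lra.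
rewrite (gtr0_norm r10) in hC.
pose E := expR (l * x0).
pose a i := E * (l ^+ i / i`!%:R).
pose b i m := a i * (if (m < i)%N then 0 else c (m - i)%N).
pose u i h := a i * (h ^+ i * F (x0 + h)).
have hu i h : `|h| < r1 -> pser_to (b i) h (u i h).
  move=> hr; have hr' : `|h| < r by rewrite /r1 in hr; have := normr_ge0 h; lra.
  have := pser_shift (i := i) (hc _ hr'); rewrite /pser_to /b /u => H.
  have -> : (fun N => \sum_(0 <= m < N) a i * (if (m < i)%N then 0 else c (m - i)%N)
      * h ^+ m) = fun N => a i * \sum_(0 <= m < N)
      (if (m < i)%N then 0 else c (m - i)%N) * h ^+ m.
    by apply/funext => N; rewrite mulr_sumr; apply: eq_bigr => k _; rewrite mulrA.
  exact: cvgMl_tmp.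
pose w i := E * C * ((`|l| * r1) ^+ i / i`!%:R).
have E0 : 0 < E by exact: expR_gt0.
have hb i m : `|b i m| * r1 ^+ m <= w i.
  have w0 : 0 <= w i.
    by rewrite /w !mulr_ge0 ?exprn_ge0 ?mulr_ge0 ?invr_ge0// ?ltW.
  rewrite /b; case: ltnP => im; first by rewrite mulr0 normr0 mul0r.
  have -> : r1 ^+ m = r1 ^+ (m - i) * r1 ^+ i by rewrite -exprD subnK.
  rewrite /w /a !normrM normrX normfV (gtr0_norm E0).
  rewrite (@ger0_norm _ (i`!%:R))// (exprMn i `|l| r1).
  have -> : E * (`|l| ^+ i / i`!%:R) * `|c (m - i)%N| * (r1 ^+ (m - i) * r1 ^+ i) =
    (E * (`|l| ^+ i * r1 ^+ i / i`!%:R)) * (`|c (m - i)%N| * r1 ^+ (m - i)) by ring.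
  have -> : E * C * (`|l| ^+ i * r1 ^+ i / i`!%:R) =
    (E * (`|l| ^+ i * r1 ^+ i / i`!%:R)) * C by ring.
  apply: ler_wpM2l => //.
  by rewrite mulr_ge0 ?divr_ge0 ?mulr_ge0 ?exprn_ge0// ?ltW.
have hW K : \sum_(0 <= i < K) w i <= E * C * expR (`|l| * r1).
  rewrite -mulr_sumr; apply: ler_wpM2l; first by rewrite mulr_ge0// ltW.
  by apply: exp_series_le; rewrite mulr_ge0// ltW.
have [B hB] := pser_series r10 hu hb hW.
exists B, (r1 / 2); split; first by rewrite divr_gt0.
move=> h hr; have [v Bv uv] := hB h hr.
suff -> : expR (l * (x0 + h)) * F (x0 + h) = v by [].
apply: (cvg_unique _ _ uv) => //.
rewrite mulrDr expRD -/E.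
have -> : (fun K => \sum_(0 <= k < K) u k h) = fun K =>
    E * (\sum_(0 <= i < K) (l * h) ^+ i / i`!%:R) * F (x0 + h).
  apply/funext => K; rewrite mulr_sumr mulr_suml; apply: eq_bigr => k _.
  by rewrite /u /a exprMn; ring.
by apply: cvgMr_tmp; apply: cvgMl_tmp; exact: cvg_exp_series.
Qed.

(** * The alternating zeta series *)

(* For [phi = cos (y * _)] and [phi = - sin (y * _)] these are the real and
   imaginary parts of [k^(- x - i y)]. *)
Definition osc (R : realType) (phi : R -> R) (k : nat) (x : R) : R :=
  expR (- (x * ln k%:R)) * phi (ln k%:R).

Lemma expr_sub_le (R : realType) (a b : R) (m : nat) : 0 <= a <= b ->
  b ^+ m.+1 - a ^+ m.+1 <= m.+1%:R * b ^+ m * (b - a).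
Proof.
move=> /andP[a0 ab]; have b0 : 0 <= b by exact: le_trans ab.
rewrite subrXX [leLHS]mulrC; apply: ler_wpM2r; first by rewrite subr_ge0.
apply: (@le_trans _ _ (\sum_(i < m.+1) b ^+ m)); last first.
  by rewrite sumr_const card_ord -[leLHS]mulr_natl.
apply: ler_sum => i _; have im : (i <= m)%N by rewrite -ltnS.
rewrite -[in leRHS](subnK im) exprD; apply: ler_wpM2l; first exact: exprn_ge0.
by apply: lerXn2r; rewrite ?nnegrE.
Qed.

(** Bounds the weighted Taylor coefficients at [x0] of one pair of consecutive terms. The difference
    gains [1 / k] through [ln (k + 1) - ln k], while the weight [r^m] costs only [(k + 1)^r],
    because [(r * l')^m / m!] is a single term of [exp (r * l')]. *)
Lemma osc_coef_le (R : realType) (phi : R -> R) (Y x0 r : R) (k m : nat) :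
  (forall a, `|phi a| <= 1) -> 0 <= Y ->
  (forall a b, `|phi b - phi a| <= Y * `|b - a|) -> 0 <= x0 -> 0 <= r ->
  (0 < k)%N ->
  `|(- ln k%:R) ^+ m / m`!%:R * osc phi k x0 -
    (- ln k.+1%:R) ^+ m / m`!%:R * osc phi k.+1 x0| * r ^+ m <=
  (r + x0 + Y) * (k.+1%:R `^ r * (k%:R `^ (- x0) / k%:R)).
Proof.
move=> p1 Y0 pl x00 r0 k0.
set l := ln k%:R; set l' := ln k.+1%:R.
have l0 : 0 <= l by rewrite ln_ge0// ler1n.
have ll : l <= l' by rewrite ler_ln ?posrE ?ltr0n// ler_nat.
have l'0 : 0 <= l' by exact: le_trans ll.
have kR0 : 0 < k%:R :> R by rewrite ltr0n.
have dl : l' - l <= k%:R^-1 by exact: lnstep_le.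
have pk : k%:R `^ (- x0) = expR (- (x0 * l)) :> R by rewrite /powR gt_eqF// mulNr.
have pk1 : k.+1%:R `^ r = expR (r * l') :> R by rewrite /powR gt_eqF ?ltr0n.
rewrite pk pk1 /osc -/l -/l'.
set al := expR (- (x0 * l)); set al' := expR (- (x0 * l')).
have al0 : 0 < al by exact: expR_gt0.
have al'0 : 0 < al' by exact: expR_gt0.
have aa : al' <= al by rewrite ler_expR lerN2; apply: ler_wpM2l.
have ad : al - al' <= x0 * al * (l' - l).
  have -> : al' = al * expR (- (x0 * (l' - l))).
    by rewrite -expRD; congr expR; ring.
  have := expR_ge1Dx (- (x0 * (l' - l))).
  by move/(ler_wpM2l (ltW al0)); lra.
set f : R := m`!%:R^-1; have f0 : 0 <= f by rewrite invr_ge0.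
set e := expR (r * l'); have e0 : 0 < e by exact: expR_gt0.
have rl n : (r * l') ^+ n / n`!%:R <= e.
  rewrite /e; apply: le_trans (exp_series_le n.+1 (mulr_ge0 r0 l'0)).
  rewrite big_nat_recr//= lerDr sumr_ge0// => i _.
  by rewrite divr_ge0 ?exprn_ge0// mulr_ge0.
have -> : (- l) ^+ m * f * (al * phi l) - (- l') ^+ m * f * (al' * phi l') =
  (-1) ^+ m * ((l ^+ m - l' ^+ m) * f * (al * phi l) +
    l' ^+ m * f * ((al - al') * phi l - al' * (phi l' - phi l))).
  by rewrite (exprNn l) (exprNn l'); ring.
rewrite normrM normrX normrN1 expr1n mul1r.
have A1 : `|(l ^+ m - l' ^+ m) * f * (al * phi l)| * r ^+ m <= r * e * (al * (l' - l)).
  rewrite normrM (normrM al) (gtr0_norm al0) (normrM _ f) (ger0_norm f0).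
  have h : `|l ^+ m - l' ^+ m| * f * r ^+ m <= r * e * (l' - l).
    move: f0; rewrite /f; case: (m) => [|n] f0.
      by rewrite !expr0 subrr normr0 !mul0r !mulr_ge0 ?subr_ge0 ?(ltW e0).
    rewrite distrC ger0_norm; last first.
      by rewrite subr_ge0; apply: lerXn2r; rewrite ?nnegrE.
    have ab : 0 <= l <= l' by rewrite l0.
    have f0' : 0 <= n.+1`!%:R^-1 * r ^+ n.+1 by rewrite mulr_ge0 ?exprn_ge0.
    rewrite -mulrA; apply: le_trans (ler_wpM2r f0' (expr_sub_le n ab)) _.
    have -> : n.+1%:R * l' ^+ n * (l' - l) * (n.+1`!%:R^-1 * r ^+ n.+1) =
        r * ((r * l') ^+ n / n`!%:R) * (l' - l).
      rewrite factS natrM exprMn exprS; field.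
      by rewrite -(natrD R 1 n) !pnatr_eq0 -lt0n fact_gt0.
    apply: ler_wpM2r; first by rewrite subr_ge0.
    by apply: ler_wpM2l => //; exact: rl.
  have -> : `|l ^+ m - l' ^+ m| * f * (al * `|phi l|) * r ^+ m =
     (`|l ^+ m - l' ^+ m| * f * r ^+ m) * (al * `|phi l|) by ring.
  have -> : r * e * (al * (l' - l)) = (r * e * (l' - l)) * (al * 1) by ring.
  apply: ler_pM => //; rewrite ?mulr_ge0 ?exprn_ge0 ?(ltW al0)//.
  by apply: ler_wpM2l; [exact: ltW|exact: p1].
have A2 : `|l' ^+ m * f * ((al - al') * phi l - al' * (phi l' - phi l))| * r ^+ m <=
    e * ((x0 + Y) * (al * (l' - l))).
  rewrite normrM ger0_norm ?mulr_ge0 ?exprn_ge0// mulrAC.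
  have -> : l' ^+ m * f * r ^+ m = (r * l') ^+ m / m`!%:R by rewrite exprMn /f; ring.
  apply: ler_pM => //; first by rewrite divr_ge0 ?exprn_ge0// mulr_ge0.
  apply: le_trans (ler_normB _ _) _; rewrite !normrM.
  rewrite (ger0_norm (_ : 0 <= al - al')) ?subr_ge0// (gtr0_norm al'0).
  have h1 : (al - al') * `|phi l| <= x0 * al * (l' - l).
    apply: le_trans ad; rewrite -[leRHS]mulr1; apply: ler_wpM2l; last exact: p1.
    by rewrite subr_ge0.
  have h2 : al' * `|phi l' - phi l| <= al * (Y * (l' - l)).
    apply: ler_pM => //; first exact: ltW.
    by have := pl l l'; rewrite (ger0_norm (_ : 0 <= l' - l)) ?subr_ge0.
  by lra.
apply: (@le_trans _ _ ((r + x0 + Y) * (e * (al * (l' - l))))).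
  apply: (@le_trans _ _ (`|(l ^+ m - l' ^+ m) * f * (al * phi l)| * r ^+ m +
    `|l' ^+ m * f * ((al - al') * phi l - al' * (phi l' - phi l))| * r ^+ m)).
    by rewrite -mulrDl; apply: ler_wpM2r; [exact: exprn_ge0|exact: ler_normD].
  by lra.
apply: ler_wpM2l; first by rewrite !addr_ge0.
by do 2 (apply: ler_wpM2l; first exact: ltW).
Qed.

Lemma osc_pser (R : realType) (phi : R -> R) (k : nat) (x0 h : R) :
  pser_to (fun m => (- ln k%:R) ^+ m / m`!%:R * osc phi k x0) h
    (osc phi k (x0 + h)).
Proof.
have -> : osc phi k (x0 + h) = expR (- ln k%:R * h) * osc phi k x0.
  by rewrite /osc mulrA -expRD; congr (expR _ * _); ring.
rewrite /pser_to.
have -> : (fun N => \sum_(0 <= m < N) (- ln k%:R) ^+ m / m`!%:R * osc phi k x0 * h ^+ m)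
    = fun N => (\sum_(0 <= m < N) (- ln k%:R * h) ^+ m / m`!%:R) * osc phi k x0.
  apply/funext => N; rewrite mulr_suml; apply: eq_bigr => m _.
  by rewrite exprMn; ring.
by apply: cvgMr_tmp; exact: cvg_exp_series.
Qed.

(** Summing the alternating series in pairs makes it absolutely convergent for all [x > 0], as the
    domination in [pser_series] demands. *)
Definition eta_part (R : realType) (phi : R -> R) (K : nat) (x : R) : R :=
  \sum_(0 <= j < K) (osc phi (2 * j).+1 x - osc phi (2 * j).+2 x).

Lemma sum_powRNB1_all (R : realType) (r : R) (K : nat) : 0 < r ->
  \sum_(0 <= j < K) j.+1%:R `^ (- 1 - r) <= 1 + 1 / r.
Proof.
move=> r0; case: K => [|K].
  by rewrite big_geq// addr_ge0// divr_ge0// ltW.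
rewrite big_nat_recl//= powR1; apply: lerD => //.
have := @sum_powRNB1 R r 1 K.+2 r0 isT; rewrite powR1.
by rewrite big_add1/= big_add1/=.
Qed.

Lemma eta_part_local (R : realType) (phi : R -> R) (Y x0 : R) :
  (forall a, `|phi a| <= 1) -> 0 <= Y ->
  (forall a b, `|phi b - phi a| <= Y * `|b - a|) -> 0 < x0 ->
  exists B r, 0 < r /\ forall h, `|h| < r ->
    exists2 v, pser_to B h v & (fun K => eta_part phi K (x0 + h)) @ \oo --> v.
Proof.
(* With [r = x0 / 2] the bound [k^(r - x0 - 1)] of a pair becomes the summable [k^(- 1 - r)]. *)
move=> p1 Y0 pl x00; pose r := x0 / 2; have r0 : 0 < r by rewrite divr_gt0.
pose u j h := osc phi (2 * j).+1 (x0 + h) - osc phi (2 * j).+2 (x0 + h).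
pose b j m := (- ln (2 * j).+1%:R) ^+ m / m`!%:R * osc phi (2 * j).+1 x0 -
    (- ln (2 * j).+2%:R) ^+ m / m`!%:R * osc phi (2 * j).+2 x0.
pose w j := (r + x0 + Y) * ((2 * j).+2%:R `^ r * ((2 * j).+1%:R `^ (- x0) / (2 * j).+1%:R)).
have hu j h : `|h| < r -> pser_to (b j) h (u j h).
  move=> _; rewrite /pser_to /b /u.
  have -> : (fun N => \sum_(0 <= m < N)
      ((- ln (2 * j).+1%:R) ^+ m / m`!%:R * osc phi (2 * j).+1 x0 -
       (- ln (2 * j).+2%:R) ^+ m / m`!%:R * osc phi (2 * j).+2 x0) * h ^+ m) =
    fun N => (\sum_(0 <= m < N)
      (- ln (2 * j).+1%:R) ^+ m / m`!%:R * osc phi (2 * j).+1 x0 * h ^+ m) -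
      (\sum_(0 <= m < N)
       (- ln (2 * j).+2%:R) ^+ m / m`!%:R * osc phi (2 * j).+2 x0 * h ^+ m).
    by apply/funext => N; rewrite -sumrB; apply: eq_bigr => m _; rewrite mulrBl.
  by apply: cvgB; exact: osc_pser.
have hb j m : `|b j m| * r ^+ m <= w j.
  exact: (osc_coef_le _ p1 Y0 pl (ltW x00) (ltW r0)).
have hW K : \sum_(0 <= j < K) w j <= (r + x0 + Y) * (2 `^ r * (1 + 1 / r)).
  rewrite -mulr_sumr; apply: ler_wpM2l; first by rewrite !addr_ge0 ?(ltW r0) ?(ltW x00).
  apply: le_trans (ler_wpM2l (powR_ge0 _ _) (sum_powRNB1_all K r0)).
  rewrite mulr_sumr; apply: ler_sum => j _.
  have k0 : 0 < (2 * j).+1%:R :> R by rewrite ltr0n.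
  have j0 : 0 < j.+1%:R :> R by rewrite ltr0n.
  have -> : (2 * j).+2%:R = 2 * j.+1%:R :> R by rewrite -natrM; congr _%:R; lia.
  rewrite powRM//.
  rewrite -mulrA; apply: ler_wpM2l; first exact: powR_ge0.
  have -> : j.+1%:R `^ (- 1 - r) = j.+1%:R `^ r * (j.+1%:R `^ (- x0) / j.+1%:R) :> R.
    rewrite -{4}(powRr1 (ltW j0)) -powRB ?(gt_eqF j0) ?implybT// -powRD; last first.
      by rewrite (gt_eqF j0) implybT.
    by congr (_ `^ _); rewrite /r; lra.
  have jk : j.+1%:R <= (2 * j).+1%:R :> R by rewrite ler_nat; lia.
  apply: ler_wpM2l; first exact: powR_ge0.
  apply: ler_pM; rewrite ?powR_ge0 ?invr_ge0//; last by rewrite lef_pV2 ?posrE.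
  rewrite !powRN lef_pV2 ?posrE ?powR_gt0//.
  by apply: ge0_ler_powR; rewrite ?nnegrE// ltW.
have [B hB] := pser_series r0 hu hb hW.
exists B, (r / 2); split; first by rewrite divr_gt0.
by move=> h hr; exact: hB.
Qed.

Lemma cvg_normc (R : realType) (u : nat -> R[i]) (l : R[i]) :
  (u : nat -> R[i]^o) @ \oo --> (l : R[i]^o) <->
  (fun n => normc (u n - l)) @ \oo --> (0 : R).
Proof.
split.
  move/cvgrPdist_le => h; apply/cvgrPdist_le => e e0.
  have /h : (0 : R[i]) < e%:C by rewrite ltcR.
  apply: filterS => n H; rewrite sub0r normrN ger0_norm ?normc_ge0//.
  by rewrite normc_distC -lecR; exact: H.
move/cvgrPdist_le => h; apply/cvgrPdist_le => e.
rewrite ltcE/= => /andP[/eqP e0 ep].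
have := h _ ep; apply: filterS => n.
rewrite sub0r normrN ger0_norm ?normc_ge0// normc_distC => hn.
have -> : e = (complex.Re e)%:C by case: (e) e0 => a b /= ->.
by rewrite lecE/= eqxx.
Qed.

Lemma cvg_ReIm (R : realType) (u : nat -> R[i]) (l : R[i]) :
  (u : nat -> R[i]^o) @ \oo --> (l : R[i]^o) <->
  ((fun n => complex.Re (u n)) @ \oo --> complex.Re l) /\
  ((fun n => complex.Im (u n)) @ \oo --> complex.Im l).
Proof.
split.
  move=> /cvg_normc /cvgrPdist_le h; split; apply/cvgrPdist_le => e e0;
    have := h e e0; apply: filterS => n; rewrite sub0r normrN ger0_norm ?normc_ge0//.
    by apply: le_trans; rewrite distrC -raddfB; exact: normr_Re_le.
  by apply: le_trans; rewrite distrC -raddfB; exact: normr_Im_le.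
move=> [hr hi]; apply/cvg_normc.
apply: (@squeeze_cvgr _ _ _ _ (cst 0) (fun n => `|complex.Re (u n) - complex.Re l| +
    `|complex.Im (u n) - complex.Im l|)).
- by apply: nearW => n /=; rewrite normc_ge0/= -!raddfB; exact: normc_le_ReIm.
- exact: cvg_cst.
- rewrite -[X in _ --> X](addr0 (0 : R)) -{1}(normr0 R) -{2}(normr0 R).
  apply: cvgD; apply: cvg_norm.
    by rewrite -(subrr (complex.Re l)); apply: cvgB => //; exact: cvg_cst.
  by rewrite -(subrr (complex.Im l)); apply: cvgB => //; exact: cvg_cst.
Qed.

Lemma cvg_ext (T : topologicalType) (u v : nat -> T) (l : T) :
  u =1 v -> u @ \oo --> l -> v @ \oo --> l.
Proof. by move=> /funext ->. Qed.

(** On a horizontal line the increment is real, so real and imaginary parts of the coefficients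
    separate. *)
Lemma analytic_at_Re_Im (R : realType) (f : R[i] -> R[i]) (x0 y : R) :
  analytic_at f (x0 +i* y) ->
  ranalytic (fun x => complex.Re (f (x +i* y))) x0 /\
  ranalytic (fun x => complex.Im (f (x +i* y))) x0.
Proof.
move=> [c [r [r0 hc]]].
have pw (h : R) k : (h%:C : R[i]) ^+ k = (h ^+ k)%:C by rewrite rmorphXn.
have H h : `|h| < r -> csum_to (fun k => c k * h%:C ^+ k) (f ((x0 + h) +i* y)).
  move=> hr; have E : ((x0 + h) +i* y) - (x0 +i* y) = h%:C :> R[i].
    by apply/eqP; rewrite eq_complex/= addrC addKr subrr !eqxx.
  have := hc ((x0 + h) +i* y); rewrite E; apply.
  by rewrite normc_def/= expr0n/= addr0 sqrtr_sqr ltcR.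
split; [exists (fun k => complex.Re (c k))|exists (fun k => complex.Im (c k))];
  exists r; split => // h /H /cvg_ReIm[hR hI].
  apply: cvg_ext hR => N.
  rewrite raddf_sum; apply: eq_bigr => k _; rewrite pw.
  by case: (c k) => a b /=; rewrite mulr0 subr0.
apply: cvg_ext hI => N.
rewrite raddf_sum; apply: eq_bigr => k _; rewrite pw.
by case: (c k) => a b /=; rewrite mulr0 add0r.
Qed.

Lemma dirichlet_term_osc (R : realType) (k : nat) (x y : R) :
  dirichlet_term k (x +i* y) =
  osc (fun a => cos (y * a)) k x +i* osc (fun a => - sin (y * a)) k x.
Proof.
rewrite /dirichlet_term /cexp/= !mulr0 subr0 add0r /osc cosN sinN.
by rewrite mulrN.
Qed.

Definition eta_sum (R : realType) (K : nat) (s : R[i]) : R[i] :=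
  \sum_(0 <= j < K) (dirichlet_term (2 * j).+1 s - dirichlet_term (2 * j).+2 s).

Lemma eta_sum_Re (R : realType) (K : nat) (x y : R) :
  complex.Re (eta_sum K (x +i* y)) = eta_part (fun a => cos (y * a)) K x.
Proof.
rewrite /eta_sum raddf_sum; apply: eq_bigr => j _.
by rewrite !dirichlet_term_osc.
Qed.

Lemma eta_sum_Im (R : realType) (K : nat) (x y : R) :
  complex.Im (eta_sum K (x +i* y)) = eta_part (fun a => - sin (y * a)) K x.
Proof.
rewrite /eta_sum raddf_sum; apply: eq_bigr => j _.
by rewrite !dirichlet_term_osc.
Qed.

Lemma npow2_dirichlet_term (R : realType) (k : nat) (s : R[i]) : (0 < k)%N ->
  npow 2 (1 - s) * dirichlet_term k s = 2 * dirichlet_term (2 * k) s.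
Proof.
move=> k0; rewrite !dirichlet_termE npowM// mulrA; congr (_ * _).
have := @npowB1 R 2 (1 - s) isT.
rewrite (_ : 1 - s - 1 = - s); last by ring.
by move=> ->; rewrite rmorphMn/=; field.
Qed.

Lemma eta_sum_dsum (R : realType) (K : nat) (s : R[i]) :
  eta_sum K s = dsum (2 * K).+1 s - npow 2 (1 - s) * dsum K.+1 s.
Proof.
elim: K => [|K IH].
  by rewrite /eta_sum /dsum !big_geq// mulr0 subr0.
rewrite /eta_sum big_nat_recr//= -/(eta_sum K s) IH mulnS !addSn add0n.
rewrite /dsum [in RHS]big_nat_recr//= [in RHS]big_nat_recr//=.
rewrite [\sum_(1 <= k < K.+2) _]big_nat_recr//= mulrDr npow2_dirichlet_term//.
by rewrite mulnS addSn add1n; ring.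
Qed.

Lemma cvg_subseq_ge (R : realType) (u : nat -> R[i]^o) (l : R[i]^o) (phi : nat -> nat) :
  (forall n, (n <= phi n)%N) -> u @ \oo --> l -> (fun n => u (phi n)) @ \oo --> l.
Proof.
move=> hp; apply: cvg_comp => A [N _ NA]; exists N => // n /= Nn.
by apply: NA => /=; exact: leq_trans (hp n).
Qed.

(** For [Re s > 1] this is rearrangement of the Dirichlet series; [identity_half_line], applied
    separately to real and imaginary parts, carries it to all [Re s > 0]. The condition [y <> 0]
    keeps the line off the pole. *)
Lemma eta_zeta (R : realType) (zeta : R[i] -> R[i]) (x y : R) :
  is_riemann_zeta zeta -> y != 0 -> 0 < x ->
  (fun K => eta_sum K (x +i* y) : R[i]^o) @ \oo -->
  ((1 - npow 2 (1 - (x +i* y))) * zeta (x +i* y) : R[i]^o).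
Proof.
move=> [zd za] y0 x0.
pose cc := cos (y * ln 2); pose ss := sin (y * ln 2).
pose f1 x := complex.Re (zeta (x +i* y)); pose f2 x := complex.Im (zeta (x +i* y)).
pose e x := expR (- ln 2 * x) : R.
have an x' : ranalytic f1 x' /\ ranalytic f2 x'.
  apply: analytic_at_Re_Im; apply: za; apply/eqP => -[_ /eqP].
  by rewrite (negbTE y0).
(* Real and imaginary parts of [(1 - 2^(1 - s)) * zeta s], written with sums and exponential factors
   so that real analyticity follows from the closure lemmas. *)
pose gR x := f1 x + ((- (2 * cc)) * (e x * f1 x) + (- (2 * ss)) * (e x * f2 x)).
pose gI x := f2 x + ((- (2 * cc)) * (e x * f2 x) + (2 * ss) * (e x * f1 x)).
have gE x' : (1 - npow 2 (1 - (x' +i* y))) * zeta (x' +i* y) = gR x' +i* gI x'.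
  have -> : npow 2 (1 - (x' +i* y)) = (2 * e x' * cc) +i* (- (2 * e x' * ss)).
    rewrite /npow /cexp/= !mulr0 subr0 sub0r add0r mulNr cosN sinN mulrN -/cc -/ss.
    have -> : expR ((1 - x') * ln 2) = 2 * e x' :> R.
      rewrite mulrBl mul1r expRD lnK ?posrE//; congr (_ * expR _); ring.
    by [].
  rewrite /gR /gI /f1 /f2; case: (zeta _) => a b /=.
  by apply/eqP; rewrite eq_complex/=; apply/andP; split; apply/eqP; ring.
have rR x' : ranalytic gR x'.
  have [h1 h2] := an x'.
  by apply: ranalyticD => //; apply: ranalyticD; apply: ranalyticZ; exact: ranalytic_expM.
have rI x' : ranalytic gI x'.
  have [h1 h2] := an x'.
  by apply: ranalyticD => //; apply: ranalyticD; apply: ranalyticZ; exact: ranalytic_expM.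
have far x' : 1 < x' -> (fun K => eta_sum K (x' +i* y) : R[i]^o) @ \oo -->
    (gR x' +i* gI x' : R[i]^o).
  move=> x1; rewrite -gE mulrBl mul1r.
  have D : (fun L => dsum L.+1 (x' +i* y) : R[i]^o) @ \oo --> (zeta (x' +i* y) : R[i]^o).
    by apply: cvg_ext (zd (x' +i* y) x1) => N; rewrite /dsum big_add1.
  rewrite (_ : (fun K => _) = fun K => dsum (2 * K).+1 (x' +i* y) -
    npow 2 (1 - (x' +i* y)) * dsum K.+1 (x' +i* y)); last first.
    by apply/funext => K; exact: eta_sum_dsum.
  apply: (@cvgB _ R[i]^o).
    by apply: (cvg_subseq_ge (phi := fun K => (2 * K)%N) _ D) => n; exact: leq_pmull.
  by apply: (@cvgMl_tmp _ _ _ _ (fun K => dsum K.+1 (x' +i* y))).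
have loc (phi : R -> R) (g : R -> R) : (forall a, `|phi a| <= 1) ->
    (forall a b, `|phi b - phi a| <= `|y| * `|b - a|) ->
    (forall x, ranalytic g x) -> forall x, 0 < x -> exists B c r, 0 < r /\
     forall h, `|h| < r ->
     (exists2 v, pser_to B h v & (fun K => eta_part phi K (x + h)) @ \oo --> v) /\
     pser_to c h (g (x + h)).
  move=> p1 pl rg x' x'0; have [B [r [r0 hB]]] := eta_part_local p1 (normr_ge0 y) pl x'0.
  have [c [r' [r'0 hc]]] := rg x'.
  exists B, c, (Num.min r r'); rewrite lt_min r0; split => // h.
  by rewrite lt_min => /andP[hr hr']; split; [exact: hB|exact: hc].
have pR : (fun K => eta_part (fun a => cos (y * a)) K x) @ \oo --> gR x.
  apply: (identity_half_line (S := eta_part (fun a => cos (y * a)))) x0.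
    apply: loc => // [a|a b]; first exact: cos_max.
    by apply: le_trans (cos_lipschitz _ _) _; rewrite -mulrBr normrM.
  move=> x' /far /cvg_ReIm[h _].
  by apply: cvg_ext h => K; exact: eta_sum_Re.
have pI : (fun K => eta_part (fun a => - sin (y * a)) K x) @ \oo --> gI x.
  apply: (identity_half_line (S := eta_part (fun a => - sin (y * a)))) x0.
    apply: loc => // [a|a b]; first by rewrite normrN sin_max.
    rewrite -opprD normrN; apply: le_trans (sin_lipschitz _ _) _.
    by rewrite -mulrBr normrM.
  move=> x' /far /cvg_ReIm[_ h].
  by apply: cvg_ext h => K; exact: eta_sum_Im.
rewrite gE; apply/cvg_ReIm; split.
  by apply: cvg_ext pR => K; rewrite eta_sum_Re.
by apply: cvg_ext pI => K; rewrite eta_sum_Im.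
Qed.

(** * Approximation of zeta on and left of the line of real part 1 *)

(** [dsum L] stops before [L], so passing from [eta_sum_dsum] to the form used in [dsum_corr_limit]
    leaves one boundary term, which tends to 0. *)
Lemma dsum_eta_sum (R : realType) (L : nat) (s : R[i]) : (0 < L)%N ->
  dsum (2 * L) s - npow 2 (1 - s) * dsum L s =
  eta_sum L s + dirichlet_term (2 * L) s.
Proof.
move=> L0; have E := eta_sum_dsum L s.
rewrite {1}/dsum big_nat_recr ?muln_gt0//= -/(dsum (2 * L) s) in E.
rewrite [dsum L.+1 s]big_nat_recr//= -/(dsum L s) mulrDr npow2_dirichlet_term// in E.
by rewrite E; ring.
Qed.

Lemma normc_dirichlet_term (R : realType) (k : nat) (x y : R) : (0 < k)%N ->
  normc (dirichlet_term k (x +i* y)) = k%:R `^ (- x).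
Proof. by move=> k0; rewrite dirichlet_termE normc_npow. Qed.

(** Adds back the main term of [dsum_corr], of modulus at most [2 K^(1 - x) / |y|]. The strict
    [x < 1] is [Re w > 0] for [w = 1 - s]; [64 |y| <= K] yields [32 |w| <= K] because
    [|w| <= 2 |y|]. *)
Lemma zeta_approx_lt (R : realType) (zeta : R[i] -> R[i]) (x y : R) (K : nat) :
  is_riemann_zeta zeta -> 1 / 2 <= x < 1 -> 1 <= `|y| -> (2 < K)%N ->
  64 * `|y| <= K%:R ->
  normc (dsum K (x +i* y) - zeta (x +i* y)) <=
  272 / Num.sqrt K%:R + 2 * Num.sqrt K%:R / `|y|.
Proof.
move=> hz /andP[x0 x1] y1 K2 Ky; set s := x +i* y; set w := 1 - s.
have K0 : (0 < K)%N by exact: leq_trans K2.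
have K1 : 1 <= K%:R :> R by rewrite ler1n.
have yn0 : y != 0 by rewrite -normr_gt0; lra.
have rw : complex.Re w = 1 - x by [].
have iw : complex.Im w = - y by rewrite /w /s/= sub0r.
have wy : `|y| <= normc w by have := normr_Im_le w; rewrite iw normrN.
have w2 : normc w <= 2 * `|y|.
  apply: le_trans (normc_le_ReIm _) _; rewrite rw iw normrN ger0_norm; lra.
have w0 : w != 0 by rewrite -normc_gt0; lra.
have sE : s = 1 - w by rewrite /w; ring.
have lim : (fun L => normc (dsum (2 * L) (1 - w) - npow 2 w * dsum L (1 - w)
     - (1 - npow 2 w) * zeta s)) @ \oo --> (0 : R).
  have x00 : 0 < x by lra.
  have /cvg_normc h := eta_zeta hz yn0 x00.
  rewrite -/s -/w in h.
  rewrite -sE.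
  apply: (@squeeze_cvgr _ _ _ _ (cst 0) (fun L =>
     normc (eta_sum L s - (1 - npow 2 w) * zeta s) + L%:R `^ (- x))).
  - exists 1%N => // L /= L0; rewrite normc_ge0/= dsum_eta_sum//.
    rewrite addrAC; apply: le_trans (normcD _ _) _; apply: lerD => //.
    rewrite normc_dirichlet_term ?muln_gt0// !powRN lef_pV2 ?posrE ?powR_gt0 ?ltr0n ?muln_gt0//.
    by apply: ge0_ler_powR; rewrite ?nnegrE ?ler_nat ?leq_pmull// ltW.
  - exact: cvg_cst.
  - by rewrite -[X in _ --> X](addr0 (0 : R)); apply: cvgD => //; exact: powR_cvgn0.
have rwb : 0 < complex.Re w <= 1 / 2 by rewrite rw; lra.
have hA := @dsum_corr_limit R w (zeta s) K (le_trans y1 wy) rwb K2 _ lim.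
have wK : 32 * normc w <= K%:R by lra.
have {}hA := hA wK.
have t1 := tau_norm_ge w0 K2 wK.
have -> : dsum K s - zeta s = (dsum_corr w K - zeta s) + npow K w / (tau w K * w).
  by rewrite /dsum_corr -sE; ring.
have sK : Num.sqrt K%:R = K%:R `^ (1 / 2) :> R by rewrite div1r powR12_sqrt.
have hb : normc (dsum_corr w K - zeta s) <= 272 / Num.sqrt K%:R.
  apply: le_trans hA _; apply: ler_wpM2l => //; rewrite rw sK -powRN.
  by apply: ler_powR => //; lra.
apply: le_trans (normcD _ _) _; apply: lerD => //.
rewrite normc_div normcM normc_npow// rw.
have y0 : 0 < `|y| by lra.
have -> : 2 * Num.sqrt K%:R / `|y| = Num.sqrt K%:R * (2 / `|y|) by ring.
apply: ler_pM; rewrite ?powR_ge0 ?invr_ge0 ?mulr_ge0 ?normc_ge0//.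
  by rewrite sK; apply: ler_powR => //; lra.
rewrite -[leRHS]invf_div lef_pV2 ?posrE ?divr_gt0//; last by rewrite mulr_gt0//; lra.
have -> : `|y| / 2 = 1 / 2 * `|y| by ring.
by apply: ler_pM => //; lra.
Qed.

Lemma ranalytic_cvg (R : realType) (F : R -> R) (x0 : R) (h : nat -> R) :
  ranalytic F x0 -> h @ \oo --> (0 : R) ->
  (fun n => F (x0 + h n)) @ \oo --> F x0.
Proof.
move=> [c [r [r0 hc]]] h0; pose r1 := r / 2; have r10 : 0 < r1 by rewrite divr_gt0.
have [C C0 hC] : exists2 C, 0 <= C & forall m, `|c m| * `|r1| ^+ m <= C.
  apply: (pser_coef_bounded (v := F (x0 + r1))); apply: hc.
  by rewrite gtr0_norm// /r1; lra.
rewrite (gtr0_norm r10) in hC.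
have c0 : F x0 = c 0%N.
  have := hc 0; rewrite normr0 addr0 => /(_ r0) l.
  suff l2 : pser_to c 0 (c 0%N) by exact: (cvg_unique _ l l2).
  rewrite /pser_to -(cvg_shiftS (fun N => \sum_(0 <= m < N) c m * 0 ^+ m)).
  apply: (@cvg_ext _ (cst (c 0%N))); last exact: cvg_cst.
  move=> N /=; rewrite big_nat_recl//= expr0 mulr1 big1 ?addr0// => m _.
  by rewrite expr0n/= mulr0.
have key e : `|e| <= r1 / 2 -> `|F (x0 + e) - F x0| <= 2 * C / r1 * `|e|.
  move=> er; pose t := `|e| / r1.
  have t0 : 0 <= t by rewrite divr_ge0// ltW.
  have t1 : t <= 1 / 2 by rewrite ler_pdivrMr//; lra.
  have l : (fun N => `|\sum_(0 <= m < N.+1) c m * e ^+ m - c 0%N|) @ \oo -->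
      `|F (x0 + e) - c 0%N|.
    apply: cvg_norm; apply: cvgB; last exact: cvg_cst.
    have er' : `|e| < r by rewrite /r1 in er; lra.
    have := hc e er'.
    by rewrite /pser_to -(cvg_shiftS (fun N => \sum_(0 <= m < N) c m * e ^+ m)).
  rewrite c0; apply: (cvgr_to_le l); apply: nearW => N.
  rewrite big_nat_recl//= expr0 mulr1 addrC addKr.
  apply: le_trans (ler_norm_sum _ _ _) _.
  apply: (@le_trans _ _ (\sum_(0 <= m < N) C * t * (1 / 2) ^+ m)).
    apply: ler_sum => m _; rewrite normrM normrX.
    have -> : `|e| = t * r1 by rewrite divfK ?gt_eqF.
    have -> : `|c m.+1| * (t * r1) ^+ m.+1 = (`|c m.+1| * r1 ^+ m.+1) * (t * t ^+ m).
      by rewrite exprMn exprS; ring.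
    rewrite -(mulrA C); apply: ler_pM; rewrite ?hC//.
    - by rewrite mulr_ge0// exprn_ge0// ltW.
    - by rewrite mulr_ge0// exprn_ge0.
    - by apply: ler_wpM2l => //; apply: lerXn2r; rewrite ?nnegrE//; lra.
  rewrite -mulr_sumr; have := sum_half_le R N.
  have -> : 2 * C / r1 * `|e| = C * t * 2 by rewrite /t; ring.
  by apply: ler_wpM2l; rewrite mulr_ge0.
have l : (fun n => 2 * C / r1 * `|h n|) @ \oo --> (0 : R).
  rewrite -[X in _ --> X](mulr0 (2 * C / r1)); apply: cvgMl_tmp.
  by rewrite -(normr0 R); exact: cvg_norm.
apply/cvgrPdist_le => e e0; near=> n.
rewrite distrC; apply: le_trans (key _ _) _.
  near: n; move/cvgrPdist_le : h0 => /(_ (r1 / 2)); rewrite divr_gt0// => /(_ isT).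
  by apply: filterS => n; rewrite sub0r normrN.
near: n; move/cvgrPdist_le : l => /(_ e e0); apply: filterS => n.
by rewrite sub0r normrN; apply: le_trans (ler_norm _).
Unshelve. all: by end_near.
Qed.

Lemma cvg_bigsum (R : realType) (I : seq nat) (u : nat -> nat -> R) (l : nat -> R) :
  (forall k, u k @ \oo --> l k) ->
  (fun n => \sum_(k <- I) u k n) @ \oo --> \sum_(k <- I) l k.
Proof.
move=> h; elim: I => [|k I IH].
  rewrite big_nil; apply: (@cvg_ext _ (cst 0)); last exact: cvg_cst.
  by move=> n; rewrite big_nil.
rewrite big_cons; apply: (@cvg_ext _ (fun n => u k n + \sum_(k <- I) u k n)).
  by move=> n; rewrite big_cons.
by apply: cvgD.
Qed.

(** The bound is uniform in [x < 1], so [x = 1] follows by continuity from the left. *)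
Lemma zeta_approx (R : realType) (zeta : R[i] -> R[i]) (x y : R) (K : nat) :
  is_riemann_zeta zeta -> 1 / 2 <= x <= 1 -> 1 <= `|y| -> (2 < K)%N ->
  64 * `|y| <= K%:R ->
  normc (dsum K (x +i* y) - zeta (x +i* y)) <=
  272 / Num.sqrt K%:R + 2 * Num.sqrt K%:R / `|y|.
Proof.
move=> hz /andP[x0 x1] y1 K2 Ky.
move: x1; rewrite le_eqVlt => /predU1P[xE|x1]; last first.
  by apply: zeta_approx_lt; rewrite // x0.
have y0 : y != 0 by rewrite -normr_gt0; lra.
have [aR aI] : ranalytic (fun x => complex.Re (zeta (x +i* y))) x /\
    ranalytic (fun x => complex.Im (zeta (x +i* y))) x.
  apply: analytic_at_Re_Im; apply: hz.2; apply/eqP => -[_ /eqP].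
  by rewrite (negbTE y0).
pose h (n : nat) : R := - (n.+2%:R)^-1.
have h0 : h @ \oo --> (0 : R).
  rewrite -[X in _ --> X](oppr0 R); apply: cvgN.
  have := @cvg_harmonic R; rewrite -(cvg_shiftS (@harmonic R)).
  by apply: cvg_ext => n.
have cosc (phi : R -> R) k : (fun n => osc phi k (x + h n)) @ \oo --> osc phi k x.
  apply: cvgMr_tmp; apply: continuous_cvg; first exact: continuous_expR.
  apply: cvgN; apply: cvgMr_tmp; rewrite -[X in _ --> X](addr0 x).
  by apply: cvgD => //; exact: cvg_cst.
have cd : (fun n => dsum K ((x + h n) +i* y) : R[i]^o) @ \oo -->
    (dsum K (x +i* y) : R[i]^o).
  have E (x' : R) : dsum K (x' +i* y) =
      (\sum_(1 <= k < K) osc (fun a => cos (y * a)) k x') +i*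
      (\sum_(1 <= k < K) osc (fun a => - sin (y * a)) k x').
    have cE (z : R[i]) : z = complex.Re z +i* complex.Im z by case: z.
    rewrite [LHS]cE /dsum !raddf_sum; congr (_ +i* _).
      by apply: eq_bigr => k _; rewrite dirichlet_term_osc.
    by apply: eq_bigr => k _; rewrite dirichlet_term_osc.
  rewrite E; apply/cvg_ReIm; split.
    apply: (@cvg_ext _ (fun n => \sum_(1 <= k < K) osc (fun a => cos (y * a)) k (x + h n))).
      by move=> n; rewrite E.
    by apply: cvg_bigsum => k; exact: cosc.
  apply: (@cvg_ext _ (fun n => \sum_(1 <= k < K) osc (fun a => - sin (y * a)) k (x + h n))).
    by move=> n; rewrite E.
  by apply: cvg_bigsum => k; exact: cosc.
have cz : (fun n => zeta ((x + h n) +i* y) : R[i]^o) @ \oo -->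
    (zeta (x +i* y) : R[i]^o).
  apply/cvg_ReIm; split.
    exact: (ranalytic_cvg aR h0).
  exact: (ranalytic_cvg aI h0).
set B := 272 / _ + _.
have /cvg_normc l : (fun n => dsum K ((x + h n) +i* y) - zeta ((x + h n) +i* y) : R[i]^o)
    @ \oo --> (dsum K (x +i* y) - zeta (x +i* y) : R[i]^o).
  exact: (@cvgB _ R[i]^o _ _ _ _ _ _ _ cd cz).
have l' : (fun n => normc (dsum K ((x + h n) +i* y) - zeta ((x + h n) +i* y) -
   (dsum K (x +i* y) - zeta (x +i* y))) + B) @ \oo --> 0 + B.
  by apply: cvgD => //; exact: cvg_cst.
rewrite add0r in l'; apply: (cvgr_to_ge l'); apply: nearW => n.
have -> : dsum K (x +i* y) - zeta (x +i* y) =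
   (dsum K ((x + h n) +i* y) - zeta ((x + h n) +i* y)) -
   (dsum K ((x + h n) +i* y) - zeta ((x + h n) +i* y) -
   (dsum K (x +i* y) - zeta (x +i* y))) by ring.
apply: le_trans (normcB _ _) _; rewrite addrC; apply: lerD.
  by rewrite !opprB; rewrite le_eqVlt; apply/orP; left; apply/eqP; congr normc; ring.
apply: zeta_approx_lt => //.
have n2 : 0 < n.+2%:R^-1 :> R by rewrite invr_gt0.
have n3 : n.+2%:R^-1 <= 1 / 2 :> R by rewrite div1r lef_pV2 ?posrE// ler_nat.
by rewrite xE /h; move: n2 n3; move: (_^-1) => i n2 n3; lra.
Qed.

Lemma zeta_approx_ex (R : realType) (zeta : R[i] -> R[i]) :
  is_riemann_zeta zeta -> exists2 A : R, 1 <= A & forall x y K,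
  1 / 2 <= x <= 1 -> 1 <= `|y| -> (2 < K)%N -> 64 * `|y| <= K%:R ->
  normc (dsum K (x +i* y) - zeta (x +i* y)) <=
  A / Num.sqrt K%:R + 2 * Num.sqrt K%:R / `|y|.
Proof.
by move=> hz; exists 272 => [|x y K *]; [rewrite ler1n|exact: zeta_approx].
Qed.

(** * From vanishing defect to the mean square *)

Lemma sqr_sub_le (R : realType) (a b e : R) : 0 <= a -> 0 <= b -> `|a - b| <= e ->
  `|a ^+ 2 - b ^+ 2| <= 2 * b * e + e ^+ 2.
Proof.
move=> a0 b0 abe; have e0 : 0 <= e by exact: le_trans abe.
have -> : a ^+ 2 - b ^+ 2 = (a - b) * (2 * b + (a - b)) by ring.
rewrite normrM; apply: (@le_trans _ _ (e * (2 * b + e))); last first.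
  by rewrite le_eqVlt; apply/orP; left; apply/eqP; ring.
apply: ler_pM => //; apply: le_trans (ler_normD _ _) _.
by rewrite ger0_norm ?mulr_ge0// lerD2l.
Qed.

Lemma root_bracket (P N : nat) : (0 < P)%N -> (0 < N)%N ->
  exists j, (0 < j)%N /\ (j ^ P <= N < j.+1 ^ P)%N.
Proof.
move=> P0 N0.
have ex : exists j, (N < j.+1 ^ P)%N.
  exists N; rewrite -[X in (X < _)%N]expn1; apply: (@leq_ltn_trans (N ^ P)%N).
    by rewrite leq_pexp2l.
  by rewrite ltn_exp2r.
have /ex_minnP[j jN jmin] := ex.
exists j; case: j jN jmin => [|j] jN jmin.
  by move: jN; rewrite exp1n ltnS leqNgt N0.
split=> //; rewrite jN andbT leqNgt; apply/negP => /jmin.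
by rewrite ltnn.
Qed.

Lemma cvg_ratioX (R : realType) (P : nat) :
  (fun j => (j.+2%:R / j.+1%:R) ^+ P) @ \oo --> (1 : R).
Proof.
rewrite -[X in _ --> X](expr1n R P); apply: (@continuous_cvg _ _ _ _ _ (fun j : nat => j.+2%:R / j.+1%:R : R)
    (fun x : R => x ^+ P) 1).
  exact: exprn_continuous.
apply: (@cvg_ext _ (fun j => 1 + @harmonic R j)).
  move=> j /=; rewrite -[j.+2%:R]natr1 mulrDl divff ?mul1r//.
rewrite -[X in _ --> X](addr0 1); apply: cvgD; first exact: cvg_cst.
exact: cvg_harmonic.
Qed.

(* A nondecreasing sequence sampled along [j^P] has averages that vary by a
   factor tending to [1] between consecutive samples. *)
Lemma cvg_average_interpolate (R : realType) (S : nat -> R) (Z : R) (P : nat) :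
  (0 < P)%N -> (forall n, 0 <= S n) -> {homo S : m n / (m <= n)%N >-> m <= n} ->
  (fun j => S (j.+1 ^ P)%N / (j.+1 ^ P)%:R) @ \oo --> Z ->
  (fun N => S N / N%:R) @ \oo --> Z.
Proof.
move=> P0 S0 Snd SZ.
pose a j := S (j.+1 ^ P)%N / (j.+1 ^ P)%:R.
pose r j : R := (j.+2%:R / j.+1%:R) ^+ P.
have r0 j : 0 < r j by rewrite exprn_gt0 ?divr_gt0 ?ltr0n.
have up : (fun j => a j.+1 * r j) @ \oo --> Z.
  rewrite -[X in _ --> X]mulr1; apply: cvgM; last exact: cvg_ratioX.
  by rewrite (cvg_shiftS a).
have lo : (fun j => a j / r j) @ \oo --> Z.
  rewrite -[X in _ --> X]mulr1 -[X in _ * X](@invr1 R); apply: cvgM => //.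
  by apply: cvgV; [exact: oner_neq0|exact: cvg_ratioX].
apply/cvgrPdist_le => e e0.
move/cvgrPdist_le : up => /(_ e e0) [J1 _ h1].
move/cvgrPdist_le : lo => /(_ e e0) [J2 _ h2].
exists ((maxn J1 J2).+1 ^ P)%N => // N /= JN.
have N0 : (0 < N)%N by apply: leq_trans JN; rewrite expn_gt0.
have [[|j] [j0 /andP[jN Nj]]] := root_bracket P0 N0; first by [].
have Jj : (maxn J1 J2 <= j)%N.
  by have := leq_ltn_trans JN Nj; rewrite ltn_exp2r.
have /h1/= := leq_trans (leq_maxl J1 J2) Jj; have /h2/= := leq_trans (leq_maxr J1 J2) Jj.
have NR0 : 0 < N%:R :> R by rewrite ltr0n.
have aR0 : 0 < (j.+1 ^ P)%:R :> R by rewrite ltr0n expn_gt0.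
have bR0 : 0 < (j.+2 ^ P)%:R :> R by rewrite ltr0n expn_gt0.
have rE : r j = (j.+2 ^ P)%:R / (j.+1 ^ P)%:R.
  by rewrite /r expr_div_n !natrX.
have A : a j / r j <= S N / N%:R.
  have -> : a j / r j = S (j.+1 ^ P)%N / (j.+2 ^ P)%:R.
    by rewrite /a rE; field; rewrite !gt_eqF.
  apply: ler_pM; [exact: S0|by rewrite invr_ge0|exact: Snd|].
  by rewrite lef_pV2 ?posrE// ler_nat ltnW.
have B : S N / N%:R <= a j.+1 * r j.
  have -> : a j.+1 * r j = S (j.+2 ^ P)%N / (j.+1 ^ P)%:R.
    by rewrite /a rE; field; rewrite !gt_eqF.
  apply: ler_pM; [exact: S0|by rewrite invr_ge0|by apply: Snd; exact: ltnW|].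
  by rewrite lef_pV2 ?posrE// ler_nat.
rewrite !ler_norml => /andP[g1 g2] /andP[g3 g4]; apply/andP; split; lra.
Qed.

Lemma dir_sqE (R : realType) (sg y : R) (X K : nat) : (0 < X)%N -> (X <= K)%N ->
  dir_sq sg X K y = normc (dsum K (sg +i* y) - dsum X (sg +i* y)) ^+ 2.
Proof.
move=> X0 XK.
have -> : dsum K (sg +i* y) - dsum X (sg +i* y) =
    \sum_(X <= k < K) dirichlet_term k (sg +i* y).
  by rewrite /dsum (big_cat_nat X0 XK)/= addrAC subrr add0r.
have po k : (X <= k)%N -> expR (- (sg * ln k%:R)) = k%:R `^ (- sg) :> R.
  move=> Xk; rewrite /powR gt_eqF; last by rewrite ltr0n (leq_trans X0).
  by rewrite mulNr.
rewrite normc_sqr /dir_sq /trig_sq !raddf_sum; congr (_ ^+ 2 + _).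
  rewrite !big_seq; apply: eq_bigr => k; rewrite mem_index_iota => /andP[Xk _].
  by rewrite dirichlet_term_osc /osc/= po.
rewrite -[LHS]sqrrN -sumrN; congr (_ ^+ 2).
rewrite !big_seq; apply: eq_bigr => k; rewrite mem_index_iota => /andP[Xk _].
by rewrite dirichlet_term_osc /osc/= po// mulrN.
Qed.

Lemma dsum_sqrE (R : realType) (sg y : R) (X : nat) :
  normc (dsum X (sg +i* y)) ^+ 2 = \sum_(1 <= k < X) k%:R `^ (- (2 * sg)) +
    \sum_(1 <= k < X) \sum_(1 <= l < X | l != k)
      k%:R `^ (- sg) * l%:R `^ (- sg) * cos (y * (ln k%:R - ln l%:R)).
Proof.
have -> : normc (dsum X (sg +i* y)) ^+ 2 = dir_sq sg 1 X y.
  case: X => [|X].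
    by rewrite /dsum /dir_sq /trig_sq !big_geq// normc0 expr0n/= addr0.
  by rewrite dir_sqE// /dsum [X in _ - X]big_geq// subr0.
rewrite /dir_sq trig_sqE -big_split/= !big_seq; apply: eq_bigr => k.
move=> kX; have := kX; rewrite mem_index_iota => /andP[k1 _].
rewrite (bigD1_seq k) ?iota_uniq//= subrr cos0 mulr1; congr (_ + _).
  rewrite -powRD; last by rewrite pnatr_eq0 -lt0n k1 implybT.
  by congr (_ `^ _); ring.
by apply: eq_bigr => l _; rewrite mulrBr.
Qed.

Definition diag (R : realType) (sg : R) (X : nat) : R :=
  \sum_(1 <= k < X) k%:R `^ (- (2 * sg)).

Lemma diag_ge0 (R : realType) (sg : R) (X : nat) : 0 <= diag sg X.
Proof. by apply: sumr_ge0 => k _; exact: powR_ge0. Qed.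

Lemma trig_sq_cos_le (R : realType) (I : seq nat) (c th : nat -> R) :
  `|\sum_(k <- I) c k * cos (th k)| <= Num.sqrt (trig_sq I c th).
Proof. by rewrite -sqrtr_sqr ler_sqrt ?trig_sq_ge0// lerDl sqr_ge0. Qed.

(** After exchanging sums, each off-diagonal coefficient is at most 1 and each exponential average
    at most [sqrt S]; the [X^2] pairs account for the root of the weight [X^4]. *)
Lemma dsum_average (R : realType) (sg : R) (X N : nat) (y : nat -> R) :
  0 <= sg -> (X <= N)%N ->
  `|N%:R^-1 * (\sum_(X <= n < N) normc (dsum X (sg +i* y n)) ^+ 2) -
    (N - X)%:R / N%:R * diag sg X| <= Num.sqrt (correlation X N y).
Proof.
move=> sg0 XN; pose th (k l : nat) : R := ln k%:R - ln l%:R.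
pose T k l := trig_sq (index_iota X N) (fun=> N%:R^-1 : R) (fun n => y n * th k l).
pose W k l : R := \sum_(X <= n < N) N%:R^-1 * cos (y n * th k l).
pose S : R := \sum_(1 <= k < X) \sum_(1 <= l < X | l != k) T k l.
have T0 k l : 0 <= T k l by exact: trig_sq_ge0.
have WS k l : (k \in index_iota 1 X) -> (l \in index_iota 1 X) -> l != k ->
    `|W k l| <= Num.sqrt S.
  move=> kX lX lk; apply: le_trans (trig_sq_cos_le _ _ _) _.
  rewrite -/(T k l) ler_sqrt; last by apply: sumr_ge0 => *; exact: sumr_ge0.
  rewrite /S (bigD1_seq k) ?iota_uniq//= (big_rem l)//= lk.
  by rewrite -addrA lerDl addr_ge0// sumr_ge0// => *; rewrite ?sumr_ge0.
have -> : N%:R^-1 * (\sum_(X <= n < N) normc (dsum X (sg +i* y n)) ^+ 2) -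
    (N - X)%:R / N%:R * diag sg X =
  \sum_(1 <= k < X) \sum_(1 <= l < X | l != k)
    k%:R `^ (- sg) * l%:R `^ (- sg) * W k l.
  under eq_bigr do rewrite dsum_sqrE.
  rewrite big_split/= mulrDr sumr_const_nat -[_ *+ (N - X)]mulr_natl.
  rewrite mulrA [_^-1 * _]mulrC addrAC subrr add0r.
  rewrite exchange_big/= mulr_sumr; apply: eq_bigr => k _.
  rewrite exchange_big/= mulr_sumr; apply: eq_bigr => l _.
  rewrite /W !mulr_sumr; apply: eq_bigr => n _; rewrite /th; ring.
have -> : Num.sqrt (correlation X N y) = X%:R ^+ 2 * Num.sqrt S.
  rewrite /correlation -/S sqrtrM ?exprn_ge0//.
  have -> : X%:R ^+ 4 = (X%:R ^+ 2) ^+ 2 :> R by rewrite -exprM.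
  by rewrite sqrtr_sqr ger0_norm ?exprn_ge0.
have p1 k : `|k%:R `^ (- sg)| <= 1 :> R.
  rewrite ger0_norm ?powR_ge0//; case: k => [|k].
    by rewrite /powR eqxx; case: (_ == 0).
  rewrite -[leRHS](powRr0 (k.+1%:R : R)).
  by apply: ler_powR; rewrite ?ler1n// oppr_le0.
apply: le_trans (ler_norm_sum _ _ _) _.
apply: (@le_trans _ _ (\sum_(1 <= k < X) X%:R * Num.sqrt S)); last first.
  rewrite sumr_const_nat -[_ *+ (X - 1)]mulr_natl expr2 -mulrA.
  apply: ler_wpM2r; first by rewrite mulr_ge0 ?sqrtr_ge0.
  by rewrite ler_nat leq_subr.
rewrite !big_seq; apply: ler_sum => k kX; apply: le_trans (ler_norm_sum _ _ _) _.
apply: (@le_trans _ _ (\sum_(1 <= l < X) Num.sqrt S)); last first.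
  rewrite sumr_const_nat -[_ *+ (X - 1)]mulr_natl.
  by apply: ler_wpM2r; rewrite ?sqrtr_ge0// ler_nat leq_subr.
rewrite big_mkcond/= !big_seq; apply: ler_sum => l lX.
case: ifP => lk; last exact: sqrtr_ge0.
rewrite normrM normrM -[leRHS]mul1r; apply: ler_pM => //; last exact: WS.
by rewrite -[leRHS]mul1r; apply: ler_pM.
Qed.

(** [del] splits the cross term: [| |z|^2 - |D|^2 |] is at most
    [del |D|^2 + (1 + 1 / del) |z - D|^2], with [D] the polynomial of length [X]. The mean of
    [|D|^2] comes from [dsum_average], that of [|z - D|^2] from the tail and [e2]; the last term
    compensates for the samples below [X]. *)
Lemma mean_square_step (R : realType) (sg del e2 : R) (X N : nat) (y : nat -> R)
    (K : nat -> nat) (z : nat -> R[i]) :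
  0 <= sg -> (0 < X)%N -> (X <= N)%N -> 0 < del -> 0 <= e2 ->
  (forall n, (X <= n < N)%N -> (X <= K n)%N) ->
  (forall n, (X <= n < N)%N -> normc (dsum (K n) (sg +i* y n) - z n) ^+ 2 <= e2) ->
  `|N%:R^-1 * (\sum_(X <= n < N) normc (z n) ^+ 2) - diag sg X| <=
  del * (diag sg X + Num.sqrt (correlation X N y)) +
  (1 + del^-1) * (2 * (N%:R^-1 * \sum_(X <= n < N) dir_sq sg X (K n) (y n)) + 2 * e2)
  + Num.sqrt (correlation X N y) + X%:R / N%:R * diag sg X.
Proof.
move=> sg0 X0 XN del0 e20 XK hz.
have N0 : (0 < N)%N by exact: leq_trans XN.
have NR0 : 0 < N%:R :> R by rewrite ltr0n.
have Ni0 : 0 <= N%:R^-1 :> R by rewrite invr_ge0.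
set C := Num.sqrt _; set D := diag sg X.
pose s n := sg +i* y n.
pose A := N%:R^-1 * (\sum_(X <= n < N) normc (dsum X (s n)) ^+ 2).
have hA : `|A - (N - X)%:R / N%:R * D| <= C by exact: dsum_average.
have NX : (N - X)%:R / N%:R = 1 - X%:R / N%:R :> R.
  by rewrite natrB// mulrBl divff ?gt_eqF.
have D0 : 0 <= D by exact: diag_ge0.
have X01 : 0 <= X%:R / N%:R :> R by rewrite divr_ge0.
rewrite NX in hA.
set G := 2 * _ + 2 * e2.
pose V := N%:R^-1 * (\sum_(X <= n < N) normc (z n) ^+ 2).
pose Q := N%:R^-1 * (\sum_(X <= n < N) normc (z n - dsum X (s n)) ^+ 2).
have hQ : Q <= G.
  have -> : G = N%:R^-1 * (2 * \sum_(X <= n < N) dir_sq sg X (K n) (y n)) + 2 * e2.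
    by rewrite /G; ring.
  apply: (@le_trans _ _ (N%:R^-1 * \sum_(X <= n < N)
     (2 * dir_sq sg X (K n) (y n) + 2 * e2))).
    apply: ler_wpM2l => //; rewrite !big_seq; apply: ler_sum => n.
    rewrite mem_index_iota => nX; rewrite dir_sqE ?XK// -/(s n).
    have -> : z n - dsum X (s n) = (dsum (K n) (s n) - dsum X (s n)) -
       (dsum (K n) (s n) - z n) by ring.
    have := hz n nX; rewrite -/(s n).
    have := normcB (dsum (K n) (s n) - dsum X (s n)) (dsum (K n) (s n) - z n).
    have := normc_ge0 ((dsum (K n) (s n) - dsum X (s n)) - (dsum (K n) (s n) - z n)).
    set a := normc (_ - _ - _); set b := normc (_ - dsum X _); set c := normc (_ - z n).
    move=> a0 abc cc.
    have : a ^+ 2 <= (b + c) ^+ 2 by apply: lerXn2r; rewrite ?nnegrE// (le_trans a0).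
    have := sqr_ge0 (b - c); rewrite !expr2 in cc *; nra.
  rewrite big_split/= mulrDr -mulr_sumr lerD2l sumr_const_nat.
  rewrite -[_ *+ (N - X)]mulr_natl [leLHS]mulrA; apply: ler_piMl; first exact: mulr_ge0.
  by rewrite mulrC ler_pdivrMr// mul1r ler_nat leq_subr.
have hV : `|V - A| <= del * A + (1 + del^-1) * Q.
  rewrite /V /A /Q -mulrBr -sumrB normrM (ger0_norm Ni0).
  have -> : del * (N%:R^-1 * \sum_(X <= n < N) normc (dsum X (s n)) ^+ 2) +
     (1 + del^-1) * (N%:R^-1 * \sum_(X <= n < N) normc (z n - dsum X (s n)) ^+ 2) =
    N%:R^-1 * \sum_(X <= n < N) (del * normc (dsum X (s n)) ^+ 2 +
      (1 + del^-1) * normc (z n - dsum X (s n)) ^+ 2).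
    by rewrite big_split/= -!mulr_sumr; ring.
  apply: ler_wpM2l => //; apply: le_trans (ler_norm_sum _ _ _) _.
  apply: ler_sum => n _.
  set a := normc (z n); set b := normc (dsum X _); set e := normc (_ - _).
  have abe : `|a - b| <= e.
    rewrite ler_norml; apply/andP; split.
      rewrite lerNl opprB lerBlDr addrC; have := normcB (z n) (z n - dsum X (s n)).
      by rewrite subKr.
    rewrite lerBlDr; have := normcD (z n - dsum X (s n)) (dsum X (s n)).
    by rewrite subrK.
  apply: le_trans (sqr_sub_le (normc_ge0 _) (normc_ge0 _) abe) _.
  have : 2 * b * e <= del * b ^+ 2 + del^-1 * e ^+ 2.
    have -> : del * b ^+ 2 + del^-1 * e ^+ 2 = del^-1 * (del * b - e) ^+ 2 + 2 * b * e.
      by field; rewrite gt_eqF.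
    by rewrite lerDr mulr_ge0 ?sqr_ge0// invr_ge0 ltW.
  have -> : del * b ^+ 2 + (1 + del^-1) * e ^+ 2 =
    del * b ^+ 2 + del^-1 * e ^+ 2 + e ^+ 2 by ring.
  by rewrite lerD2r.
have di0 : 0 <= 1 + del^-1 by rewrite addr_ge0// invr_ge0 ltW.
have h1 := ler_wpM2l di0 hQ.
have A_le : A <= D + C.
  have := hA; rewrite ler_norml => /andP[_].
  have : 0 <= X%:R / N%:R * D by exact: mulr_ge0.
  by lra.
have h2 := ler_wpM2l (ltW del0) A_le.
have E : V - D = (V - A) + (A - (1 - X%:R / N%:R) * D) - X%:R / N%:R * D by ring.
rewrite -/V E; apply: le_trans (ler_normB _ _) _.
rewrite (ger0_norm (mulr_ge0 X01 D0)) lerD2r.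
apply: le_trans (ler_normD _ _) _; apply: lerD => //.
by apply: le_trans hV _; apply: lerD.
Qed.

Lemma normc_dsum_le (R : realType) (sg y : R) (K : nat) : 0 <= sg ->
  normc (dsum K (sg +i* y)) <= K%:R.
Proof.
move=> sg0; apply: (@le_trans _ _ (\sum_(1 <= k < K) (1 : R))); last first.
  by rewrite sumr_const_nat ler_nat leq_subr.
rewrite /dsum; elim: K => [|K IH]; first by rewrite !big_geq// normc0.
case: K IH => [|K] IH; first by rewrite !big_geq// normc0.
rewrite !(big_nat_recr K.+1)//=; apply: le_trans (normcD _ _) _; apply: lerD => //.
rewrite normc_dirichlet_term// -[leRHS](powRr0 (K.+1%:R : R)).
by apply: ler_powR; rewrite ?ler1n// oppr_le0.
Qed.

(** For [K = j * n^d] the second error [sqrt K / y] is of order [sqrt j / sqrt (n^d)], and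
    [64 * Cc <= j] provides the condition [64 |y| <= K]. *)
Lemma zeta_approx_sample (R : realType) (zeta : R[i] -> R[i]) (A sg y c Cc : R)
    (d j n : nat) :
  (forall x y K, 1 / 2 <= x <= 1 -> 1 <= `|y| -> (2 < K)%N -> 64 * `|y| <= K%:R ->
    normc (dsum K (x +i* y) - zeta (x +i* y)) <=
    A / Num.sqrt K%:R + 2 * Num.sqrt K%:R / `|y|) ->
  1 <= A -> 1 / 2 <= sg <= 1 -> 0 < c -> 1 <= y ->
  c * n%:R ^+ d <= y <= Cc * n%:R ^+ d -> 64 * Cc <= j%:R -> (2 < j)%N ->
  (0 < n)%N ->
  normc (dsum (j * n ^ d) (sg +i* y) - zeta (sg +i* y)) <=
  A / Num.sqrt j%:R + 2 / c * (Num.sqrt j%:R / Num.sqrt (n%:R ^+ d)).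
Proof.
move=> happ A1 sg1 c0 y1 /andP[cy yC] jC j2 n0.
have y0 : 0 < y by lra.
have nd1 : 1 <= n%:R ^+ d :> R by rewrite exprn_ege1// ler1n.
have nd0 : 0 < n%:R ^+ d :> R by lra.
have j0 : 0 < j%:R :> R by rewrite ltr0n (leq_trans _ j2).
have K2 : (2 < j * n ^ d)%N.
  by apply: leq_trans j2 _; rewrite leq_pmulr// expn_gt0 n0.
have KE : (j * n ^ d)%:R = j%:R * n%:R ^+ d :> R by rewrite natrM natrX.
have y1' : 1 <= `|y| by rewrite gtr0_norm.
have Ky : 64 * `|y| <= (j * n ^ d)%:R.
  rewrite gtr0_norm// KE; have := ler_wpM2r (ltW nd0) jC.
  by have := ler_wpM2l (ler0n R 64) yC; lra.
apply: le_trans (happ _ _ _ sg1 y1' K2 Ky) _.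
rewrite gtr0_norm// KE sqrtrM ?(ltW j0)//.
have sj0 : 0 < Num.sqrt j%:R :> R by rewrite sqrtr_gt0.
have sn1 : 1 <= Num.sqrt (n%:R ^+ d) :> R.
  by rewrite -[leLHS]sqrtr1 ler_sqrt// ltW.
have sn0 : 0 < Num.sqrt (n%:R ^+ d) :> R by lra.
apply: lerD.
  apply: ler_wpM2l; first lra.
  rewrite lef_pV2 ?posrE ?mulr_gt0//.
  by rewrite -[leLHS]mulr1; apply: ler_wpM2l => //; exact: ltW.
rewrite ler_pdivrMr//.
set a := Num.sqrt j%:R; set b := Num.sqrt _ in sn0 sn1 *.
have bb : n%:R ^+ d = b ^+ 2 by rewrite sqr_sqrtr// ltW.
rewrite bb in cy.
apply: (@le_trans _ _ (2 / c * (a / b) * (c * b ^+ 2))).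
  rewrite le_eqVlt; apply/orP; left; apply/eqP; field.
  by rewrite !gt_eqF.
by apply: ler_wpM2l => //; rewrite !mulr_ge0 ?invr_ge0// ?ltW.
Qed.

Lemma mean_square_limit (R : realType) (zeta : R[i] -> R[i]) (sg c Cc Z : R)
    (d p q n0 : nat) (y : nat -> R) :
  is_riemann_zeta zeta -> 1 / 2 < sg <= 1 -> (0 < d)%N -> (1 < q)%N ->
  (q * (2 * d + 1) + 3 <= p.*2)%N -> 0 < c -> (0 < n0)%N ->
  (forall n, (n0 <= n)%N -> 1 <= y n /\ c * n%:R ^+ d <= y n <= Cc * n%:R ^+ d) ->
  (fun j => defect sg d p.*2 q j.+2 y) @ \oo --> (0 : R) ->
  diag sg @ \oo --> Z ->
  (fun N => (\sum_(1 <= n < N) normc (zeta (sg +i* y n)) ^+ 2) / N%:R) @ \oo --> Z.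
Proof.
move=> hz /andP[sg0 sg1] d0 q1 pq c0 n00 hy hdef hdiag.
have sgb : 1 / 2 <= sg <= 1 by rewrite (ltW sg0).
have sgp : 0 <= sg by lra.
have [A A1 happ] := zeta_approx_ex hz.
pose V n := normc (zeta (sg +i* y n)) ^+ 2.
have V0 n : 0 <= V n by exact: sqr_ge0.
pose S N := \sum_(1 <= n < N) V n.
have P0 : (0 < p.*2)%N by apply: leq_trans pq; rewrite addn_gt0 orbT.
apply: (@cvg_average_interpolate R S Z p.*2) => //.
- by move=> N; exact: sumr_ge0.
- move=> m n mn; rewrite /S; have [n1|n1] := ltnP n 1.
    by rewrite !big_geq// ?(ltnW n1)// (leq_trans mn)// ltnW.
  have [m1|m1] := ltnP m 1; first by rewrite [leLHS]big_geq ?sumr_ge0// ltnW.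
  by rewrite [leRHS](big_cat_nat m1 mn)/= lerDl sumr_ge0.
rewrite -(cvg_shiftS (fun j => S (j.+1 ^ p.*2)%N / (j.+1 ^ p.*2)%:R)).
pose E := A + 2 / c.
have E0 : 0 < E by rewrite addr_gt0 ?divr_gt0//; lra.
pose de j := defect sg d p.*2 q j.+2 y.
have Z0 : 0 <= Z by apply: (cvgr_to_ge hdiag); apply: nearW => X; exact: diag_ge0.
have diagZ X : diag sg X <= Z.
  apply: (cvgr_to_ge hdiag); exists X => // X' /= XX'.
  rewrite /diag; have [X1|X1] := ltnP X 1.
    by rewrite [leLHS]big_geq ?sumr_ge0 ?(ltnW X1)// => *; exact: powR_ge0.
  rewrite [leRHS](big_cat_nat X1 XX')/= lerDl sumr_ge0// => *; exact: powR_ge0.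
(* Bounds the mean of [|zeta - D|^2]. It is positive even when [de j] vanishes, so
   [del = sqrt (g j)] is admissible and [(1 + 1 / del) * g j = g j + sqrt (g j)] still tends to
   0. *)
pose g j := 2 * de j + 2 * (E ^+ 2 / j.+2%:R).
pose F0 := \sum_(1 <= n < n0) V n.
have F00 : 0 <= F0 by exact: sumr_ge0.
pose B j := (F0 + (E + 1) ^+ 2 + Z) * harmonic j.+1 +
  (Num.sqrt (g j) * (Z + Num.sqrt (de j)) + g j + Num.sqrt (g j) + Num.sqrt (de j)).
have hB : \forall j \near \oo,
    `|S (j.+2 ^ p.*2)%N / (j.+2 ^ p.*2)%:R - diag sg (j.+2 ^ q)| <= B j.
  pose J0 := maxn (maxn 3 n0) (Num.truncn `|64 * Cc|).+1.
  exists J0 => // j /= Jj.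
  set k := j.+2; have Jk : (J0 <= k)%N by rewrite (leq_trans Jj)// /k ltnW.
  have k3 : (2 < k)%N by rewrite (leq_trans _ Jk)// /J0 !leq_max.
  have kn0 : (n0 <= k)%N by rewrite (leq_trans _ Jk)// /J0 !leq_max leqnn orbT.
  have kC : 64 * Cc <= k%:R.
    apply: le_trans (ler_norm _) _; apply: ltW; apply: lt_le_trans (truncnS_gt _) _.
    by rewrite ler_nat (leq_trans _ Jk)// /J0 leq_max leqnn orbT.
  have k0 : (0 < k)%N by [].
  have kR1 : 1 <= k%:R :> R by rewrite ler1n.
  have kR0 : 0 < k%:R :> R by rewrite ltr0n.
  set X := (k ^ q)%N; set N := (k ^ p.*2)%N.
  have kX : (k <= X)%N by rewrite -{1}(expn1 k) leq_pexp2l// ltnW.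
  have n0X : (n0 <= X)%N by exact: leq_trans kX.
  have X0 : (0 < X)%N by exact: leq_trans kX.
  have XR1 : 1 <= X%:R :> R by rewrite ler1n.
  have NX : (k ^ 3 * X ^ (2 * d + 1) <= N)%N.
    by rewrite /X /N -expnM -expnD leq_pexp2l// addnC.
  have deE : de j = N%:R^-1 * (\sum_(X <= n < N) dir_sq sg X (k * n ^ d) (y n)) +
      correlation X N y by [].
  have kX2 : (k ^ 2 <= X)%N by rewrite /X leq_pexp2l.
  clearbody X N.
  have XN : (X <= N)%N.
    apply: leq_trans NX; rewrite -{1}(expn1 X); apply: leq_trans (leq_pmull _ _).
      by rewrite leq_pexp2l// addn1.
    by rewrite expn_gt0.
  have kXN : (k * X <= N)%N.
    apply: leq_trans NX; rewrite leq_mul//.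
      by rewrite -{1}(expn1 k) leq_pexp2l.
    by rewrite -{1}(expn1 X) leq_pexp2l// addn1.
  have N0 : (0 < N)%N by exact: leq_trans XN.
  have NR0 : 0 < N%:R :> R by rewrite ltr0n.
  have n1X : (1 <= X)%N by [].
  have skk : Num.sqrt k%:R ^+ 2 = k%:R :> R by rewrite sqr_sqrtr// ltW.
  have sk1 : 1 <= Num.sqrt k%:R :> R by rewrite -[leLHS]sqrtr1 ler_sqrt// ltW.
  have sk0 : 0 < Num.sqrt k%:R :> R by lra.
  have ci0 : 0 < 2 / c by rewrite divr_gt0.
  have approx n : (n0 <= n)%N ->
      normc (dsum (k * n ^ d) (sg +i* y n) - zeta (sg +i* y n)) <=
      A / Num.sqrt k%:R + 2 / c * (Num.sqrt k%:R / Num.sqrt (n%:R ^+ d)).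
    move=> nn; have [y1 yy] := hy n nn.
    by apply: (zeta_approx_sample happ A1 sgb c0 y1 yy kC k3); exact: leq_trans nn.
  have nd n : (0 < n)%N -> (n <= n ^ d)%N.
    by move=> n_gt0; rewrite -{1}(expn1 n) leq_pexp2l.
  (* Here the trivial bound of the Dirichlet polynomial is enough: [X] samples of size at most [M^2]
     against [N >= k^3 * X^(2 d + 1)] leave a factor [1 / k]. *)
  have small : (\sum_(n0 <= n < X) V n) / N%:R <= (E + 1) ^+ 2 / k%:R.
    pose M := (E + 1) * (k%:R * X%:R ^+ d).
    have Xd1 : 1 <= X%:R ^+ d :> R by exact: exprn_ege1.
    have kXd : k%:R <= k%:R * X%:R ^+ d :> R.
      by rewrite -[leLHS]mulr1; apply: ler_wpM2l.
    have VM n : n \in index_iota n0 X -> V n <= M ^+ 2.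
      rewrite mem_index_iota => /andP[nn nX].
      have n_gt0 : (0 < n)%N by exact: leq_trans nn.
      apply: lerXn2r; rewrite ?nnegrE ?normc_ge0//.
        by rewrite /M mulr_ge0 ?mulr_ge0 ?exprn_ge0//; lra.
      have := approx n nn; rewrite normc_distC => ha.
      have hd := normc_dsum_le (y n) (k * n ^ d) sgp.
      have ht := normcD (zeta (sg +i* y n) - dsum (k * n ^ d) (sg +i* y n))
        (dsum (k * n ^ d) (sg +i* y n)); rewrite subrK in ht.
      have hk : (k * n ^ d)%:R <= k%:R * X%:R ^+ d :> R.
        rewrite natrM natrX; apply: ler_wpM2l => //; apply: lerXn2r; rewrite ?nnegrE//.
        by rewrite ler_nat ltnW.
      have hA : A / Num.sqrt k%:R <= A * (k%:R * X%:R ^+ d) :> R.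
        apply: ler_wpM2l; first lra.
        apply: (@le_trans _ _ 1); last exact: le_trans kXd.
        by rewrite invf_le1.
      have hq : Num.sqrt k%:R / Num.sqrt (n%:R ^+ d) <= k%:R * X%:R ^+ d :> R.
        have sn1 : 1 <= Num.sqrt (n%:R ^+ d) :> R.
          rewrite -[leLHS]sqrtr1 ler_sqrt ?exprn_gt0 ?ltr0n//.
          by rewrite exprn_ege1// ler1n.
        rewrite ler_pdivrMr; last lra.
        have : Num.sqrt k%:R <= k%:R :> R by rewrite -[leRHS]skk expr2; nra.
        have : k%:R * X%:R ^+ d <= k%:R * X%:R ^+ d * Num.sqrt (n%:R ^+ d) :> R.
          by rewrite -[leLHS]mulr1; apply: ler_wpM2l => //; lra.
        by move=> h1 h2; exact: le_trans h2 (le_trans kXd h1).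
      have := ler_wpM2l (ltW ci0) hq.
      rewrite /M /E; set T := k%:R * X%:R ^+ d in hk hA *.
      by move: ha ht hd; rewrite !mulrDl mul1r; lra.
    rewrite ler_pdivrMr//; apply: (@le_trans _ _ (\sum_(n0 <= n < X) M ^+ 2)).
      by rewrite !big_seq; apply: ler_sum => n; exact: VM.
    rewrite sumr_const_nat -[_ *+ (X - n0)]mulr_natl.
    apply: (@le_trans _ _ (X%:R * M ^+ 2)).
      by apply: ler_wpM2r; [exact: sqr_ge0|rewrite ler_nat leq_subr].
    have -> : X%:R * M ^+ 2 = (E + 1) ^+ 2 / k%:R * (k ^ 3 * X ^ (2 * d + 1))%:R.
      have X1 : X%:R ^+ (2 * d + 1) = X%:R * (X%:R ^+ d) ^+ 2 :> R.
        by rewrite addn1 exprS mulnC exprM.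
      rewrite natrM (natrX _ k) (natrX _ X) X1 /M.
      by field; rewrite gt_eqF.
    apply: ler_wpM2l; last by rewrite ler_nat.
    by rewrite divr_ge0 ?sqr_ge0.
  have main : `|N%:R^-1 * (\sum_(X <= n < N) V n) - diag sg X| <=
     Num.sqrt (g j) * (Z + Num.sqrt (de j)) + g j + Num.sqrt (g j) +
     Num.sqrt (de j) + Z / k%:R.
    pose D := N%:R^-1 * \sum_(X <= n < N) dir_sq sg X (k * n ^ d) (y n).
    have D0 : 0 <= D.
      by rewrite mulr_ge0 ?invr_ge0 ?sumr_ge0// => *; exact: trig_sq_ge0.
    have C0 : 0 <= correlation X N y.
      rewrite /correlation mulr_ge0 ?exprn_ge0 ?sumr_ge0// => ? _.
      by rewrite sumr_ge0// => *; exact: trig_sq_ge0.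
    rewrite -/D in deE.
    have de0 : 0 <= de j by rewrite deE addr_ge0.
    have sC : Num.sqrt (correlation X N y) <= Num.sqrt (de j).
      by rewrite ler_sqrt// deE lerDr.
    have e20 : 0 < E ^+ 2 / k%:R by rewrite divr_gt0 ?exprn_gt0.
    have gp : 0 < g j by rewrite /g -/k; lra.
    have del0 : 0 < Num.sqrt (g j) by rewrite sqrtr_gt0.
    have hK n : (X <= n < N)%N -> (X <= k * n ^ d)%N.
      move=> /andP[Xn _]; apply: leq_trans (Xn) _.
      by apply: leq_trans (nd n _) (leq_pmull _ k0); exact: leq_trans Xn.
    have hE n : (X <= n < N)%N ->
        normc (dsum (k * n ^ d) (sg +i* y n) - zeta (sg +i* y n)) ^+ 2 <= E ^+ 2 / k%:R.
      move=> /andP[Xn _]; have n_gt0 : (0 < n)%N by exact: leq_trans Xn.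
      have ha := approx n (leq_trans n0X Xn).
      have -> : E ^+ 2 / k%:R = (E / Num.sqrt k%:R) ^+ 2 by rewrite expr_div_n skk.
      apply: lerXn2r; rewrite ?nnegrE ?normc_ge0//; first by rewrite divr_ge0// ltW.
      apply: le_trans ha _; rewrite /E [leRHS]mulrDl lerD2l; apply: ler_wpM2l; first exact: ltW.
      (* Uses [n^d >= n >= X >= k^2], the last from [q >= 2]; it brings the second error below
         [(2 / c) / sqrt k]. *)
      have kn : k%:R <= Num.sqrt (n%:R ^+ d) :> R.
        rewrite -[leLHS](ger0_norm (ltW kR0)) -sqrtr_sqr ler_sqrt ?exprn_gt0 ?ltr0n//.
        rewrite -!natrX ler_nat; apply: leq_trans (nd n n_gt0).
        by apply: leq_trans Xn.
      rewrite ler_pdivrMr ?(lt_le_trans kR0)// mulrC ler_pdivlMr// -expr2 skk.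
      exact: kn.
    have := mean_square_step (z := fun n => zeta (sg +i* y n)) sgp X0 XN del0 (ltW e20) hK hE.
    move=> /le_trans; apply; rewrite -/D.
    have h1 : Num.sqrt (g j) * (diag sg X + Num.sqrt (correlation X N y)) <=
        Num.sqrt (g j) * (Z + Num.sqrt (de j)).
      by apply: ler_wpM2l; [exact: ltW|exact: lerD].
    have h2 : (1 + (Num.sqrt (g j))^-1) * (2 * D + 2 * (E ^+ 2 / k%:R)) <=
        g j + Num.sqrt (g j).
      have hg : 2 * D + 2 * (E ^+ 2 / k%:R) <= g j.
        by rewrite /g -/k lerD2r ler_pM2l// deE lerDl.
      apply: le_trans (ler_wpM2l _ hg) _.
        by rewrite addr_ge0// invr_ge0 ltW.
      rewrite mulrDl mul1r lerD2l -{2}(sqr_sqrtr (ltW gp)) expr2 mulrA mulVf ?mul1r//.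
      by rewrite gt_eqF.
    have h3 : X%:R / N%:R * diag sg X <= Z / k%:R.
      rewrite [leRHS]mulrC; apply: ler_pM; rewrite ?divr_ge0 ?diag_ge0//.
      rewrite ler_pdivrMr// mulrC ler_pdivlMr// -natrM ler_nat mulnC.
      exact: kXN.
    by apply: lerD => //; apply: lerD => //; rewrite -[leRHS]addrA; exact: lerD.
  have split3 : S N / N%:R = F0 / N%:R + (\sum_(n0 <= n < X) V n) / N%:R +
      N%:R^-1 * (\sum_(X <= n < N) V n).
    rewrite /S (big_cat_nat n1X XN)/= (big_cat_nat n00 n0X)/= -/F0; ring.
  have F0N : F0 / N%:R <= F0 / k%:R.
    apply: ler_wpM2l => //; rewrite lef_pV2 ?posrE// ler_nat (leq_trans kX)//.
  have s0 : 0 <= (\sum_(n0 <= n < X) V n) / N%:R.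
    by rewrite divr_ge0 ?sumr_ge0.
  have f0 : 0 <= F0 / N%:R by rewrite divr_ge0.
  rewrite split3.
  have -> : F0 / N%:R + (\sum_(n0 <= n < X) V n) / N%:R +
      N%:R^-1 * (\sum_(X <= n < N) V n) - diag sg X =
    (F0 / N%:R + (\sum_(n0 <= n < X) V n) / N%:R) +
    (N%:R^-1 * (\sum_(X <= n < N) V n) - diag sg X) by ring.
  apply: le_trans (ler_normD _ _) _.
  rewrite ger0_norm ?addr_ge0// /B.
  have -> : (F0 + (E + 1) ^+ 2 + Z) * harmonic j.+1 =
    F0 / k%:R + (E + 1) ^+ 2 / k%:R + Z / k%:R by rewrite /=; ring.
  apply: le_trans (lerD (lerD F0N small) main) _.
  by rewrite le_eqVlt; apply/orP; left; apply/eqP; ring.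
have harm : (fun j => @harmonic R j.+1) @ \oo --> (0 : R).
  by have := @cvg_harmonic R; rewrite -(cvg_shiftS (@harmonic R)).
have g0 : g @ \oo --> (0 : R).
  rewrite -[X in _ --> X](addr0 0); apply: cvgD.
    by rewrite -[X in _ --> X](mulr0 2); apply: cvgMl_tmp.
  rewrite -[X in _ --> X](mulr0 2); apply: cvgMl_tmp.
  by rewrite -[X in _ --> X](mulr0 (E ^+ 2)); apply: cvgMl_tmp.
have sq0 (u : nat -> R) : u @ \oo --> (0 : R) -> (fun j => Num.sqrt (u j)) @ \oo --> (0 : R).
  move=> u0; rewrite -[X in _ --> X](sqrtr0 R).
  by apply: (continuous_cvg _ _ u0); exact: sqrt_continuous.
have B0 : B @ \oo --> (0 : R).
  have -> : (0 : R) = (F0 + (E + 1) ^+ 2 + Z) * 0 + (0 * (Z + 0) + 0 + 0 + 0).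
    by rewrite mulr0 mul0r !addr0.
  apply: cvgD; first exact: cvgMl_tmp.
  apply: cvgD; last exact: sq0.
  apply: cvgD; last exact: sq0.
  apply: cvgD => //; apply: cvgM; first exact: sq0.
  by apply: cvgD; [exact: cvg_cst|exact: sq0].
have dX : (fun j => diag sg (j.+2 ^ q)) @ \oo --> Z.
  apply: (cvg_comp (fun j => (j.+2 ^ q)%N) (diag sg) _ hdiag) => U [N _ NU].
  exists N => // j /= Nj; apply: NU => /=.
  apply: leq_trans Nj _; apply: leq_trans (leqnSn _) _; apply: leq_trans (leqnSn _) _.
  by rewrite -{1}(expn1 j.+2) leq_pexp2l// ltnW.
apply: (@squeeze_cvgr _ _ _ _ (fun j => diag sg (j.+2 ^ q) - B j)
   (fun j => diag sg (j.+2 ^ q) + B j)).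
- apply: filterS hB => j; rewrite ler_norml => /andP[h1 h2].
  apply/andP; split.
    by rewrite addrC -lerBrDr.
  by rewrite addrC -lerBlDr.
- by rewrite -[X in _ --> X](subr0 Z); apply: cvgB.
- by rewrite -[X in _ --> X](addr0 Z); apply: cvgD.
Qed.

(** * Lebesgue measure on tuples *)

(** Convergence is expressed by countable operations; the exceptional set must be measurable before
    its sections can be integrated. *)
Lemma measurable_cvg0 (R : realType) d (T : measurableType d) (h : nat -> T -> R) :
  (forall j, measurable_fun setT (h j)) ->
  measurable [set a : T | h ^~ a @ \oo --> (0 : R)].
Proof.
move=> mh.
have -> : [set a : T | h ^~ a @ \oo --> (0 : R)] =
    \bigcap_k \bigcup_J \bigcap_j [set a | (J <= j)%N -> `|h j a| <= k.+1%:R^-1].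
  apply/seteqP; split => a /=.
    move=> /cvgrPdist_le ha k _; have [J _ hJ] := ha (k.+1%:R^-1) ltac:(by rewrite invr_gt0).
    by exists J => // j _ /= Jj; have := hJ j Jj; rewrite /= sub0r normrN.
  move=> ha; apply/cvgrPdist_le => e e0.
  have [J _ hJ] := ha (Num.truncn e^-1) I.
  exists J => // j /= Jj; rewrite sub0r normrN; apply: le_trans (hJ j I Jj) _.
  rewrite -[leRHS]invrK lef_pV2 ?posrE ?invr_gt0//.
  by apply: ltW; exact: truncnS_gt.
apply: bigcapT_measurable => k; apply: bigcup_measurable => J _.
apply: bigcapT_measurable => j.
have [Jj|Jj] := leqP J j; last first.
  rewrite (_ : [set _ | _] = setT); first exact: measurableT.
  by apply/seteqP; split => // a _ /=; rewrite leqNgt Jj.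
rewrite (_ : [set _ | _] = setT `&` (h j) @^-1` `[- k.+1%:R^-1, k.+1%:R^-1]).
  exact: mh.
apply/seteqP; split => a /=.
  by move=> /(_ isT); rewrite in_itv/= -ler_norml.
by move=> [_]; rewrite in_itv/= -ler_norml.
Qed.

Lemma measurable_trig_sq (R : realType) d (T : measurableType d) (I : seq nat)
    (c : nat -> R) (th : nat -> T -> R) :
  (forall k, measurable_fun setT (th k)) ->
  measurable_fun setT (fun a => trig_sq I c (th ^~ a)).
Proof.
move=> mth; apply: measurable_funD; apply: measurable_funX; apply: measurable_sum => k;
  apply: measurable_funM => //.
  apply: (@measurableT_comp _ _ _ _ _ _ (@cos R) _ (th k)) => //.
  by apply: continuous_measurable_fun; exact: continuous_cos.
apply: (@measurableT_comp _ _ _ _ _ _ (@sin R) _ (th k)) => //.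
by apply: continuous_measurable_fun; exact: continuous_sin.
Qed.

Lemma measurable_defect (R : realType) d0 (T : measurableType d0) (sg : R)
    (d p q j : nat) (y : nat -> T -> R) :
  (forall n, measurable_fun setT (y n)) ->
  measurable_fun setT (fun a => defect sg d p q j (y ^~ a)).
Proof.
move=> my; apply: measurable_funD.
  apply: measurable_funM => //; apply: measurable_sum => n.
  apply: (@measurable_trig_sq R _ _ _ _ (fun k a => y n a * ln k%:R)) => k.
  exact: measurable_funM.
apply: measurable_funM => //; apply: measurable_sum => k.
rewrite (_ : (fun _ => _) = fun a => \sum_(l <- [seq l <- index_iota 1 (j ^ q) | l != k])
    trig_sq (index_iota (j ^ q) (j ^ p)) (fun=> (j ^ p)%:R^-1)
      (fun n => y n a * (ln k%:R - ln l%:R))); last first.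
  by apply/funext => a; rewrite big_filter.
apply: measurable_sum => l.
apply: (@measurable_trig_sq R _ _ _ _ (fun n a => y n a * (ln k%:R - ln l%:R))) => n.
exact: measurable_funM.
Qed.

Lemma measurable_cons_section (R : realType) (n : nat) (x : measurableTypeR R)
    (A : set (n.+1.-tuple (measurableTypeR R))) :
  measurable A -> measurable [set w : n.-tuple (measurableTypeR R) | A (cons_tuple x w)].
Proof.
move=> mA.
have mf : measurable_fun setT (fun w : n.-tuple (measurableTypeR R) => cons_tuple x w).
  by apply: measurable_cons.
by have := mf measurableT A mA; rewrite setTI.
Qed.

Lemma xsection_cons (R : realType) (n : nat) (x : measurableTypeR R)
    (A : set (n.+1.-tuple (measurableTypeR R))) :
  xsection ((fun p : measurableTypeR R * n.-tuple (measurableTypeR R) =>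
     cons_tuple p.1 p.2) @^-1` A) x = [set w | A (cons_tuple x w)].
Proof. by apply/seteqP; split => w; rewrite /xsection/= inE. Qed.

Lemma cons_rcons_tuple (T : Type) (n : nat) (x z : T) (v : n.-tuple T) :
  cons_tuple x [tuple of rcons v z] = [tuple of rcons [tuple of x :: v] z].
Proof. exact: val_inj. Qed.

(** [lebesgue_tuple] peels off the first coordinate, while the leading coefficient is the last.
    Inducting with the first coordinate fixed reaches the last one as innermost variable, and every
    outer integral is then of 0. *)
Lemma lebesgue_tuple_last0 (R : realType) (n : nat)
    (A : set (n.+1.-tuple (measurableTypeR R))) :
  measurable A ->
  (forall v : n.-tuple (measurableTypeR R),
    lebesgue_measure [set x : measurableTypeR R | A [tuple of rcons v x]] = 0%E) ->
  lebesgue_tuple A = 0%E.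
Proof.
elim: n A => [|n IH] A mA hA.
  rewrite /= /pushforward /product_measure1.
  have := hA [tuple]; set B := [set x | _] => hB.
  have mB : measurable B.
    have mf : measurable_fun setT (fun x : measurableTypeR R => cons_tuple x [tuple]).
      by apply: measurable_cons => //; exact: measurable_id.
    have := mf measurableT A mA; rewrite setTI; congr (measurable _).
    by apply/seteqP; split => x /=; rewrite (_ : cons_tuple x [tuple] = [tuple of rcons [tuple] x])//; exact: val_inj.
  transitivity (\int[lebesgue_measure]_x (\1_B x : R)%:E)%E; last first.
    by rewrite integral_indic// setIT.
  apply: eq_integral => x _ /=; rewrite xsection_cons diracE /indic/=.
  have E : cons_tuple x [tuple] = [tuple of rcons [tuple] x] by exact: val_inj.
  by congr (_%:R%:E); congr nat_of_bool; apply/idP/idP; rewrite !inE/= E.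
change (lebesgue_tuple A) with
  ((\int[lebesgue_measure]_x (@lebesgue_tuple R n.+1 \o
    xsection ((fun p : measurableTypeR R * (n.+1).-tuple (measurableTypeR R) =>
          cons_tuple p.1 p.2) @^-1` A)) x)%E).
apply: (@integral0_eq _ _ _ lebesgue_measure setT) => x _ /=.
rewrite xsection_cons.
apply: IH; first exact: measurable_cons_section.
move=> v; rewrite -(hA [tuple of x :: v]); congr (lebesgue_measure _).
by apply/seteqP; split => z; rewrite /= cons_rcons_tuple.
Qed.

(** * Assembly: the diagonal, the averages in complex form, the parameters *)

Lemma zeta_diag (R : realType) (zeta : R[i] -> R[i]) (sg : R) :
  is_riemann_zeta zeta -> 1 / 2 < sg -> exists2 Z : R,
    zeta (2 * sg)%:C = Z%:C & diag sg @ \oo --> Z.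
Proof.
move=> [zd _] sg0; have s1 : 1 < complex.Re ((2 * sg)%:C : R[i]) by rewrite /=; lra.
have /cvg_ReIm[hR hI] := zd _ s1.
have tE k : dirichlet_term k.+1 ((2 * sg)%:C : R[i]) = (k.+1%:R `^ (- (2 * sg)))%:C.
  rewrite -[(2 * sg)%:C]/((2 * sg) +i* 0) dirichlet_term_osc /osc mul0r cos0 sin0 oppr0.
  by rewrite mulr1 mulr0 /powR pnatr_eq0/= mulNr.
exists (complex.Re (zeta (2 * sg)%:C)).
  apply/eqP; rewrite eq_complex/= eqxx/=; apply/eqP.
  apply: (cvg_unique _ hI) => //; apply: (@cvg_ext _ (cst (0 : R))); last exact: cvg_cst.
  by move=> N /=; rewrite raddf_sum big1// => k _; rewrite tE.
rewrite -(cvg_shiftS (diag sg)); apply: cvg_ext hR => N.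
by rewrite [RHS]/= /diag big_add1 raddf_sum; apply: eq_bigr => k _; rewrite tE.
Qed.

Lemma cvg_real_complex (R : realType) (u : nat -> R) (l : R) :
  u @ \oo --> l -> (fun n => (u n)%:C : R[i]^o) @ \oo --> (l%:C : R[i]^o).
Proof. by move=> h; apply/cvg_ReIm; split => //=; exact: cvg_cst. Qed.

Lemma cvg_mean_complex (R : realType) (zeta : R[i] -> R[i]) (sg t Z : R) (x : nat -> R) :
  (fun N => (\sum_(1 <= n < N) normc (zeta (sg +i* (t + x n))) ^+ 2) / N%:R)
    @ \oo --> Z ->
  ((fun N : nat => N%:R^-1 * \sum_(1 <= n < N.+1)
      `|zeta ((sg +i* t) + 'i%C * (x n)%:C)| ^+ 2) : nat -> R[i]^o) @ \oo -->
    (Z%:C : R[i]^o).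
Proof.
pose S N := \sum_(1 <= n < N) normc (zeta (sg +i* (t + x n))) ^+ 2.
move=> h.
have h' : (fun N => S N.+1 / N%:R) @ \oo --> Z.
  (* [S N] stops at [N - 1], so the average up to [N] is corrected by the ratio [(N + 2) / (N + 1)];
     the shift discards [N = 0]. *)
  rewrite -(cvg_shiftS (fun N => S N.+1 / N%:R)).
  have r : (fun N => (N.+2%:R / N.+1%:R) ^+ 1) @ \oo --> (1 : R) by exact: cvg_ratioX.
  have -> : Z = Z * 1 by rewrite mulr1.
  apply: (@cvg_ext _ (fun N => S N.+2 / N.+2%:R * (N.+2%:R / N.+1%:R) ^+ 1)).
    by move=> N; rewrite expr1 mulrA divfK// pnatr_eq0.
  apply: cvgM r.
  by rewrite -(cvg_shiftn 2) in h; move: h; under eq_fun do rewrite addn2.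
apply: cvg_ext (cvg_real_complex h') => N.
rewrite rmorphM/= fmorphV rmorph_nat mulrC; congr (_ * _).
rewrite /S rmorph_sum; apply: eq_bigr => n _.
have -> : (sg +i* t) + 'i%C * (x n)%:C = sg +i* (t + x n) :> R[i].
  by apply/eqP; rewrite eq_complex/= !mul0r mulr0 mul1r subr0 !add0r addr0 !eqxx.
by rewrite rmorphXn.
Qed.

(** From [n0] on, half of the leading term exceeds [|T| + 1], which absorbs the lower bound of [b]
    and leaves height at least 1. *)
Lemma linear_growth (R : realType) (a T T' : R) (d : nat) (b : nat -> R) :
  0 < a -> (0 < d)%N -> (forall n, (0 < n)%N -> - T <= b n <= T' * n%:R ^+ d) ->
  exists n0, (0 < n0)%N /\ forall n, (n0 <= n)%N -> 1 <= a * n%:R ^+ d + b n /\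
    a / 2 * n%:R ^+ d <= a * n%:R ^+ d + b n <= (a + T') * n%:R ^+ d.
Proof.
move=> a0 d0 hb; exists (Num.truncn (2 * (`|T| + 1) / a)).+1; split => // n hn.
have n0 : (0 < n)%N by exact: leq_trans hn.
have /andP[b1 b2] := hb n n0.
have nd : n%:R <= n%:R ^+ d :> R.
  by rewrite -{1}(expr1 n%:R) -!natrX ler_nat leq_pexp2l.
have h : 2 * (`|T| + 1) / a <= n%:R ^+ d.
  apply: le_trans nd; apply: ltW; apply: lt_le_trans (truncnS_gt _) _.
  by rewrite ler_nat.
rewrite ler_pdivrMr// in h; have := ler_norm T; have := normr_ge0 T.
by split; [lra|apply/andP; split; lra].
Qed.

Lemma sample_mean_square (R : realType) (zeta : R[i] -> R[i]) (sg a T T' : R)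
    (d p q : nat) (b : nat -> R) :
  is_riemann_zeta zeta -> 1 / 2 < sg <= 1 -> (0 < d)%N -> (1 < q)%N ->
  (q * (2 * d + 1) + 3 <= p.*2)%N -> 0 < a ->
  (forall n, (0 < n)%N -> - T <= b n <= T' * n%:R ^+ d) ->
  (fun j => defect sg d p.*2 q j.+2 (fun n => a * n%:R ^+ d + b n))
    @ \oo --> (0 : R) ->
  exists2 Z : R, zeta (2 * sg)%:C = Z%:C &
  (fun N => (\sum_(1 <= n < N) normc (zeta (sg +i* (a * n%:R ^+ d + b n))) ^+ 2) / N%:R)
    @ \oo --> Z.
Proof.
move=> hz sgb d0 q1 pq a0 hb hdef.
have [n0 [n00 hn]] := linear_growth a0 d0 hb.
have /andP[sg0 _] := sgb; have [Z ZE hZ] := zeta_diag hz sg0.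
exists Z => //.
have a20 : 0 < a / 2 by rewrite divr_gt0.
exact: (mean_square_limit hz sgb d0 q1 pq a20 n00 hn hdef hZ).
Qed.

Lemma exists_parameters (R : realType) (sg : R) (d : nat) : 1 / 2 < sg ->
  exists eta : R, exists p q : nat, [/\ 0 < eta <= 1 / 4, 1 / 2 + eta <= sg,
    4 <= q%:R * eta, (7 * q + 2 <= p)%N &
    (1 < q)%N && (q * (2 * d + 1) + 3 <= p.*2)%N].
Proof.
move=> sg0; pose eta := Num.min (sg - 1 / 2) (1 / 4).
have e0 : 0 < eta by rewrite lt_min; apply/andP; split; lra.
pose q := (Num.truncn (4 / eta)).+2.
(* The two lower bounds on [p] are simply added. *)
exists eta, (7 * q + 2 + (q * (2 * d + 1) + 3))%N, q; split => //.
- by rewrite e0/= ge_min lexx orbT.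
- have : eta <= sg - 1 / 2 by rewrite ge_min lexx.
  lra.
- rewrite -ler_pdivrMr//; apply: ltW; apply: lt_le_trans (truncnS_gt _) _.
  by rewrite ler_nat.
- by rewrite leq_addr.
- by rewrite -addnn -addnA addnCA leq_addr.
Qed.

Lemma tnth_rcons_max (T : Type) (n : nat) (v : n.-tuple T) (x : T) :
  tnth [tuple of rcons v x] ord_max = x.
Proof. by rewrite (tnth_nth x)/= nth_rcons size_tuple ltnn eqxx. Qed.

Lemma tnth_rcons_widen (T : Type) (n : nat) (v : n.-tuple T) (x : T) (j : 'I_n) :
  tnth [tuple of rcons v x] (widen_ord (leqnSn n) j) = tnth v j.
Proof. by rewrite !(tnth_nth x)/= nth_rcons size_tuple ltn_ord. Qed.

Theorem theorem5 (R : realType) (zeta : R[i] -> R[i])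
    (zetaP : is_riemann_zeta zeta) (LH : lindelof_hypothesis zeta)
    (d : nat) (hd : (2 <= d)%N) (sigma : R) (hsigma : 2^-1 < sigma <= 1)
    (t : R) :
  let s : R[i] := sigma +i* t in
  {ae lebesgue_tuple (R := R) (n := d),
    forall a : d.-tuple (measurableTypeR R),
      (forall j : 'I_d, 0 <= (tnth a j : R)) ->
      ((fun N : nat => N%:R^-1 * \sum_(1 <= n < N.+1)
          `|zeta (s + 'i%C * (\sum_(j < d) (tnth a j : R) * n%:R ^+ j.+1)%:C)|
            ^+ 2) : nat -> R[i]^o) @ \oo
        --> (zeta (2 * sigma)%:C : R[i]^o)}
  /\
  {ae lebesgue_measure,
    forall a : measurableTypeR R,
      0 <= (a : R) ->
      ((fun N : nat => N%:R^-1 * \sum_(1 <= n < N.+1)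
          `|zeta (s + 'i%C * ((a : R) * n%:R ^+ d)%:C)| ^+ 2) : nat -> R[i]^o)
        @ \oo --> (zeta (2 * sigma)%:C : R[i]^o)}.
Proof.
have {}hsigma : 1 / 2 < sigma <= 1 by rewrite div1r.
have /andP[sg0 _] := hsigma.
have d0 : (0 < d)%N by exact: ltnW.
have [eta [p [q [e01 esg qe pq /andP[q1 pq2]]]]] := exists_parameters d sg0.
have n_ge1 n m : (0 < n)%N -> 1 <= n%:R ^+ m :> R.
  by move=> n0; rewrite exprn_ege1// ler1n.
have aeH b := ae_defect_cvg0 b d0 e01 esg qe pq.
move=> s; split; last first.
  (* At [a = 0] the heights do not grow, so this null set is removed. *)
  have ae0 : {ae lebesgue_measure, forall a : measurableTypeR R, (a : R) <> 0}.
    exists [set 0]; split => //; first exact: lebesgue_measure_set1.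
    by move=> a /= /contrapT.
  have := aeH (fun=> t); move: ae0; apply: filterS2 => a an0 ha a_ge0.
  have a0 : 0 < (a : R) by rewrite lt0r a_ge0 andbT; apply/eqP.
  have hb n : (0 < n)%N -> - `|t| <= t <= `|t| * n%:R ^+ d.
    move=> n0; rewrite lerNl (le_trans (ler_norm _)) ?normrN//=.
    by rewrite (le_trans (ler_norm _))// ler_peMr// n_ge1.
  have [Z -> hZ] := sample_mean_square zetaP hsigma d0 q1 pq2 a0 hb ha.
  apply: (cvg_mean_complex (x := fun n => (a : R) * n%:R ^+ d)).
  by under eq_fun do under eq_bigr do rewrite [t + _]addrC.
case: d hd d0 pq2 aeH => // e hd d0 pq2 aeH.
pose y (n : nat) (a : e.+1.-tuple (measurableTypeR R)) : R :=
  t + \sum_(j < e.+1) (tnth a j : R) * n%:R ^+ j.+1.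
pose h j (a : e.+1.-tuple (measurableTypeR R)) := defect sigma e.+1 p.*2 q j.+2 (y ^~ a).
(* Exceptional set: the defect fails to vanish in the limit, or the leading coefficient is zero.
   Signs of the coefficients are left out, since [ae_defect_cvg0] holds on the whole line. *)
pose A := (~` [set a | h ^~ a @ \oo --> (0 : R)]) `|` [set a | (tnth a ord_max : R) = 0].
have my n : measurable_fun setT (y n).
  apply: measurable_funD => //; apply: measurable_sum => j.
  by apply: measurable_funM => //; exact: measurable_tnth.
have mA : measurable A.
  apply: measurableU.
    apply: measurableC; apply: measurable_cvg0 => j.
    exact: (measurable_defect _ _ _ _ _ my).
  have := measurable_tnth (T := measurableTypeR R) (ord_max : 'I_e.+1) measurableT
    (measurable_set1 (0 : R)).
  by rewrite setTI.
exists A; split => //.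
  apply: lebesgue_tuple_last0 => // v.
  (* With the lower coefficients [v] fixed, the section of [A] is a null set of the leading
     coefficient by [aeH b]. *)
  pose b (n : nat) : R := t + \sum_(j < e) (tnth v j : R) * n%:R ^+ j.+1.
  pose f j (x : measurableTypeR R) :=
    defect sigma e.+1 p.*2 q j.+2 (fun n => (x : R) * n%:R ^+ e.+1 + b n).
  have yE x : y ^~ [tuple of rcons v x] = (fun n => (x : R) * n%:R ^+ e.+1 + b n).
    apply/funext => n; rewrite /y /b big_ord_recr/= tnth_rcons_max addrA addrC.
    by under eq_bigr do rewrite tnth_rcons_widen.
  have -> : [set x | A [tuple of rcons v x]] =
      (~` [set x | f ^~ x @ \oo --> (0 : R)]) `|` [set (0 : R)].
    apply/seteqP; split => x; rewrite /A /= tnth_rcons_max;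
      (have -> : h ^~ [tuple of rcons v x] = f ^~ x by
        apply/funext => j; rewrite /h /f yE); by [].
  apply/negligibleP.
    apply: measurableU; last exact: measurable_set1.
    apply: measurableC; apply: measurable_cvg0 => j.
    apply: (@measurable_defect R _ (measurableTypeR R) sigma e.+1 p.*2 q j.+2
      (fun n x => (x : R) * n%:R ^+ e.+1 + b n)) => n.
    by apply: measurable_funD => //; apply: measurable_funM.
  apply: negligibleU; first exact: aeH.
  by exists [set 0]; split => //; exact: lebesgue_measure_set1.
move=> a /= na; apply: contrapT => nA; apply: na => a_ge0.
have hA : h ^~ a @ \oo --> (0 : R) by apply: contrapT => hn; apply: nA; left.
have al0 : 0 < (tnth a ord_max : R).
  by rewrite lt0r a_ge0 andbT; apply/eqP => a0; apply: nA; right.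
pose b (n : nat) : R := t + \sum_(j < e) (tnth a (widen_ord (leqnSn e) j) : R) * n%:R ^+ j.+1.
have yE : y ^~ a = (fun n => (tnth a ord_max : R) * n%:R ^+ e.+1 + b n).
  by apply/funext => n; rewrite /y /b big_ord_recr/= addrA addrC.
(* Nonnegative lower coefficients give [b n >= - |t|], and each lower power of [n] is at most [n^d];
   this is the growth condition of [sample_mean_square]. *)
pose T' := `|t| + \sum_(j < e) (tnth a (widen_ord (leqnSn e) j) : R).
have hb n : (0 < n)%N -> - `|t| <= b n <= T' * n%:R ^+ e.+1.
  move=> n0; apply/andP; split.
    rewrite /b -[leLHS]addr0; apply: lerD.
      by rewrite lerNl (le_trans (ler_norm _)) ?normrN.
    by apply: sumr_ge0 => j _; rewrite mulr_ge0// exprn_ge0.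
  rewrite /T' mulrDl; apply: lerD.
    by rewrite (le_trans (ler_norm _))// ler_peMr// n_ge1.
  rewrite mulr_suml; apply: ler_sum => j _; apply: ler_wpM2l; first exact: a_ge0.
  apply: ler_weXn2l; first by rewrite ler1n.
  exact: (leq_trans (ltn_ord j)).
have hdef : (fun j => defect sigma e.+1 p.*2 q j.+2
    (fun n => (tnth a ord_max : R) * n%:R ^+ e.+1 + b n)) @ \oo --> (0 : R).
  by rewrite -yE.
have [Z -> hZ] := sample_mean_square zetaP hsigma d0 q1 pq2 al0 hb hdef.
apply: (cvg_mean_complex (x := fun n => \sum_(j < e.+1) (tnth a j : R) * n%:R ^+ j.+1)).
move: hZ; apply: cvg_ext => N; congr (_ / _); apply: eq_bigr => n _.
by rewrite -(congr1 (fun f => f n) yE).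
Qed.
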